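(* The maps $D:\mathrm{Lip}_0([0,1],d)\to\bigoplus^\infty_{n\ge0}\ker(\mathbb{E}^{n-1})$ and $I:\bigoplus^\infty_{n\ge0}\ker(\mathbb{E}^{n-1})\to\mathrm{Lip}_0([0,1],d)$ are inverses of each other, and thus $D$ is an isomorphism. Moreover, the isomorphism constant $\|D\|\,\|D^{-1}\|$ is bounded by a constant depending only on the doubling constant of $([0,1],d)$.
   Context: Dyadic setup. For $k\ge0$ let $\mathcal{D}_k=\{[(j-1)2^{-k},j2^{-k}]:1\le j\le2^k\}$, $\mathcal{D}=\bigcup_k\mathcal{D}_k$, and $\mathrm{gen}(e)=k$ for $e\in\mathcal{D}_k$. The left and right halves of $e\in\mathcal D$ are its children $e_0,e_1$. A dyadic diameter function is $\Delta:\mathcal{D}\to(0,1]$ with $\Delta([0,1])=1$, for each $e$ either $\Delta(e_0)=\Delta(e_1)=\frac12\Delta(e)$ or $\Delta(e_0)=\Delta(e_1)=\Delta(e)$, and $\lim_{n\to\infty}\max_{e\in\mathcal{D}_n}\Delta(e)=0$. Its metric on $[0,1]$ is $d_\Delta(x,y)=\inf\sum_{k=0}^m\Delta(e^k)$, the infimum over finite sequences $e^0,\dots,e^m\in\mathcal{D}$ with $\{x,y\}\subset\bigcup_k e^k$ and $e^k\cap e^{k+1}\ne\emptyset$ for $k<m$. Standing assumptions: $\Delta$ is a fixed dyadic diameter function such that $([0,1],d)$, $d:=d_\Delta$, is doubling (every ball of radius $r$ is covered by at most a fixed number of balls of radius $r/2$), and $\Delta([0,\frac12])=\Delta([\frac12,1])=\Delta([0,1])=1$.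 For $n\ge0$: $\mathcal{A}_n$ is the $\sigma$-algebra on $[0,1]$ generated by the Lebesgue-null sets and $\{e\in\mathcal{D}:\Delta(e)\le2^{n-\mathrm{gen}(e)}\}$. $\mathcal{A}t_n$ is the set of $e\in\mathcal{D}\cap\mathcal{A}_n$ such that the only $e'\in\mathcal{D}\cap\mathcal{A}_n$ with $e'\subset e$ is $e'=e$. $\mathrm{Diff}_n=[0,1]\setminus\bigcup_{e\in\mathcal{A}t_n}\mathrm{int}(e)$. $\Delta_n$ is the dyadic diameter function with $\Delta_n(e')=2^{\mathrm{gen}(e)-\mathrm{gen}(e')}\Delta(e)$ if $e'\subset e\in\mathcal{A}t_n$, and $\Delta_n(e')=\Delta(e')$ otherwise; $d_n:=d_{\Delta_n}$ (bi-Lipschitz equivalent to the Euclidean metric, $d_n\le d$), and $\mathcal{H}^1_n$ is Hausdorff $1$-measure for $d_n$ (same null sets as Lebesgue measure). Function spaces. $\mathrm{Lip}_0([0,1],\rho)$ is the Banach space of $\rho$-Lipschitz $f:[0,1]\to\mathbb{R}$ with $f(0)=0$, normed by the optimal Lipschitz constant. $L^\infty(\mathcal{A}_n)=L^\infty([0,1],\mathcal{A}_n,\mathcal{H}^1_n)$. For $n\ge1$, $\mathbb{E}^{n-1}:L^\infty(\mathcal{A}_n)\to L^\infty(\mathcal{A}_{n-1})$ is $\mathbb{E}^{n-1}(g)=g1_{\mathrm{Diff}_{n-1}}+\sum_{e\in\mathcal{A}t_{n-1}}\big(\frac1{\mathcal{H}^1_n(e)}\int_e g\,d\mathcal{H}^1_n\big)1_e$;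 $\mathbb{E}^{-1}$ is the zero map on $L^\infty(\mathcal{A}_0)$. $\bigoplus^\infty$ denotes the $\ell^\infty$-sum. For $f\in\mathrm{Lip}_0([0,1],d_n)$, $f^{(n)}(x)=\lim_{y\to x^-}\frac{f(x)-f(y)}{d_n(y,x)}$ (which exists for a.e. $x$), set to $0$ where the limit fails to exist. For $f\in\mathrm{Lip}_0([0,1],d)$, the affinization $f_{\mathrm{aff}(n)}$ is the unique continuous function equal to $f$ on $\mathrm{Diff}_n$ and affine on each $e\in\mathcal{A}t_n$ (it lies in $\mathrm{Lip}_0([0,1],d_n)$). The maps. $D(f)=(D_n(f))_{n\ge0}$ with $D_n(f)=f_{\mathrm{aff}(n)}^{(n)}-\mathbb{E}^{n-1}\big(f_{\mathrm{aff}(n)}^{(n)}\big)$, where $f_{\mathrm{aff}(n)}^{(n)}=(f_{\mathrm{aff}(n)})^{(n)}$. $I((g_n)_{n\ge0})=\sum_{n\ge0}I_n(g_n)$ (pointwise sum, which converges absolutely), where $I_n(g)(x)=\int_{[0,x]}g\,d\mathcal{H}^1_n$. *)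

(* Defs.v *)
From HB Require Import structures.
From mathcomp Require Import all_boot all_order all_algebra.
From mathcomp Require Import all_classical all_reals all_analysis ess_sup_inf.

Set Implicit Arguments.
Unset Strict Implicit.
Unset Printing Implicit Defensive.

Import Order.TTheory GRing.Theory Num.Theory.
Import numFieldNormedType.Exports.

Local Open Scope classical_set_scope.
Local Open Scope ring_scope.

(* The interval [0,1] as a type, with the topology induced by R. *)
Definition I01 (R : realType) : Type := set_type (`[0, 1]%classic : set R).

HB.instance Definition _ (R : realType) :=
  Topological.copy (I01 R) (set_type (`[0, 1]%classic : set R)).

Definition rval (R : realType) (x : I01 R) : R := set_val x.

Lemma zero_in01 (R : realType) : (0 : R) \in (`[0, 1]%classic : set R).
Proof. by rewrite inE /= in_itv /= lexx ler01. Qed.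

Definition zero01 (R : realType) : I01 R := exist _ 0 (zero_in01 R).

HB.instance Definition _ (R : realType) := isPointed.Build (I01 R) (zero01 R).

Section HausdorffMeasure.
Local Open Scope ereal_scope.
Variables (R : realType) (T : Type) (d : T -> T -> R).

(* The maximum with 0 only serves to give the empty set diameter 0. *)
Definition ediam (A : set T) : \bar R :=
  maxe 0 (ereal_sup [set (d p.1 p.2)%:E | p in A `*` A]).

Definition hausdorff1_delta (delta : R) (A : set T) : \bar R :=
  ereal_inf [set \sum_(k <oo) ediam (U k) | U in
    [set U : (set T)^nat | A `<=` \bigcup_k U k /\
                           forall k, ediam (U k) <= delta%:E]].

Definition hausdorff1 (A : set T) : \bar R :=
  ereal_sup [set hausdorff1_delta delta A | delta in [set t : R | (0 < t)%R]].

Lemma ediam_ge0 A : 0 <= ediam A.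
Proof. by rewrite /ediam le_max lexx. Qed.

Lemma ediam0 : ediam set0 = 0.
Proof.
rewrite /ediam (_ : [set _ | _ in _] = set0); first by rewrite ereal_sup0 maxeNy.
by apply/seteqP; split => // x /= [p [[]]].
Qed.

Lemma hausdorff1_delta_ge0 t A : 0 <= hausdorff1_delta t A.
Proof.
apply: le_ereal_inf_tmp => _ [U _ <-].
by apply: nneseries_ge0 => k _ _; exact: ediam_ge0.
Qed.

Lemma le_hausdorff1_delta t : {homo hausdorff1_delta t : A B / A `<=` B >-> A <= B}.
Proof.
move=> A B AB; apply: ereal_inf_le_tmp => _ [U [BU dU] <-].
by exists U => //; split => //; exact: subset_trans AB BU.
Qed.

Lemma hausdorff1_delta0 t : (0 < t)%R -> hausdorff1_delta t set0 = 0.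
Proof.
move=> t0; apply/eqP; rewrite eq_le hausdorff1_delta_ge0 andbT.
apply: ereal_inf_lbound; exists (fun=> set0).
  by split => // k; rewrite ediam0 lee_fin ltW.
by apply: eseries0 => k _ _; exact: ediam0.
Qed.

Lemma hausdorff1_delta_sigma_subadditive t : sigma_subadditive (hausdorff1_delta t).
Proof.
move=> A; have [[i ioo]|] := pselect (exists i, hausdorff1_delta t (A i) = +oo).
  rewrite (eseries_pinfty _ _ ioo) ?leey// => n _.
  by rewrite -ltNye (lt_le_trans _ (hausdorff1_delta_ge0 _ _)).
rewrite -forallNE => Aoo.
apply/lee_addgt0Pr => e e0.
rewrite (le_trans _ (epsilon_trick _ _ (ltW e0)))//; last first.
  by move=> n; exact: hausdorff1_delta_ge0.
pose P n (B : (set T)^nat) := (A n `<=` \bigcup_k B k /\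
    forall k, ediam (B k) <= t%:E) /\
  \sum_(k <oo) ediam (B k) <=
    hausdorff1_delta t (A n) + (e / (2 ^ n.+1)%:R)%:E.
have [G PG] : {G : ((set T)^nat)^nat & forall n, P n (G n)}.
  apply: (@choice _ _ P) => n; rewrite /P /hausdorff1_delta.
  set S := (X in ereal_inf X); move infS : (ereal_inf S) => iS.
  case: iS infS => [r Sr|Soo|Soo].
  - have en1 : (0 < e / (2 ^ n.+1)%:R)%R by rewrite divr_gt0// ltr0n expn_gt0.
    have /(lb_ereal_inf_adherent en1) : ereal_inf S \is a fin_num by rewrite Sr.
    move=> [x [B AnB muBx] xS].
    by exists B; split => //; rewrite muBx -Sr; exact/ltW.
  - by have := Aoo n; rewrite /hausdorff1_delta -/S Soo.
  - by have := hausdorff1_delta_ge0 t (A n); rewrite /hausdorff1_delta -/S Soo.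
have muG_ge0 x : 0 <= (ediam \o uncurry G) x by exact: ediam_ge0.
apply: (@le_trans _ _ (\esum_(i in setT) (ediam \o uncurry G) i)).
  apply: ereal_inf_lbound => /=.
  have /card_esym/ppcard_eqP[f] := card_nat2.
  exists (uncurry G \o f).
    split => [x [n _ /(PG n).1.1 [k _ Gx]]|k /=].
      by exists (f^-1%FUN (n, k)) => //=; rewrite invK ?inE.
    by case: (f k) => n m /=; exact: (PG n).1.2.
  rewrite -(esum_pred_image (ediam \o uncurry G) _ xpredT) ?[fun=> _]set_true//.
  by rewrite image_eq.
rewrite (_ : esum _ _ = \sum_(i <oo) \sum_(j <oo) ediam (G i j)); last first.
  pose J : nat -> set (nat * nat) := fun i => [set (i, j) | j in setT].
  rewrite (_ : setT = \bigcup_k J k); last first.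
    by rewrite predeqE => -[a b]; split => // _; exists a => //; exists b.
  rewrite esum_bigcupT /=; last 2 first.
    - apply/trivIsetP => i j _ _ ij.
      rewrite predeqE => -[n m] /=; split => //= -[] [_] _ [<-{n} _].
      by move=> [m' _] [] /esym/eqP; rewrite (negbTE ij).
    - by move=> [n m]; exact: muG_ge0.
  rewrite -(image_id [set: nat]) -fun_true esum_pred_image//; last first.
    by move=> n _; apply: esum_ge0 => -[i j] _; exact: muG_ge0.
  apply: eq_eseriesr => /= j _.
  rewrite -(esum_pred_image (ediam \o uncurry G) (pair j) predT)//=; last 2 first.
    - by move=> n _; exact: ediam_ge0.
    - by move=> ? ? _ _; exact: (@can_inj _ _ _ snd).
  by congr esum; rewrite predeqE => -[a b]; split; move=> [i _ <-]; exists i.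
apply: lee_nneseries => [n _ _|n _]; last exact: (PG n).2.
by apply: nneseries_ge0 => k _ _; exact: ediam_ge0.
Qed.

Lemma hausdorff1_set0 : hausdorff1 set0 = 0.
Proof.
apply/eqP; rewrite eq_le; apply/andP; split.
  by apply: ge_ereal_sup => _ [t t0 <-]; rewrite hausdorff1_delta0.
rewrite -(hausdorff1_delta0 (@ltr01 R)).
by apply: ereal_sup_ubound; exists 1%R => //=; exact: ltr01.
Qed.

Lemma hausdorff1_ge0 A : 0 <= hausdorff1 A.
Proof.
apply: le_trans (hausdorff1_delta_ge0 1 A) _.
by apply: ereal_sup_ubound; exists 1%R => //=; exact: ltr01.
Qed.

Lemma le_hausdorff1 : {homo hausdorff1 : A B / A `<=` B >-> A <= B}.
Proof.
move=> A B AB; apply: ge_ereal_sup => _ [t t0 <-].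
apply: le_trans (le_hausdorff1_delta t AB) _.
by apply: ereal_sup_ubound; exists t.
Qed.

Lemma hausdorff1_sigma_subadditive : sigma_subadditive hausdorff1.
Proof.
move=> A; apply: ge_ereal_sup => _ [t t0 <-].
apply: le_trans (hausdorff1_delta_sigma_subadditive t A) _.
apply: lee_nneseries => [n _ _|n _]; first exact: hausdorff1_delta_ge0.
by apply: ereal_sup_ubound; exists t.
Qed.

HB.instance Definition _ := isOuterMeasure.Build R T hausdorff1
  hausdorff1_set0 hausdorff1_ge0 le_hausdorff1 hausdorff1_sigma_subadditive.

End HausdorffMeasure.

(* (k, j) with j < 2^k encodes the interval [j 2^-k, (j+1) 2^-k]; this is
   a bijection onto the set of dyadic intervals. *)
Definition dyadic : Type := {k : nat & 'I_(2 ^ k)}.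
HB.instance Definition _ := Countable.on dyadic.

Definition mkdyadic (k : nat) (j : 'I_(2 ^ k)) : dyadic :=
  existT (fun k : nat => 'I_(2 ^ k)) k j.

Definition gen (e : dyadic) : nat := projT1 e.

Definition idx (e : dyadic) : nat := projT2 e.

Lemma child_proof (b : bool) (e : dyadic) : ((idx e).*2 + b < 2 ^ (gen e).+1)%N.
Proof.
rewrite expnS mul2n; case: e => k [j jk] /=; rewrite /idx /gen /=.
by case: b; rewrite ?addn1 ?addn0 ?ltn_double// -doubleS -leq_double in jk *.
Qed.

(* The left child for b = false, the right child for b = true. *)
Definition child (b : bool) (e : dyadic) : dyadic :=
  mkdyadic (Ordinal (child_proof b e)).

Definition dtop : dyadic := @mkdyadic 0 ord0.

Section Dyadic.
Variable R : realType.
Local Notation I := (I01 R).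

Definition ditvR (e : dyadic) : set R :=
  `[(idx e)%:R / 2 ^+ gen e, (idx e).+1%:R / 2 ^+ gen e]%classic.

Definition ditv (e : dyadic) : set I := @rval R @^-1` ditvR e.

(* The interior is taken in R, so 0 and 1 are not in the interior of any
   dyadic interval. *)
Definition dint (e : dyadic) : set I := @rval R @^-1` (ditvR e)°.

Definition dyadic_diameter (Delta : dyadic -> R) : Prop :=
  [/\ forall e, 0 < Delta e <= 1,
      Delta dtop = 1,
      forall e,
        (Delta (child false e) = Delta e / 2 /\
         Delta (child true e) = Delta e / 2) \/
        (Delta (child false e) = Delta e /\ Delta (child true e) = Delta e) &
      (fun n => \big[Num.max/0]_(j < 2 ^ n) Delta (mkdyadic j)) @ \oo --> (0 : R)].

Definition chain (x y : I) (s : seq dyadic) : Prop :=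
  [/\ exists2 e, e \in s & ditv e x,
      exists2 e, e \in s & ditv e y &
      forall k, (k.+1 < size s)%N ->
        ditv (nth dtop s k) `&` ditv (nth dtop s k.+1) !=set0].

Definition dmetric (Delta : dyadic -> R) (x y : I) : R :=
  inf [set \sum_(e <- s) Delta e | s in chain x y].

(* Every ball of radius r is covered by N balls of radius r/2. *)
Definition doubling (N : nat) (rho : I -> I -> R) : Prop :=
  forall (x : I) (r : R), 0 < r ->
    exists c : 'I_N -> I,
      [set y | rho x y < r] `<=` \bigcup_(i in [set: 'I_N]) [set y | rho (c i) y < r / 2].

Definition is_lipschitz (rho : I -> I -> R) (f : I -> R) (L : R) : Prop :=
  0 <= L /\ forall x y, `|f x - f y| <= L * rho x y.

Definition Lip0 (rho : I -> I -> R) (f : I -> R) : Prop :=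
  (exists L, is_lipschitz rho f L) /\ f (zero01 R) = 0.

Definition lip_norm (rho : I -> I -> R) (f : I -> R) : R :=
  inf [set L | is_lipschitz rho f L].

(* [set y | y < x] accumulates at x only if x > 0, whence the first condition. *)
Definition left_derivative (rho : I -> I -> R) (f : I -> R) (x : I) : R :=
  let F := (fun y => (f x - f y) / rho y x) @
             within [set y : I | rval y < rval x] (nbhs x) in
  if `[< 0 < rval x /\ cvg F >] then lim F else 0.

Section Fixed.
Variable Delta : dyadic -> R.

Definition An_gen (n : nat) : set (set I) :=
  [set A | lebesgue_measure.-negligible (@rval R @` A)] `|`
  [set ditv e | e in [set e | Delta e <= 2 ^+ n / 2 ^+ gen e]].

Definition An (n : nat) : set (set I) := <<s An_gen n >>.

Definition At (n : nat) : set dyadic :=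
  [set e | An n (ditv e) /\
    forall e', An n (ditv e') -> ditv e' `<=` ditv e -> e' = e].

Definition Diff (n : nat) : set I := ~` \bigcup_(e in At n) dint e.

(* The atom containing e', if there is one, is unique; otherwise e = e' and
   the formula reduces to Delta e'. *)
Definition Deltan (n : nat) (e' : dyadic) : R :=
  let e := xget e' [set e | At n e /\ ditv e' `<=` ditv e] in
  2 ^+ gen e / 2 ^+ gen e' * Delta e.

Definition dn (n : nat) : I -> I -> R := dmetric (Deltan n).

Definition hausdorffn (n : nat) : {outer_measure set I -> \bar R} :=
  hausdorff1 (dn n).

(* The 1-dimensional Hausdorff measure of d_n, on the Caratheodory measurable
   sets. *)
Definition Hn (n : nat) :
    {measure set (caratheodory_type (hausdorffn n)) -> \bar R} :=
  [the {measure set (caratheodory_type (hausdorffn n)) -> \bar R} of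
    (hausdorffn n : set (caratheodory_type (hausdorffn n)) -> \bar R)].

Definition eq_ae (n : nat) (g h : I -> R) : Prop :=
  {ae Hn n, forall x, g x = h x}.

(* Functions representing elements of L^oo(A_n), two of which represent the
   same element when they are related by eq_ae n. *)
Definition Linf_norm (n : nat) (g : I -> R) : \bar R :=
  ess_sup (Hn n) (fun x => `|g x|%:E).

Definition Linf (n : nat) (g : I -> R) : Prop :=
  measurable_fun setT (g : g_sigma_algebraType (An_gen n) -> R) /\
  (Linf_norm n g < +oo)%E.

(* condexp n is the operator with superscript n - 1, with domain L^oo(A_n). *)
Definition condexp (n : nat) (g : I -> R) : I -> R :=
  if n is m.+1 then
    fun x => g x * \1_(Diff m) x +
      \sum_(e \in At m)
        ((fine (Hn n (ditv e)))^-1 * \int[Hn n]_(y in ditv e) g y) * \1_(ditv e) x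
  else fun=> 0.

Definition sum_norm (g : nat -> I -> R) : \bar R :=
  ereal_sup (range (fun n => Linf_norm n (g n))).

(* Representatives of the elements of the l^oo-sum of the kernels. *)
Definition sum_ker (g : nat -> I -> R) : Prop :=
  (forall n, Linf n (g n) /\ eq_ae n (condexp n (g n)) (fun=> 0)) /\
  (sum_norm g < +oo)%E.

Definition is_affinization (n : nat) (f h : I -> R) : Prop :=
  [/\ continuous h,
      forall x, Diff n x -> h x = f x &
      forall e, At n e -> exists a b : R, forall x, ditv e x -> h x = a * rval x + b].

Definition affinization (n : nat) (f : I -> R) : I -> R :=
  xget f [set h | is_affinization n f h].

Definition Dmap_n (n : nat) (f : I -> R) : I -> R :=
  let f' := left_derivative (dn n) (affinization n f) in
  fun x => f' x - condexp n f' x.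

Definition Dmap (f : I -> R) : nat -> I -> R := fun n => Dmap_n n f.

Definition Imap_n (n : nat) (g : I -> R) (x : I) : R :=
  \int[Hn n]_(y in [set y : I | rval y <= rval x]) g y.

Definition Imap (g : nat -> I -> R) (x : I) : R :=
  limn (series (fun n => Imap_n n (g n) x)).

Definition Dmap_norm : \bar R :=
  ereal_sup [set sum_norm (Dmap f) | f in
    [set f | Lip0 (dmetric Delta) f /\ lip_norm (dmetric Delta) f <= 1]].

Definition Imap_norm : \bar R :=
  ereal_sup [set (lip_norm (dmetric Delta) (Imap g))%:E | g in
    [set g | sum_ker g /\ (sum_norm g <= 1)%E]].

End Fixed.
End Dyadic.

(* Main.v *)
Require Import Defs.
From HB Require Import structures.
From mathcomp Require Import all_boot all_order all_algebra.
From mathcomp Require Import all_classical all_reals all_analysis ess_sup_inf measurable_realfun.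
From mathcomp Require Import ring lra zify.

Set Implicit Arguments.
Unset Strict Implicit.
Unset Printing Implicit Defensive.

Import Order.TTheory GRing.Theory Num.Theory.
Import numFieldNormedType.Exports.

Local Open Scope classical_set_scope.
Local Open Scope ring_scope.

(** The weight of a dyadic interval e is 2^gen(e) Delta(e), its diameter divided
    by its length. It is a power of 2 which is kept or doubled on passing to a
    child, so the intervals of weight at most 2^n form a tree; they are the
    intervals of A_n, and the leaves of the tree are the atoms of A_n ([At_leaf]).
    Truncating the weight at 2^n gives Delta_n ([DeltanE]). Both halves of an
    atom of A_(n-1) have weight 2^n, hence d_n is 2^n times the Euclidean metric
    on each half, and H_n is 2^n times Lebesgue measure on the atom
    ([mu_block]). All metric lower bounds come from one observation: a bound on
    the oscillations over dyadic intervals passes to the chain metric, because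
    consecutive members of a chain meet ([osc_dmetric]).

    I is bounded. If g lies in the kernel at level n, its mean over each atom of
    A_(n-1) is zero and it vanishes on Diff_(n-1), so that I_n g vanishes on
    Diff_(n-1) ([Imap_n_Diff]). Its Euclidean Lipschitz constant is at most
    2^n times a bound M for g, so on an atom it is at most 2 M times the diameter
    of the atom ([Imap_n_tail]). Doubling makes the diameters of nested atoms
    decrease geometrically: were they constant over N^3+1 levels, the siblings of
    the intervals between them would provide N^3+1 well separated points in a
    small ball ([Delta_halves]). So on a dyadic interval e of weight 2^m the
    terms with n <= m contribute a geometric sum of slopes, the later terms a
    geometric sum of atom diameters, and both are of order Delta(e)
    ([Imap_osc]). By the oscillation principle, I maps into the Lipschitz
    functions ([Imap_lipschitz]).

    I is injective. The terms with index above n vanish on Diff_n, while I_n g_n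
    is affine on the atoms of A_n because g_n is constant there; by induction on
    n each term of a vanishing sum vanishes, and then so does each g_n almost
    everywhere ([Imap_inj]).

    I D f = f. The affinization of f is Lipschitz for the Euclidean metric, so it
    is an integral of its derivative ([lipschitz_density]), and the derivative
    with respect to d_n is the Euclidean one divided by 2^n. Secants over dyadic
    intervals show that the latter is bounded by the Lipschitz constant L of f
    and A_n-measurable ([aff_density]). Subtracting the conditional expectation
    subtracts the slope of the previous affinization, so D_n f is bounded by 2 L
    and I_n D_n f is the difference of the affinizations of levels n and n-1
    ([Imap_n_Dmap]). The sum telescopes, and the affinizations converge to f, the
    error at x being at most 2 L times the diameter of the atom of A_n around x
    ([Imap_Dmap]).

    The identity D I = id and the linearity of D need no computation: I is linear
    and injective, and I D = id. The norms are at most 2 for D and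
    2 + 8 (N^3 + 1) for I. *)

(** * The tree of dyadic intervals *)

Lemma dyadic_eq (e e' : dyadic) : gen e = gen e' -> idx e = idx e' -> e = e'.
Proof.
case: e e' => k j [k' j'] /= kk'; move: kk' j j'; rewrite /gen /= => <- j j' jj'.
by congr existT; apply: val_inj.
Qed.

Lemma idx_lt (e : dyadic) : (idx e < 2 ^ gen e)%N.
Proof. by case: e => k j; exact: ltn_ord. Qed.

Lemma gen_child b e : gen (child b e) = (gen e).+1.
Proof. by []. Qed.

Lemma idx_child b e : idx (child b e) = ((idx e).*2 + b)%N.
Proof. by []. Qed.

(** The residue only makes the index legal: it is applied with j < 2^k. *)
Definition dy (k j : nat) : dyadic :=
  mkdyadic (Ordinal (ltn_pmod j (expn_gt0 2 k))).

Lemma gen_dy k j : gen (dy k j) = k.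
Proof. by []. Qed.

Lemma idx_dy k j : (j < 2 ^ k)%N -> idx (dy k j) = j.
Proof. by move=> jk; rewrite /idx /= modn_small. Qed.

Lemma dyadic_tree_ind (P : dyadic -> Prop) :
  P dtop -> (forall b e, P e -> P (child b e)) -> forall e, P e.
Proof.
move=> P0 PS e; move ek : (gen e) => k.
elim: k e ek => [|k IH] e ek.
  suff -> : e = dtop by [].
  by apply: dyadic_eq => //; have := idx_lt e; rewrite ek expn0 ltnS leqn0 => /eqP.
have jk : ((idx e)./2 < 2 ^ k)%N.
  by have := idx_lt e; rewrite ek expnS; lia.
have -> : e = child (odd (idx e)) (dy k (idx e)./2).
  apply: dyadic_eq; first by rewrite gen_child gen_dy.
  by rewrite idx_child idx_dy // addnC odd_double_half.
exact: PS (IH _ _).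
Qed.

(** Containment of e' in e ([anc_ditv], [ditv_anc]), put as arithmetic of the
    indices, so that it can be handled by induction on generations. *)
Definition anc (e e' : dyadic) : bool :=
  (gen e <= gen e')%N && (idx e' %/ 2 ^ (gen e' - gen e) == idx e)%N.

Lemma ancxx e : anc e e.
Proof. by rewrite /anc leqnn subnn expn0 divn1 eqxx. Qed.

Lemma anc_gen e e' : anc e e' -> (gen e <= gen e')%N.
Proof. by case/andP. Qed.

Lemma anc_child e e' b : anc e e' -> anc e (child b e').
Proof.
move=> /andP[gg /eqP ii]; rewrite /anc gen_child idx_child (leqW gg) /=.
rewrite subSn // expnS divnMA -ii.
suff -> : (((idx e').*2 + b) %/ 2 = idx e')%N by [].
by case: b; lia.
Qed.

Lemma anc_childP e e' b : anc e (child b e') -> e = child b e' \/ anc e e'.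
Proof.
move=> /andP[]; rewrite gen_child idx_child leq_eqVlt => /orP[/eqP gg|].
  rewrite gg subnn expn0 divn1 => /eqP ii; left.
  by apply: dyadic_eq; rewrite ?gg.
rewrite ltnS => gg; rewrite subSn // expnS divnMA => /eqP ii; right.
rewrite /anc gg /= -ii; apply/eqP; congr (_ %/ _)%N.
by case: b ii => _; lia.
Qed.

Lemma anc_ind e (P : dyadic -> Prop) :
  P e -> (forall b e', anc e e' -> P e' -> P (child b e')) ->
  forall e', anc e e' -> P e'.
Proof.
move=> P0 PS; apply: dyadic_tree_ind => [|b e' IH].
  move=> /andP[]; rewrite leqn0 => /eqP g0; rewrite g0 => /eqP i0.
  by suff <- : e = dtop; last by apply: dyadic_eq; rewrite // -i0.
by move=> /anc_childP[<- //|ee']; apply: PS => //; exact: IH.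
Qed.

Lemma dtop_anc e : anc dtop e.
Proof. by elim/dyadic_tree_ind: e => [|b e]; [exact: ancxx|exact: anc_child]. Qed.

Lemma anc_trans e2 e1 e3 : anc e1 e2 -> anc e2 e3 -> anc e1 e3.
Proof.
move=> e12; move: e3; apply: anc_ind => // b e' _; exact: anc_child.
Qed.

Lemma anc_cases e e' : anc e e' -> e = e' \/ exists b, anc (child b e) e'.
Proof.
move: e'; apply: anc_ind => [|b e' _ [<-|[b' h]]]; [by left|right..].
  by exists b; exact: ancxx.
by exists b'; exact: anc_child.
Qed.

Section Geometry.
Variable R : realType.
Local Notation I := (I01 R).
Implicit Types (x y : I) (t : R).

Definition len (e : dyadic) : R := (2 ^+ gen e)^-1.
Definition lo (e : dyadic) : R := (idx e)%:R / 2 ^+ gen e.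
Definition hi (e : dyadic) : R := (idx e).+1%:R / 2 ^+ gen e.

Lemma p2_gt0 (k : nat) : 0 < 2 ^+ k :> R.
Proof. by rewrite exprn_gt0. Qed.

Lemma len_gt0 e : 0 < len e.
Proof. by rewrite invr_gt0 p2_gt0. Qed.

Lemma hiE e : hi e = lo e + len e.
Proof. by rewrite /hi -addn1 natrD mulrDl mul1r. Qed.

Lemma lo_lt_hi e : lo e < hi e.
Proof. by rewrite hiE ltrDl len_gt0. Qed.

Lemma lo_ge0 e : 0 <= lo e.
Proof. by rewrite divr_ge0 // exprn_ge0. Qed.

Lemma hi_le1 e : hi e <= 1.
Proof.
by rewrite ler_pdivrMr ?p2_gt0 // mul1r -natrX ler_nat; exact: idx_lt.
Qed.

Lemma len_child b e : len (child b e) = len e / 2.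
Proof. by rewrite /len gen_child exprS invfM mulrC. Qed.

Lemma lo_child b e : lo (child b e) = lo e + b%:R * (len e / 2).
Proof.
rewrite /lo /len gen_child idx_child exprS natrD -muln2 natrM.
by field; rewrite expf_neq0.
Qed.

Lemma lo_dtop : lo dtop = 0. Proof. by rewrite /lo mul0r. Qed.
Lemma hi_dtop : hi dtop = 1. Proof. by rewrite /hi expr0 divr1. Qed.

Lemma anc_lohi e e' : anc e e' -> lo e <= lo e' /\ hi e' <= hi e.
Proof.
move: e'; apply: anc_ind => [//|b e' _ [h1 h2]].
have l := len_gt0 e'; rewrite hiE len_child lo_child; move: h2; rewrite hiE.
by case: b => /= h2; rewrite ?mul1r ?mul0r; split; lra.
Qed.

(** After scaling by the larger power of 2 the overlap becomes a pair of strict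
    inequalities between integers. *)
Lemma overlap_anc e e' t : lo e < t < hi e -> lo e' < t < hi e' ->
  (gen e <= gen e')%N -> anc e e'.
Proof.
rewrite /lo /hi => /andP[a1 a2] /andP[b1 b2] gg; rewrite /anc gg /=.
move: a1 a2 b1 b2; rewrite -(subnK gg); set d := (gen e' - gen e)%N.
rewrite addnK => a1 a2 b1 b2; apply/eqP.
have pg := p2_gt0 (gen e); have pd := p2_gt0 d.
move: a1 a2 b1 b2; rewrite exprD ltr_pdivrMr // ltr_pdivlMr //.
rewrite ltr_pdivrMr ?mulr_gt0 // ltr_pdivlMr ?mulr_gt0 // => a1 a2 b1 b2.
have c1 : (idx e * 2 ^ d < (idx e').+1)%N.
  rewrite -(ltr_nat R) natrM natrX; apply: lt_trans b2.
  by rewrite (mulrC (2 ^+ d)) mulrA ltr_pM2r.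
have c2 : (idx e' < (idx e).+1 * 2 ^ d)%N.
  rewrite -(ltr_nat R) natrM natrX; apply: lt_trans b1 _.
  by rewrite (mulrC (2 ^+ d)) mulrA ltr_pM2r.
apply/eqP; rewrite eqn_leq; apply/andP; split.
  by rewrite -ltnS ltn_divLR ?expn_gt0.
by rewrite leq_divRL ?expn_gt0.
Qed.

Lemma overlap e e' t : lo e < t < hi e -> lo e' < t < hi e' ->
  anc e e' \/ anc e' e.
Proof.
move=> h h'; have [gg|/ltnW gg] := leqP (gen e) (gen e').
  by left; exact: overlap_anc h h' gg.
by right; exact: overlap_anc h' h gg.
Qed.

Fact clamp_in01 t : (Num.max 0 (Num.min t 1) : R) \in (`[0, 1]%classic : set R).
Proof. by rewrite inE /= in_itv /= le_max lexx /= ge_max ler01 ge_min lexx orbT. Qed.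

(** Clamping makes this a total left inverse of rval, so that endpoints of dyadic
    intervals are points of [0,1] without side conditions. *)
Definition pt t : I := exist _ (Num.max 0 (Num.min t 1)) (clamp_in01 t).

Lemma rvalP x : 0 <= rval x <= 1.
Proof. by have := set_valP x; rewrite /= in_itv. Qed.

Lemma rval_ptE t : rval (pt t) = Num.max 0 (Num.min t 1).
Proof. by []. Qed.

Lemma rval_pt t : 0 <= t <= 1 -> rval (pt t) = t.
Proof. by move=> /andP[t0 t1]; rewrite rval_ptE (min_idPl t1) (max_idPr t0). Qed.

Lemma rval_inj : injective (@rval R).
Proof. exact: val_inj. Qed.

Lemma ptK x : pt (rval x) = x.
Proof. by apply: rval_inj; rewrite rval_pt ?rvalP. Qed.

Lemma ditvE e x : ditv e x = (lo e <= rval x <= hi e) :> Prop.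
Proof. by rewrite /ditv /ditvR /preimage /= in_itv /=. Qed.

Lemma dintE e x : dint e x = (lo e < rval x < hi e) :> Prop.
Proof.
rewrite /dint /ditvR interior_itv_bnd.
by rewrite /preimage /= in_itv.
Qed.

Lemma dint_ditv e : @dint R e `<=` ditv e.
Proof. by move=> x; rewrite dintE ditvE => /andP[/ltW -> /ltW ->]. Qed.

Lemma rval_lo e : rval (pt (lo e)) = lo e.
Proof. by rewrite rval_pt // lo_ge0 (le_trans _ (hi_le1 e)) // ltW // lo_lt_hi. Qed.

Lemma rval_hi e : rval (pt (hi e)) = hi e.
Proof. by rewrite rval_pt // hi_le1 (le_trans (lo_ge0 e)) // ltW // lo_lt_hi. Qed.

Lemma ditv_lo e : ditv e (pt (lo e)).
Proof. by rewrite ditvE rval_lo lexx ltW // lo_lt_hi. Qed.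

Lemma ditv_hi e : ditv e (pt (hi e)).
Proof. by rewrite ditvE rval_hi lexx ltW // lo_lt_hi. Qed.

Definition mid e : R := lo e + len e / 2.

Lemma mid_in e : lo e < mid e < hi e.
Proof. by rewrite hiE /mid; have := len_gt0 e; lra. Qed.

Lemma rval_mid e : rval (pt (mid e)) = mid e.
Proof.
rewrite rval_pt //; have := mid_in e; have := lo_ge0 e; have := hi_le1 e; lra.
Qed.

Lemma ditv_dtop x : ditv dtop x.
Proof. by rewrite ditvE lo_dtop hi_dtop rvalP. Qed.

Lemma anc_ditv e e' : anc e e' -> @ditv R e' `<=` ditv e.
Proof.
move=> /anc_lohi[h1 h2] x; rewrite !ditvE => /andP[h3 h4].
by rewrite (le_trans h1) // (le_trans h4).
Qed.

Lemma anc_dint e e' : anc e e' -> @dint R e' `<=` dint e.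
Proof.
move=> /anc_lohi[h1 h2] x; rewrite !dintE => /andP[h3 h4].
by rewrite (le_lt_trans h1) // (lt_le_trans h4).
Qed.

Lemma ditv_anc e e' : @ditv R e' `<=` ditv e -> anc e e'.
Proof.
move=> sub; have := sub _ (ditv_lo e'); have := sub _ (ditv_hi e').
rewrite !ditvE rval_lo rval_hi => /andP[h1 h2] /andP[h3 h4].
have := mid_in e' => /andP[m1 m2].
apply: (@overlap_anc _ _ (mid e')); rewrite ?m1 ?m2 //.
  by rewrite (le_lt_trans h3) // (lt_le_trans m2).
have : len e' <= len e by move: h2; rewrite !hiE; lra.
by rewrite lef_pV2 ?posrE ?p2_gt0 // ler_eXn2l // ltr1n.
Qed.

Lemma overlap_dint e e' x : dint e x -> dint e' x -> anc e e' \/ anc e' e.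
Proof. by rewrite !dintE; exact: overlap. Qed.

(** The minimum puts the point 1 into the last interval. *)
Definition pos (k : nat) x : nat :=
  minn (Num.truncn (rval x * 2 ^+ k)) (2 ^ k).-1.

Lemma pos_lt k x : (pos k x < 2 ^ k)%N.
Proof. by rewrite /pos gtn_min prednK ?expn_gt0 // leqnn orbT. Qed.

Lemma ditv_pos k x : ditv (dy k (pos k x)) x.
Proof.
rewrite ditvE /lo /hi gen_dy idx_dy ?pos_lt // /pos.
have /andP[x0 x1] := rvalP x; have pk := p2_gt0 k.
have rx0 : 0 <= rval x * 2 ^+ k by rewrite mulr_ge0 // ltW.
have /andP[t1 t2] := truncn_itv rx0.
rewrite ler_pdivrMr // ler_pdivlMr //; apply/andP; split.
  by apply: le_trans t1; rewrite ler_nat geq_minl.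
have [h|h] := leqP (Num.truncn (rval x * 2 ^+ k)) (2 ^ k).-1; first exact: ltW.
by rewrite prednK ?expn_gt0 // natrX ler_piMl // ltW.
Qed.

Definition dyadic_pt : set I := [set x | exists e, rval x = lo e \/ rval x = hi e].

Lemma ditv_dint e x : ~ dyadic_pt x -> ditv e x -> dint e x.
Proof.
move=> nx; rewrite ditvE dintE => /andP[h1 h2]; rewrite !lt_neqAle h1 h2 !andbT.
by apply/andP; split; apply/eqP => h; apply: nx; exists e; [left|right].
Qed.

End Geometry.
Arguments dyadic_pt R : clear implicits.

(** * Lebesgue null subsets of the unit interval *)

Section NullSets.
Variable R : realType.
Local Notation I := (I01 R).

Definition lneg (A : set I) : Prop := lebesgue_measure.-negligible (@rval R @` A).

Lemma bigcup_countType (T : Type) (J : countType) (P : set J) (F : J -> set T) :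
  \bigcup_(j in P) F j =
  \bigcup_k (if unpickle k is Some j then [set x | P j /\ F j x] else set0).
Proof.
apply/seteqP; split => [x [j Pj Fjx]|x [k _]].
  by exists (pickle j) => //; rewrite pickleK.
by case: (unpickle k) => // j [Pj Fjx]; exists j.
Qed.

Lemma lnegS (A B : set I) : A `<=` B -> lneg B -> lneg A.
Proof. by move=> AB; apply: negligibleS; exact: image_subset. Qed.

Lemma lneg0 : lneg set0.
Proof. by rewrite /lneg image_set0; exact: negligible_set0. Qed.

Lemma lneg_bigcup (F : (set I)^nat) : (forall k, lneg (F k)) -> lneg (\bigcup_k F k).
Proof. by move=> h; rewrite /lneg image_bigcup; exact: negligible_bigcup. Qed.

Lemma lnegU (A B : set I) : lneg A -> lneg B -> lneg (A `|` B).
Proof. by move=> hA hB; rewrite /lneg image_setU; exact: negligibleU. Qed.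

Lemma lneg_countable (J : countType) (P : set J) (F : J -> set I) :
  (forall j, P j -> lneg (F j)) -> lneg (\bigcup_(j in P) F j).
Proof.
move=> h; rewrite bigcup_countType; apply: lneg_bigcup => k.
case: (unpickle k) => [j|]; last exact: lneg0.
have [Pj|nPj] := pselect (P j); first by apply: lnegS (h _ Pj) => x [].
by apply: lnegS lneg0 => x [].
Qed.

Lemma lneg_rval (r : R) : lneg [set x | rval x = r].
Proof.
have : lebesgue_measure.-negligible [set r].
  by apply/negligibleP; [exact: measurable_set1|exact: lebesgue_measure_set1].
by apply: negligibleS => _ [x /= -> <-].
Qed.

Lemma lneg_dyadic_pt : lneg (dyadic_pt R).
Proof.
suff : lneg (\bigcup_(e in [set: dyadic])
    ([set x | rval x = lo R e] `|` [set x | rval x = hi R e])).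
  by apply: lnegS => x [e [h|h]]; exists e => //; [left|right].
by apply: lneg_countable => e _; apply: lnegU; exact: lneg_rval.
Qed.

Lemma not_lneg_dint e : ~ lneg (dint e).
Proof.
have -> : lneg (dint e) = lebesgue_measure.-negligible `]lo R e, hi R e[%classic.
  congr (_.-negligible _); apply/seteqP; split => [_ [x + <-]|t /=].
    by rewrite dintE /= in_itv.
  rewrite in_itv /= => tl.
  have rt : rval (pt t) = t.
    by rewrite rval_pt //; have := lo_ge0 R e; have := hi_le1 R e; lra.
  by exists (pt t); rewrite // dintE rt.
move=> /negligibleP => /(_ (measurable_itv _)) /=; rewrite lebesgue_measure_itv /= lte_fin.
by rewrite lo_lt_hi => /eqP; rewrite -EFinB eqe subr_eq0 gt_eqF // lo_lt_hi.
Qed.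

End NullSets.

(** * Weights and leaves *)

Section Weights.
Variables (R : realType) (Delta : dyadic -> R).
Hypothesis DD : dyadic_diameter Delta.

(** The diameter divided by the Euclidean length; the condition on the generators
    of A_n reads wt e <= 2^n ([gen_An]). *)
Definition wt (e : dyadic) : R := 2 ^+ gen e * Delta e.

Lemma Delta_gt0 e : 0 < Delta e.
Proof. by case: DD => /(_ e)/andP[]. Qed.

Lemma Delta_wt e : Delta e = wt e * len R e.
Proof. by rewrite /wt /len mulrAC divff ?mul1r // expf_neq0. Qed.

Lemma wt_gt0 e : 0 < wt e.
Proof. by rewrite mulr_gt0 // ?exprn_gt0 // Delta_gt0. Qed.

Lemma wt_dtop : wt dtop = 1.
Proof. by case: DD => _ D1 _ _; rewrite /wt D1 expr0 mul1r. Qed.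

Lemma wt_child e : (forall b, wt (child b e) = wt e) \/ (forall b, wt (child b e) = 2 * wt e).
Proof.
case: DD => _ _ /(_ e) [] [h1 h2] _; [left|right] => b; rewrite /wt gen_child exprS.
  by case: b; rewrite ?h1 ?h2; field.
by case: b; rewrite ?h1 ?h2; ring.
Qed.

Lemma wt_pow e : exists p : nat, wt e = 2 ^+ p.
Proof.
elim/dyadic_tree_ind: e => [|b e [p ep]]; first by exists 0%N; rewrite wt_dtop.
case: (wt_child e) => /(_ b) ->; [by exists p|exists p.+1].
by rewrite exprS ep.
Qed.

Lemma pow2_le (p n : nat) : (2 ^+ p <= 2 ^+ n :> R) = (p <= n)%N.
Proof. by rewrite ler_eXn2l // ltr1n. Qed.

Lemma pow2_lt (p n : nat) : (2 ^+ p < 2 ^+ n :> R) = (p < n)%N.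
Proof. by rewrite ltr_eXn2l // ltr1n. Qed.

Lemma wt_gt_pow n e : 2 ^+ n < wt e -> 2 ^+ n.+1 <= wt e.
Proof. by have [p ->] := wt_pow e; rewrite pow2_le pow2_lt. Qed.

Lemma wt_child_le b e : wt e <= wt (child b e).
Proof. by have := wt_gt0 e; case: (wt_child e) => /(_ b) ->; lra. Qed.

Lemma wt_anc e e' : anc e e' -> wt e <= wt e'.
Proof.
move: e'; apply: anc_ind => // b e' _ /le_trans; apply; exact: wt_child_le.
Qed.

Lemma Delta_anc e e' : anc e e' -> Delta e' <= Delta e.
Proof.
move: e'; apply: anc_ind => // b e' _; apply: le_trans.
have := Delta_gt0 e'; case: DD => _ _ /(_ e') [] [h1 h2] _;
  by case: b; rewrite ?h1 ?h2; lra.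
Qed.

(** The combinatorial form of the atoms of A_n; see [At_leaf]. *)
Definition leaf (n : nat) (e : dyadic) : Prop :=
  wt e = 2 ^+ n /\ forall b, wt (child b e) = 2 ^+ n.+1.

Lemma leaf_of_child n e b : wt e <= 2 ^+ n -> 2 ^+ n < wt (child b e) -> leaf n e.
Proof.
move=> h1 h2; have := wt_gt_pow h2.
case: (wt_child e) => h; rewrite h in h2 *; first by move: h1; rewrite leNgt h2.
rewrite exprS ler_pM2l // => h3.
have we : wt e = 2 ^+ n by apply: le_anti; rewrite h1 h3.
by split => // b'; rewrite h we exprS.
Qed.

(** On the way from the root to an interval of weight above 2^n the weight
    doubles, so it passes through 2^n at a last interval. *)
Lemma leaf_ex n e : 2 ^+ n < wt e -> exists l b, leaf n l /\ anc (child b l) e.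
Proof.
elim/dyadic_tree_ind: e => [|b e IH].
  by rewrite wt_dtop ltNge exprn_ege1 // ler1n.
move=> h; have [/IH [l [b' [ll a]]]|h'] := ltP (2 ^+ n) (wt e).
  by exists l, b'; split => //; exact: anc_child.
by exists e, b; split; [exact: leaf_of_child h|exact: ancxx].
Qed.

(** Below a leaf all weights exceed 2^n. *)
Lemma leaf_anc n l e : leaf n l -> wt e <= 2 ^+ n -> anc l e -> l = e.
Proof.
move=> [_ lc] we /anc_cases[//|[b /wt_anc]]; rewrite lc => h.
by have := le_trans h we; rewrite pow2_le ltnn.
Qed.

Lemma leaf_wt n l : leaf n l -> wt l <= 2 ^+ n.
Proof. by case=> ->. Qed.

Lemma leaf_overlap n l e (x : I01 R) : leaf n l -> wt e <= 2 ^+ n ->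
  dint l x -> dint e x -> anc e l.
Proof.
move=> ll we lx ex; case: (overlap_dint lx ex) => // a.
by rewrite (leaf_anc ll we a); exact: ancxx.
Qed.

Lemma leaf_uniq n l l' (x : I01 R) : leaf n l -> leaf n l' ->
  dint l x -> dint l' x -> l = l'.
Proof.
move=> ll ll' lx lx'.
by have /(leaf_anc ll' (leaf_wt ll)) := leaf_overlap ll (leaf_wt ll') lx lx'.
Qed.

Lemma leaf_Delta n l : leaf n l -> Delta l = 2 ^+ n * len R l.
Proof. by case=> h _; rewrite Delta_wt h. Qed.

(** ** The sigma-algebras A_n and their atoms *)

Local Notation I := (I01 R).

Lemma sigma_algebra_An n : sigma_algebra setT (An Delta n).
Proof. exact: smallest_sigma_algebra. Qed.

Lemma An_lneg n A : lneg A -> An Delta n A.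
Proof. by move=> h; apply: sub_sigma_algebra; left. Qed.

Lemma gen_An n e : (Delta e <= 2 ^+ n / 2 ^+ gen e) = (wt e <= 2 ^+ n).
Proof. by rewrite ler_pdivlMr ?exprn_gt0 // mulrC. Qed.

Lemma An_dyadic n e : wt e <= 2 ^+ n -> An Delta n (ditv e).
Proof.
by move=> h; apply: sub_sigma_algebra; right; exists e; rewrite //= gen_An.
Qed.

Lemma AnC n A : An Delta n A -> An Delta n (~` A).
Proof. by move=> h; rewrite -setTD; case: (sigma_algebra_An n) => _ + _; exact. Qed.

Lemma An_bigcup n (F : (set I)^nat) : (forall k, An Delta n (F k)) ->
  An Delta n (\bigcup_k F k).
Proof. by case: (sigma_algebra_An n) => _ _; exact. Qed.

Lemma AnU n A B : An Delta n A -> An Delta n B -> An Delta n (A `|` B).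
Proof.
move=> hA hB; rewrite -bigcup2E; apply: An_bigcup => -[|[|k]] //=.
exact: An_lneg (@lneg0 _).
Qed.

Lemma AnI n A B : An Delta n A -> An Delta n B -> An Delta n (A `&` B).
Proof.
by move=> hA hB; rewrite -(setCK (A `&` B)) setCI; apply: AnC; apply: AnU; exact: AnC.
Qed.

Lemma AnD n A B : An Delta n A -> An Delta n B -> An Delta n (A `\` B).
Proof. by move=> hA hB; rewrite setDE; apply: AnI => //; exact: AnC. Qed.

Lemma An_countable n (J : countType) (P : set J) (F : J -> set I) :
  (forall j, P j -> An Delta n (F j)) -> An Delta n (\bigcup_(j in P) F j).
Proof.
move=> h; rewrite bigcup_countType; apply: An_bigcup => k.
have A0 : An Delta n set0 by exact: An_lneg (@lneg0 _).
case: (unpickle k) => [j|] //.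
have [Pj|nPj] := pselect (P j).
  rewrite (_ : mkset _ = F j); first exact: h.
  by apply/seteqP; split => [x []|x].
by rewrite (_ : mkset _ = set0) //; apply/seteqP; split => [x []|x].
Qed.

Lemma ditv_diff_dint e : lneg (ditv e `\` dint e : set I).
Proof.
apply: lnegS (@lneg_dyadic_pt R) => x [ex nex].
by apply: contrapT => nx; apply: nex; exact: ditv_dint.
Qed.

Lemma An_dint n e : wt e <= 2 ^+ n -> An Delta n (dint e).
Proof.
move=> h; rewrite (_ : dint e = ditv e `\` (ditv e `\` dint e)).
  by apply: AnD; [exact: An_dyadic|exact: An_lneg (ditv_diff_dint _)].
by rewrite setDD setIidr //; exact: dint_ditv.
Qed.

(** The sets that are null or conull in the leaf form a sigma-algebra, and a
    generator that overlaps the leaf contains it. *)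
Lemma An_leaf n l A : leaf n l -> An Delta n A ->
  lneg (dint l `&` A) \/ lneg (dint l `\` A).
Proof.
move=> ll; pose S := [set A : set I | lneg (dint l `&` A) \/ lneg (dint l `\` A)].
suff : An Delta n `<=` S by move=> h /h.
apply: smallest_sub.
  split => [|B [h|h]|F hF].
  - by left; rewrite setI0; exact: lneg0.
  - by right; rewrite setTD setDE setCK.
  - by left; rewrite setTD -setDE.
  - have [[k hk]|nk] := pselect (exists k, lneg (dint l `\` F k)).
      by right; apply: lnegS hk; apply: setDS; exact: bigcup_sup.
    left; rewrite setI_bigcupr; apply: lneg_bigcup => k.
    by case: (hF k) => // h; case: nk; exists k.
move=> B [hB|[e /= + <-]]; first by left; apply: lnegS hB; exact: subIsetr.
rewrite gen_An => we.
have [[x [lx ex]]|no] := pselect (exists x : I, dint l x /\ dint e x).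
  right; have a := leaf_overlap ll we lx ex.
  by apply: lnegS (@lneg0 _) => y [/(anc_dint a)/dint_ditv ey].
left; apply: lnegS (ditv_diff_dint e) => y [ly ey]; split => // ey'.
by apply: no; exists y.
Qed.

(** An interval of weight above 2^n lies in one half of a leaf, and so is neither
    null nor conull in the leaf. *)
Lemma An_ditv n e : An Delta n (ditv e) <-> wt e <= 2 ^+ n.
Proof.
split; last exact: An_dyadic.
move=> h; rewrite leNgt; apply/negP => /leaf_ex[l [b [ll a]]].
have al : anc l e by apply: anc_trans a; apply: anc_child; exact: ancxx.
case: (An_leaf ll h) => hl.
  apply: (@not_lneg_dint R e); apply: lnegS hl => x ex.
  by split; [exact: anc_dint ex|exact: dint_ditv].
apply: (@not_lneg_dint R (child (~~ b) l)); apply: lnegS hl => x cx; split.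
  by apply: anc_dint cx; apply: anc_child; exact: ancxx.
move/(anc_ditv a); move: cx; rewrite ditvE dintE !hiE !len_child !lo_child.
by have := len_gt0 R l; case: b a => _ /=; lra.
Qed.

Lemma At_leaf n e : At Delta n e <-> leaf n e.
Proof.
split => [[/An_ditv we mine]|le].
  apply: (@leaf_of_child _ _ false) => //; rewrite ltNge; apply/negP => wc.
  have /(congr1 gen) : child false e = e.
    by apply: mine; [exact/An_ditv|apply: anc_ditv; apply: anc_child; exact: ancxx].
  by rewrite gen_child => /esym/n_Sn.
split; first by apply/An_ditv; exact: leaf_wt.
by move=> e' /An_ditv we' /ditv_anc /(leaf_anc le we').
Qed.

Lemma DiffP n x : Diff Delta n x <-> forall l, leaf n l -> ~ dint l x.
Proof.
split => [h l ll lx|h [l ll]]; first by apply: h; exists l => //; exact/At_leaf.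
by apply: h; exact/At_leaf.
Qed.

Lemma notDiffP n x : ~ Diff Delta n x <-> exists2 l, leaf n l & dint l x.
Proof.
rewrite /Diff /setC /mkset notK; split => -[l ll lx]; exists l => //; exact/At_leaf.
Qed.

Lemma Diff_lohi n e x : wt e <= 2 ^+ n -> rval x = lo R e \/ rval x = hi R e ->
  Diff Delta n x.
Proof.
move=> we xe; apply/DiffP => l ll; rewrite dintE => lx.
suff : anc e l by move=> /(anc_lohi R)[h1 h2]; case: xe => xe; rewrite xe in lx; lra.
have [t lt et] : exists2 t, lo R l < t < hi R l & lo R e < t < hi R e.
  have le := lo_lt_hi R e; case: xe => xe; rewrite xe in lx.
    exists ((lo R e + Num.min (hi R e) (hi R l)) / 2);
    by have [] := leP (hi R e) (hi R l); lra.
  exists ((Num.max (lo R e) (lo R l) + hi R e) / 2);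
  by have [] := leP (lo R e) (lo R l); lra.
case: (overlap lt et) => // /(leaf_anc ll we) <-; exact: ancxx.
Qed.

Lemma leaf_anc_leaf k n l : (k <= n)%N -> leaf n l -> exists2 l', leaf k l' & anc l' l.
Proof.
rewrite leq_eqVlt => /orP[/eqP -> ll|kn ll]; first by exists l; last exact: ancxx.
have [|l' [b [ll' a]]] := @leaf_ex k l; first by case: ll => -> _; rewrite pow2_lt.
by exists l' => //; apply: anc_trans a; apply: anc_child; exact: ancxx.
Qed.

Lemma Diff_le k n : (k <= n)%N -> Diff Delta k `<=` Diff Delta n.
Proof.
move=> kn x /DiffP hx; apply/DiffP => l ll lx.
by have [l' ll' a] := leaf_anc_leaf kn ll; apply: (hx l') => //; exact: anc_dint lx.
Qed.

(** ** The truncated diameter functions *)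

(** Below a leaf the truncated diameter is proportional to the length, which
    freezes the weight at 2^n. *)
Lemma DeltanE n e : Deltan Delta n e = Num.min (wt e) (2 ^+ n) * len R e.
Proof.
rewrite /Deltan; case: xgetP => [l -> /= [/At_leaf ll /ditv_anc a]|none].
  have := wt_anc a; have [-> _] := ll => h; rewrite (min_idPr h).
  by rewrite (leaf_Delta ll) mulrCA mulrAC divff ?mul1r // expf_neq0.
rewrite divff ?expf_neq0 // mul1r Delta_wt min_l // leNgt; apply/negP => /leaf_ex.
move=> [l [b [ll a]]]; apply: (none l); split; first exact/At_leaf.
by apply: anc_ditv; apply: anc_trans a; apply: anc_child; exact: ancxx.
Qed.

Lemma Deltan_gt0 n e : 0 < Deltan Delta n e.
Proof. by rewrite DeltanE mulr_gt0 ?len_gt0 // lt_min wt_gt0 exprn_gt0. Qed.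

Lemma Deltan_le n e : Deltan Delta n e <= 2 ^+ n * len R e.
Proof. by rewrite DeltanE ler_pM2r ?len_gt0 // ge_min lexx orbT. Qed.

(** The two monotonicities that the lower bounds on chain metrics require: going
    down, diameters decrease and weights increase. *)
Lemma Deltan_anc n e e' : anc e e' ->
  Deltan Delta n e' <= Deltan Delta n e /\
  2 ^+ gen e * Deltan Delta n e <= 2 ^+ gen e' * Deltan Delta n e'.
Proof.
have pl k (a : R) : 2 ^+ k * (a * (2 ^+ k)^-1) = a.
  by rewrite mulrCA divff ?mulr1 // expf_neq0.
have H a : Num.min (wt a) (2 ^+ n) * len R a = Num.min (Delta a) (2 ^+ n * len R a).
  by rewrite minr_pMl ?ltW ?len_gt0 // -Delta_wt.
move=> a; split; last first.
  by rewrite !DeltanE !pl le_min ge_min (wt_anc a) ge_min lexx orbT.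
have ll : len R e' <= len R e by rewrite lef_pV2 ?posrE ?exprn_gt0 // pow2_le anc_gen.
rewrite !DeltanE !H le_min ge_min (Delta_anc a) /= ge_min.
by rewrite [X in _ || X]ler_pM2l ?exprn_gt0 // ll orbT.
Qed.

End Weights.

(** * Chain metrics *)

Section ChainMetric.
Variables (R : realType) (D : dyadic -> R).
Hypothesis D_ge0 : forall e, 0 <= D e.
Local Notation I := (I01 R).
Implicit Types (x y : I) (s : seq dyadic).

Lemma chain1 e x y : ditv e x -> ditv e y -> chain x y [:: e].
Proof. by split=> //; exists e; rewrite ?mem_head. Qed.

Lemma dmetric_le_chain x y s : chain x y s -> dmetric D x y <= \sum_(e <- s) D e.
Proof.
move=> h; apply: ge_inf; last by exists s.
by exists 0 => _ [s' _ <-]; apply: sumr_ge0.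
Qed.

Lemma dmetric_le e x y : ditv e x -> ditv e y -> dmetric D x y <= D e.
Proof. by move=> ex ey; have := dmetric_le_chain (chain1 ex ey); rewrite big_seq1. Qed.

Lemma dmetric_ge x y (m : R) : (forall s, chain x y s -> m <= \sum_(e <- s) D e) ->
  m <= dmetric D x y.
Proof.
move=> h; apply: lb_le_inf; last by move=> _ [s /h ? <-].
exists (\sum_(e <- [:: dtop]) D e), [:: dtop] => //.
by apply: chain1; exact: ditv_dtop.
Qed.

Lemma dmetric_ge0 x y : 0 <= dmetric D x y.
Proof. by apply: dmetric_ge => s _; apply: sumr_ge0. Qed.

(** Consecutive members of a chain share a point, so the oscillation over a
    chain is at most the sum of the oscillations over its members. This is how
    all lower bounds on chain metrics are obtained. *)
Lemma osc_dmetric (f : I -> R) (C : R) : 0 <= C ->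
  (forall e x y, ditv e x -> ditv e y -> `|f x - f y| <= C * D e) ->
  forall x y, `|f x - f y| <= C * dmetric D x y.
Proof.
move=> C0 osc.
have chain_osc s : (forall k, (k.+1 < size s)%N ->
      @ditv R (nth dtop s k) `&` ditv (nth dtop s k.+1) !=set0) ->
    forall x y, (exists2 e, e \in s & ditv e x) -> (exists2 e, e \in s & ditv e y) ->
    `|f x - f y| <= C * \sum_(e <- s) D e.
  elim: s => [|a s IH] link x y; first by move=> [].
  have {}IH := IH (fun k => link k.+1).
  have cross z t : ditv a z -> (exists2 e, e \in s & ditv e t) ->
      `|f z - f t| <= C * \sum_(e <- (a :: s)) D e.
    move=> az st; rewrite big_cons mulrDr.
    have [b [s' es]] : exists b s', s = b :: s'.
      by case: (s) st => [[]//|b s' _]; exists b, s'.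
    have [|p] := link 0%N; first by rewrite es.
    rewrite es => /= -[ap bp].
    rewrite (_ : f z - f t = (f z - f p) + (f p - f t)); last by ring.
    apply: le_trans (ler_normD _ _) _; apply: lerD; first exact: osc.
    by rewrite -es; apply: IH => //; exists b => //; rewrite es mem_head.
  have S0 : 0 <= C * \sum_(e <- s) D e by rewrite mulr_ge0 // sumr_ge0.
  move=> [e + ex] [e' + ey]; rewrite !inE => /orP[/eqP ea|es] /orP[/eqP e'a|e's].
  - rewrite big_cons mulrDr; rewrite -(addr0 `|_|); apply: lerD => //.
    by apply: osc; [rewrite -ea|rewrite -e'a].
  - by apply: cross; [rewrite -ea|exists e'].
  - by rewrite distrC; apply: cross; [rewrite -e'a|exists e].
  - rewrite big_cons mulrDr; apply: ler_wpDl; first by rewrite mulr_ge0.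
    by apply: IH; [exists e|exists e'].
have {}chain_osc x y s : chain x y s -> `|f x - f y| <= C * \sum_(e <- s) D e.
  by move=> [h1 h2 h3]; exact: chain_osc.
move=> x y; move: C0; rewrite le_eqVlt => /orP[/eqP C0|C0].
  have := chain_osc x y _ (chain1 (ditv_dtop x) (ditv_dtop y)).
  by rewrite -C0 !mul0r.
rewrite mulrC -ler_pdivrMr //; apply: dmetric_ge => s /chain_osc h.
by rewrite ler_pdivrMr // mulrC.
Qed.

(** Join x to y by the consecutive intervals of generation k and let k tend to
    infinity. *)
Lemma dmetric_upper (K : R) : 0 <= K -> (forall e, D e <= K * len R e) ->
  forall x y, dmetric D x y <= K * `|rval x - rval y|.
Proof.
move=> K0 DK.
have step k x y : rval x <= rval y ->
    dmetric D x y <= K * (rval y - rval x) + K * 2 / 2 ^+ k.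
  move=> xy; set i := pos k x; set j := pos k y.
  have pk := p2_gt0 R k.
  have [ik jk] : (i < 2 ^ k)%N /\ (j < 2 ^ k)%N by split; exact: pos_lt.
  have := ditv_pos k x; have := ditv_pos k y.
  rewrite !ditvE /lo /hi !gen_dy !idx_dy // -/i -/j => /andP[y1 y2] /andP[x1 x2].
  have ij : (i <= j)%N.
    rewrite leqNgt; apply/negP => ji.
    have hx : rval x = rval y.
      apply: le_anti; rewrite xy /=; apply: le_trans y2 _; apply: le_trans x1.
      by rewrite ler_pM2r ?invr_gt0 // ler_nat.
    by move: ji; rewrite /i /j /pos hx ltnn.
  pose s := [seq dy k m | m <- iota i (j - i).+1].
  have mem m : (i <= m <= j)%N -> dy k m \in s.
    by move=> im; apply: map_f; rewrite mem_iota; lia.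
  have hs : chain x y s.
    split; [exists (dy k i)|exists (dy k j)|]; rewrite ?mem ?leqnn ?ij //;
      try exact: ditv_pos.
    move=> m; rewrite size_map size_iota => mj.
    rewrite !(nth_map 0%N) ?size_iota ?(ltnW mj) // !nth_iota ?(ltnW mj) //.
    have h1 : (i + m.+1 < 2 ^ k)%N by apply: leq_ltn_trans jk; lia.
    have h2 : (i + m < 2 ^ k)%N by apply: leq_ltn_trans h1; lia.
    exists (pt (hi R (dy k (i + m)))); split; first exact: ditv_hi.
    rewrite (_ : hi R _ = lo R (dy k (i + m.+1))); first exact: ditv_lo.
    by rewrite /hi /lo !gen_dy !idx_dy // addnS.
  apply: le_trans (dmetric_le_chain hs) _.
  rewrite big_map; apply: (@le_trans _ _ (\sum_(m <- iota i (j - i).+1) K / 2 ^+ k)).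
    by apply: ler_sum => m _; apply: le_trans (DK _) _; rewrite /len gen_dy.
  rewrite big_const_seq iter_addr addr0 count_predT size_iota.
  rewrite -[leLHS]mulr_natl mulrCA.
  rewrite [leRHS](_ : _ = K * (rval y - rval x + 2 / 2 ^+ k)); last by ring.
  rewrite ler_wpM2l // -lerBlDr.
  have -> : (j - i).+1%:R / 2 ^+ k - 2 / 2 ^+ k =
      j%:R / 2 ^+ k - i.+1%:R / 2 ^+ k :> R.
    by rewrite -!mulrBl -addn1 -(addn1 i) !natrD natrB //; congr (_ / _); ring.
  by apply: lerB.
have le_ab x y : rval x <= rval y -> dmetric D x y <= K * (rval y - rval x).
  move=> xy; apply/ler_addgt0Pr => e e0.
  pose k := Num.truncn (K * 2 / e); apply: le_trans (step k x y xy) _.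
  rewrite lerD2l ler_pdivrMr ?p2_gt0 // [leRHS]mulrC -ler_pdivrMr //.
  have h0 : 0 <= K * 2 / e by rewrite divr_ge0 ?mulr_ge0 // ltW.
  have /andP[_ /ltW h] := truncn_itv h0.
  by apply: le_trans h _; rewrite -natrX ler_nat; exact: ltn_expl.
move=> x y; have [xy|/ltW yx] := leP (rval x) (rval y).
  by rewrite ler0_norm ?subr_le0 // opprB; exact: le_ab.
have sym : chain x y = chain y x.
  by apply/funext => s; apply/propext; split => -[? ? ?]; split.
by rewrite /dmetric sym ger0_norm ?subr_ge0 //; exact: le_ab.
Qed.

(** ** Lower bounds *)

Definition clamp (c : dyadic) (t : R) : R := Num.max (lo R c) (Num.min t (hi R c)).

Lemma clamp_in c t : lo R c <= t <= hi R c -> clamp c t = t.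
Proof. by move=> /andP[h1 h2]; rewrite /clamp (min_idPl h2) (max_idPr h1). Qed.

Lemma clamp_lo c t : t <= lo R c -> clamp c t = lo R c.
Proof. by move=> h; rewrite /clamp (max_idPl _) // ge_min h. Qed.

Lemma clamp_hi c t : hi R c <= t -> clamp c t = hi R c.
Proof.
by move=> h; rewrite /clamp (min_idPr h); apply/max_idPr; exact/ltW/lo_lt_hi.
Qed.

Lemma clamp_itv c t : lo R c <= clamp c t <= hi R c.
Proof.
have l := ltW (lo_lt_hi R c).
by rewrite /clamp le_max lexx ge_max l ge_min lexx orbT.
Qed.

Lemma clamp_contract c (s t : R) : `|clamp c s - clamp c t| <= `|s - t|.
Proof.
wlog st : s t / s <= t.
  move=> h; have [|/ltW] := leP s t; first exact: h.
  by move/h; rewrite distrC (distrC t).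
have l := lo_lt_hi R c.
rewrite ler_distlC (ler0_norm (_ : s - t <= 0)) ?subr_le0 //.
have [s1|s1] := leP s (lo R c); have [t1|t1] := leP t (lo R c);
have [s2|s2] := leP (hi R c) s; have [t2|t2] := leP (hi R c) t;
  rewrite ?(clamp_lo s1) ?(clamp_lo t1) ?(clamp_hi s2) ?(clamp_hi t2)
    ?clamp_in ?(ltW s1) ?(ltW s2) ?(ltW t1) ?(ltW t2) //; lra.
Qed.

Hypothesis D_anc : forall e e', anc e e' ->
  D e' <= D e /\ 2 ^+ gen e * D e <= 2 ^+ gen e' * D e'.

(** An interval inside c has at least the weight of c, and one that contains c
    at least its diameter. So the retraction to c, scaled by the weight of c,
    satisfies the oscillation bound of [osc_dmetric]. *)
Lemma clamp_dmetric c x y :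
  2 ^+ gen c * D c * `|clamp c (rval x) - clamp c (rval y)| <= dmetric D x y.
Proof.
set W := 2 ^+ gen c * D c.
have W0 : 0 <= W by rewrite mulr_ge0 // ltW // p2_gt0.
rewrite -{1}(ger0_norm W0) -normrM mulrBr -[leRHS]mul1r.
apply: (@osc_dmetric (fun z => W * clamp c (rval z))) => // e {}y z.
rewrite !ditvE mul1r -mulrBr normrM (ger0_norm W0) => /andP[y1 y2] /andP[z1 z2].
have disj t : clamp c (rval y) = t -> clamp c (rval z) = t ->
    W * `|clamp c (rval y) - clamp c (rval z)| <= D e.
  by move=> -> ->; rewrite subrr normr0 mulr0.
have [h1|h1] := leP (hi R e) (lo R c).
  by apply: (disj (lo R c)); apply: clamp_lo; lra.
have [h2|h2] := leP (hi R c) (lo R e).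
  by apply: (disj (hi R c)); apply: clamp_hi; lra.
have [t tc te] : exists2 t, lo R c < t < hi R c & lo R e < t < hi R e.
  have lc := lo_lt_hi R c; have le := lo_lt_hi R e.
  exists ((Num.max (lo R c) (lo R e) + Num.min (hi R c) (hi R e)) / 2);
  by have [] := leP (lo R c) (lo R e); have [] := leP (hi R c) (hi R e); lra.
have VK a : 2 ^+ gen a * D a * len R a = D a.
  by rewrite mulrAC divff ?mul1r // expf_neq0.
case: (overlap tc te) => a.
  rewrite -(VK e); apply: ler_pM => //; first by case: (D_anc a).
  apply: le_trans (clamp_contract _ _ _) _; rewrite ler_distl.
  by move: y1 y2 z1 z2; rewrite !hiE; lra.
apply: (@le_trans _ _ (W * len R c)); last by rewrite VK; case: (D_anc a).
apply: ler_wpM2l => //; rewrite ler_distl.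
by have := clamp_itv c (rval y); have := clamp_itv c (rval z); rewrite !hiE; lra.
Qed.

End ChainMetric.

(** * Hausdorff measure *)

Section Hausdorff.
Local Open Scope ereal_scope.
Variables (R : realType) (T : Type) (d : T -> T -> R).

Lemma ediam_ub (A : set T) x y : A x -> A y -> (d x y)%:E <= ediam d A.
Proof.
move=> Ax Ay; rewrite /ediam le_max; apply/orP; right.
by apply: ereal_sup_ubound; exists (x, y).
Qed.

Lemma ediam_le (A : set T) (r : R) : (0 <= r)%R ->
  (forall x y, A x -> A y -> d x y <= r)%R -> ediam d A <= r%:E.
Proof.
move=> r0 h; rewrite /ediam ge_max lee_fin r0 /=.
by apply: ge_ereal_sup => _ [[x y] /= [Ax Ay] <-]; rewrite lee_fin; exact: h.
Qed.

Lemma ediamS (A B : set T) : A `<=` B -> ediam d A <= ediam d B.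
Proof.
move=> AB; rewrite /ediam ge_max le_max lexx /=; apply: ge_ereal_sup.
by move=> _ [[x y] /= [Ax Ay] <-]; apply: ediam_ub; exact: AB.
Qed.

Lemma hausdorff1_delta_le (t : R) A : (0 < t)%R ->
  hausdorff1_delta d t A <= hausdorff1 d A.
Proof. by move=> t0; apply: ereal_sup_ubound; exists t. Qed.

Lemma hausdorff1_delta_anti (s t : R) A : (s <= t)%R ->
  hausdorff1_delta d t A <= hausdorff1_delta d s A.
Proof.
move=> st; apply: le_ereal_inf_tmp => _ [U [AU dU] <-].
apply: ereal_inf_lbound; exists U => //; split => // k.
by apply: le_trans (dU k) _; rewrite lee_fin.
Qed.

(** Sets of diameter less than the gap between A and B meet at most one of
    them, so the Hausdorff measure is additive on A and B. *)
Lemma hausdorff1_separated (eta : R) (A B : set T) : (0 < eta)%R ->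
  (forall x y, A x -> B y -> eta <= d x y)%R ->
  forall X, hausdorff1 d (X `&` A) + hausdorff1 d (X `&` B) <= hausdorff1 d X.
Proof.
move=> eta0 sep X.
have small (t : R) : (0 < t < eta)%R ->
    hausdorff1_delta d t (X `&` A) + hausdorff1_delta d t (X `&` B)
    <= hausdorff1_delta d t X.
  move=> /andP[t0 te]; apply: le_ereal_inf_tmp => _ [U [XU dU] <-].
  have cov C : hausdorff1_delta d t (X `&` C) <= \sum_(k <oo) ediam d (U k `&` C).
    apply: ereal_inf_lbound; exists (fun k => U k `&` C) => //; split.
      by rewrite -setI_bigcupl; exact: setSI.
    by move=> k; apply: le_trans (dU k); apply: ediamS; exact: subIsetl.
  apply: le_trans (leeD (cov A) (cov B)) _.
  rewrite -nneseriesD; [|by move=> *; exact: ediam_ge0..].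
  apply: lee_nneseries => [k _ _|k _]; first by rewrite adde_ge0 ?ediam_ge0.
  have [[x [Ux Ax]]|noA] := pselect (U k `&` A !=set0); last first.
    rewrite (_ : U k `&` A = set0) ?ediam0 ?add0e.
      by apply: ediamS; exact: subIsetl.
    by apply/seteqP; split => // x hx; apply: noA; exists x.
  rewrite [X in _ + ediam _ X](_ : _ = set0) ?ediam0 ?adde0.
    by apply: ediamS; exact: subIsetl.
  apply/seteqP; split => // y [Uy By].
  have := le_trans (ediam_ub Ux Uy) (dU k).
  by rewrite lee_fin => /(le_trans (sep _ _ Ax By)); rewrite leNgt te.
have [->|Xfin] := eqVneq (hausdorff1 d X) +oo; first exact: leey.
have fin C : C `<=` X -> hausdorff1 d C \is a fin_num.
  move=> CX; rewrite ge0_fin_numE ?hausdorff1_ge0 //.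
  by apply: le_lt_trans (le_hausdorff1 d CX) _; rewrite ltey.
have two (s t : R) : (0 < s)%R -> (0 < t)%R ->
    hausdorff1_delta d s (X `&` A) + hausdorff1_delta d t (X `&` B) <= hausdorff1 d X.
  move=> s0 t0; pose r := Num.min (Num.min s t) (eta / 2)%R.
  have r0 : (0 < r)%R by rewrite !lt_min s0 t0 divr_gt0.
  have rs : (r <= s)%R by rewrite /r !ge_min lexx.
  have rt : (r <= t)%R by rewrite /r !ge_min lexx orbT.
  have re : (r < eta)%R.
    apply: (@le_lt_trans _ _ (eta / 2)%R); first by rewrite /r ge_min lexx orbT.
    lra.
  apply: le_trans (leeD (hausdorff1_delta_anti _ rs) (hausdorff1_delta_anti _ rt)) _.
  apply: le_trans (hausdorff1_delta_le _ r0); apply: small; by rewrite r0.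
have finB := fin _ (@subIsetl _ X B).
rewrite -leeBrDr //; apply: ge_ereal_sup => _ [s s0 <-].
have fins : hausdorff1_delta d s (X `&` A) \is a fin_num.
  rewrite ge0_fin_numE ?hausdorff1_delta_ge0 //.
  apply: le_lt_trans (hausdorff1_delta_le _ s0) _.
  by rewrite -ge0_fin_numE ?hausdorff1_ge0 // fin //; exact: subIsetl.
rewrite leeBrDr // addeC -leeBrDr //; apply: ge_ereal_sup => _ [t t0 <-].
by rewrite leeBrDr // addeC; exact: two.
Qed.

End Hausdorff.

(** A set function dominated on half-open intervals is dominated on all sets,
    Lebesgue measure being defined through covers by such intervals. *)
Lemma outer_le_lebesgue (R : realType) (T : Type)
  (mu : {outer_measure set T -> \bar R}) (phi : T -> R) (C : R) : 0 < C ->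
  (forall a b, a < b -> (mu (phi @^-1` `]a, b]%classic) <= (C * (b - a))%:E)%E) ->
  forall B : set R, (mu (phi @^-1` B) <= C%:E * lebesgue_measure B)%E.
Proof.
move=> C0 h B; rewrite -lee_pdivrMl //; apply: le_ereal_inf_tmp => _ [F [mF BF] <-].
rewrite lee_pdivrMl // -nneseriesZl; last by move=> k _; exact: measure_ge0.
apply: (@le_trans _ _ (mu (\bigcup_k (phi @^-1` F k)))).
  by rewrite -preimage_bigcup; apply: le_outer_measure; exact: preimage_subset.
apply: le_trans (outer_measure_sigma_subadditive mu _) _.
apply: lee_nneseries => [k _ _|k _]; first exact: outer_measure_ge0.
have : ocitv (F k) by exact: mF.
case/ocitvP => [->|[[a b] /= ab ->]].
  by rewrite preimage_set0 outer_measure0 measure0 mule0.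
rewrite /= wlength_itv_bnd ?(ltW ab) // -EFinM; exact: h.
Qed.

(** * The measures H_n *)

Section TruncatedMetric.
Variables (R : realType) (Delta : dyadic -> R).
Hypothesis DD : dyadic_diameter Delta.
Variable n : nat.
Local Notation I := (I01 R).
Local Notation dn := (dn Delta n).
Local Notation mu := (hausdorffn Delta n).

Let Dn_ge0 e : 0 <= Deltan Delta n e.
Proof. exact/ltW/Deltan_gt0. Qed.

Lemma dn_le (x y : I) : dn x y <= 2 ^+ n * `|rval x - rval y|.
Proof.
by apply: dmetric_upper => // e; exact: Deltan_le.
Qed.

Lemma dn_ge (x y : I) : `|rval x - rval y| <= dn x y.
Proof.
have := @clamp_dmetric _ _ Dn_ge0 (Deltan_anc DD n) dtop x y.
rewrite !clamp_in ?lo_dtop ?hi_dtop ?rvalP // expr0 mul1r DeltanE //.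
by rewrite wt_dtop // min_l ?exprn_ege1 ?ler1n // /len expr0 invr1 mulr1 mul1r.
Qed.

Lemma dn_clamp c (x y : I) : wt Delta c = 2 ^+ n ->
  2 ^+ n * `|clamp c (rval x) - clamp c (rval y)| <= dn x y.
Proof.
move=> wc; have := @clamp_dmetric _ _ Dn_ge0 (Deltan_anc DD n) c x y.
by rewrite DeltanE // wc minxx mulrCA divff ?mulr1 // expf_neq0.
Qed.

Lemma dn_cell c (x y : I) : wt Delta c = 2 ^+ n -> ditv c x -> ditv c y ->
  dn x y = 2 ^+ n * `|rval x - rval y|.
Proof.
rewrite !ditvE => wc cx cy; apply: le_anti; rewrite dn_le /=.
by have := dn_clamp x y wc; rewrite !clamp_in.
Qed.

(** Cut the interval into equal pieces of d_n-diameter at most the mesh. *)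
Lemma mu_itv (A : set I) (a b : R) : a <= b -> (forall x, A x -> a <= rval x <= b) ->
  (mu A <= (2 ^+ n * (b - a))%:E)%E.
Proof.
move=> ab Aab; apply: ge_ereal_sup => _ [t /= t0 <-].
have p0 : 0 <= 2 ^+ n :> R by rewrite exprn_ge0.
pose L := 2 ^+ n * (b - a); have L0 : 0 <= L by rewrite mulr_ge0 // subr_ge0.
pose m := Num.truncn (L / t).
have m0 : 0 < m.+1%:R :> R by rewrite ltr0n.
pose w := (b - a) / m.+1%:R.
have w0 : 0 <= w by rewrite divr_ge0 ?subr_ge0 // ltW.
have pw0 : 0 <= 2 ^+ n * w by rewrite mulr_ge0.
have wt : 2 ^+ n * w <= t.
  rewrite /w mulrA -/L ler_pdivrMr // mulrC -ler_pdivrMr //.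
  have Lt : 0 <= L / t by rewrite divr_ge0 // ltW.
  by have /andP[_ /ltW] := truncn_itv Lt.
pose U k : set I := if (k <= m)%N then [set x | a + k%:R * w <= rval x <= a + k.+1%:R * w]
                    else set0.
have dU k : (ediam dn (U k) <= (if (k <= m)%N then 2 ^+ n * w else 0)%:E)%E.
  rewrite /U; case: ifP => _; last by rewrite ediam0.
  apply: ediam_le => // x y /= hx hy; apply: le_trans (dn_le x y) _.
  rewrite ler_wpM2l // ler_distl; move: hx hy; rewrite -addn1 natrD; lra.
apply: (@le_trans _ _ (\sum_(k <oo) ediam dn (U k))%E).
  apply: ereal_inf_lbound; exists U => //; split; last first.
    by move=> k; apply: le_trans (dU k) _; rewrite lee_fin; case: ifP => // _; exact: ltW.
  move=> x /Aab /andP[ax xb].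
  have [w_eq0|w_neq0] := eqVneq w 0.
    exists 0%N => //; rewrite /U /= w_eq0 !mulr0 addr0 ax /=.
    by move/eqP: w_eq0; rewrite mulf_eq0 invr_eq0 (gt_eqF m0) orbF; lra.
  have wp : 0 < w by rewrite lt_neqAle eq_sym w_neq0.
  have q0 : 0 <= (rval x - a) / w by rewrite divr_ge0 // subr_ge0.
  have /andP[] := truncn_itv q0; set k := Num.truncn _.
  rewrite ler_pdivlMr // ltr_pdivrMr // => k1 k2.
  have bw : b = a + m.+1%:R * w by rewrite /w mulrCA divff ?mulr1 ?gt_eqF //; ring.
  have [km|mk] := leqP k m.
    by exists k => //; rewrite /U km /=; apply/andP; split; lra.
  exists m => //; rewrite /U leqnn /=; apply/andP; split; last by rewrite -bw.
  apply: (@le_trans _ _ (a + k%:R * w)); last by lra.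
  by rewrite lerD2l ler_wpM2r // ler_nat ltnW.
apply: (@le_trans _ _ (\sum_(k <oo) (if (k <= m)%N then 2 ^+ n * w else 0)%:E)%E).
  by apply: lee_nneseries => [k _ _|k _]; [exact: ediam_ge0|exact: dU].
rewrite (nneseries_split 0%N m.+1); last by move=> k _; rewrite lee_fin; case: ifP.
rewrite add0n eseries0 ?adde0; last by move=> k mk _; rewrite leqNgt mk.
rewrite big_mkord (eq_bigr (fun=> (2 ^+ n * w)%:E)); last first.
  by move=> k _; rewrite -ltnS ltn_ord.
rewrite sumEFin lee_fin sumr_const card_ord -[leLHS]mulr_natr.
by rewrite -mulrA /w divfK // gt_eqF.
Qed.

Lemma mu_lebesgue (B : set R) :
  (mu (@rval R @^-1` B) <= (2 ^+ n)%:E * lebesgue_measure B)%E.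
Proof.
apply: outer_le_lebesgue; first by rewrite exprn_gt0.
move=> a b ab; apply: mu_itv; first exact: ltW.
by move=> x /=; rewrite in_itv /= => /andP[/ltW -> ->].
Qed.

Lemma mu_lneg (A : set I) : lneg A -> mu A = 0%E.
Proof.
move=> [N [mN N0 AN]]; apply/eqP; rewrite eq_le outer_measure_ge0 andbT.
apply: (@le_trans _ _ (mu (@rval R @^-1` N))).
  by apply: le_outer_measure => x Ax; apply: AN; exists x.
apply: le_trans (mu_lebesgue N) _; move: N0 => /= ->.
by rewrite mule0.
Qed.

(** The traces on c of the members of a cover lie in intervals of total length at
    least that of c, and on c the metric is 2^n times the Euclidean one. *)
Lemma mu_cell_ge c : wt Delta c = 2 ^+ n ->
  ((2 ^+ n * len R c)%:E <= mu (ditv c))%E.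
Proof.
move=> wc; apply: le_trans (hausdorff1_delta_le _ _ (@ltr01 R)).
apply: le_ereal_inf_tmp => _ [U [cU dU] <-].
have p0 : 0 < 2 ^+ n :> R by rewrite exprn_gt0.
rewrite EFinM -lee_pdivlMl // -nneseriesZl; last by move=> k _; exact: ediam_ge0.
pose S k := @rval R @` (U k `&` ditv c).
pose J k : set R := if `[< S k !=set0 >] then `[inf (S k), sup (S k)]%classic else set0.
have Sc k s : S k s -> lo R c <= s <= hi R c by move=> [x [_]]; rewrite ditvE => + <-.
have Sub k : has_ubound (S k) by exists (hi R c) => s /Sc/andP[].
have Slb k : has_lbound (S k) by exists (lo R c) => s /Sc/andP[].
have SJ k : S k `<=` J k.
  move=> s Ss; rewrite /J asboolT; last by exists s.
  by rewrite /= in_itv /= ge_inf //= ub_le_sup.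
have mJ k : measurable (J k).
  by rewrite /J; case: asboolP => _; [exact: measurable_itv|exact: measurable0].
have cJ : `[lo R c, hi R c]%classic `<=` \bigcup_k J k.
  move=> t /=; rewrite in_itv /= => ct.
  have rt : rval (pt t) = t.
    by rewrite rval_pt //; have := lo_ge0 R c; have := hi_le1 R c; lra.
  have ctx : ditv c (pt t) by rewrite ditvE rt.
  have [k _ Uk] := cU _ ctx; exists k => //; apply: SJ; exists (pt t) => //.
have <- : lebesgue_measure (`[lo R c, hi R c]%classic : set R) = (len R c)%:E.
  by rewrite lebesgue_measure_itv /= lte_fin lo_lt_hi -EFinB hiE addrAC subrr add0r.
apply: le_trans (@measure_sigma_subadditive _ _ _ (@lebesgue_measure R)
  _ J mJ (measurable_itv _) cJ) _.
apply: lee_nneseries => [k _ _|k _]; first exact: measure_ge0.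
rewrite lee_pdivlMl //.
rewrite /J; case: asboolP => [[s0 Ss0]|_]; last by rewrite measure0 mule0 ediam_ge0.
have fd : ediam dn (U k) \is a fin_num.
  by rewrite ge0_fin_numE ?ediam_ge0 // (le_lt_trans (dU k)) // ltry.
have key s t : S k s -> S k t -> 2 ^+ n * (s - t) <= fine (ediam dn (U k)).
  move=> [x [Ux cx] <-] [y [Uy cy] <-].
  have := ediam_ub dn Ux Uy; rewrite -(fineK fd) lee_fin; apply: le_trans.
  by rewrite (dn_cell wc) //; apply: ler_wpM2l; [exact: ltW|exact: ler_norm].
have is_le : inf (S k) <= sup (S k).
  by apply: (@le_trans _ _ s0); [exact: ge_inf|exact: ub_le_sup].
have JE : lebesgue_measure (`[inf (S k), sup (S k)]%classic : set R)
    = (sup (S k) - inf (S k))%:E.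
  rewrite lebesgue_measure_itv /= lte_fin; move: is_le.
  by rewrite le_eqVlt => /orP[/eqP ->|->//]; rewrite ltxx subrr.
rewrite [X in (_ * X)%E](_ : _ = (sup (S k) - inf (S k))%:E) //.
rewrite -EFinM -(fineK fd) lee_fin mulrC -ler_pdivlMr //.
rewrite lerBlDr; apply: ge_sup; first by exists s0.
move=> s Ss; rewrite addrC -lerBlDr; apply: lb_le_inf; first by exists s0.
move=> t St; have := key _ _ Ss St.
by rewrite mulrC -ler_pdivlMr //; lra.
Qed.

(** Points on the two sides of the strip between a and a + e are at d_n-distance
    at least e, and the measure of the strip tends to 0 with e. *)
Lemma mu_le_cara (a : R) : mu.-caratheodory [set x | rval x <= a].
Proof.
apply: le_caratheodory_measurable => X.
set S := [set x | _]; apply/lee_addgt0Pr => e e0.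
have p0 : 0 < 2 ^+ n :> R by rewrite exprn_gt0.
pose w := e / 2 ^+ n; have w0 : 0 < w by rewrite divr_gt0.
pose B := [set x : I | a + w <= rval x].
have sep := @hausdorff1_separated _ _ dn w S B w0 _ X.
have {}sep : (mu (X `&` S) + mu (X `&` B) <= mu X)%E.
  apply: sep => x y; rewrite /S /B /= => xa ya; apply: le_trans (dn_ge x y).
  by rewrite distrC; apply: le_trans (ler_norm _); lra.
have strip : (mu (X `&` ~` S) <= mu (X `&` B) + e%:E)%E.
  pose Z := [set x : I | a <= rval x <= a + w].
  have ZE : (mu Z <= e%:E)%E.
    apply: le_trans (@mu_itv Z a (a + w) _ _) _ => //; first by rewrite lerDl ltW.
    by rewrite lee_fin addrAC subrr add0r /w mulrCA divff ?mulr1 // gt_eqF.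
  apply: (@le_trans _ _ (mu ((X `&` B) `|` Z))).
    apply: le_outer_measure => x [Xx /= /negP]; rewrite -ltNge => ax.
    have [xw|wx] := leP (a + w) (rval x); first by left.
    by right; rewrite /Z /= !ltW.
  apply: le_trans (outer_measureU2 _ _ _) _; exact: leeD.
apply: le_trans (leeD (le_refl _) strip) _.
by rewrite addeA; exact: leeD.
Qed.

End TruncatedMetric.

(** * Atoms of the previous level *)

Section Blocks.
Variables (R : realType) (Delta : dyadic -> R).
Hypothesis DD : dyadic_diameter Delta.
Local Notation I := (I01 R).

(** The atoms of A_(n-1), with the convention that [0,1] is the atom of A_(-1). *)
Definition block (n : nat) (e : dyadic) : Prop :=
  if n is m.+1 then leaf Delta m e else e = dtop.

Lemma block_wt n e : block n e -> wt Delta e <= 2 ^+ n.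
Proof.
case: n => [->|n [-> _]]; first by rewrite wt_dtop // expr0.
by rewrite pow2_le.
Qed.

Lemma block_child n e : block n e ->
  wt Delta e = 2 ^+ n \/ forall b, wt Delta (child b e) = 2 ^+ n.
Proof. by case: n => [->|n [_ h]]; [left; rewrite wt_dtop|right]. Qed.

Variable n : nat.
Local Notation mu := (hausdorffn Delta n).

(** On a block the density of H_n with respect to Lebesgue measure is 2^n: this
    holds on each of the two halves, where d_n is 2^n times the Euclidean
    metric. *)
Lemma mu_block e : block n e -> mu (ditv e) = (2 ^+ n * len R e)%:E.
Proof.
move=> /block_child be; apply/eqP; rewrite eq_le; apply/andP; split.
  apply: le_trans (@mu_itv _ _ DD n (ditv e) (lo R e) (hi R e) _ _) _.
  - exact/ltW/lo_lt_hi.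
  - by move=> x; rewrite ditvE.
  - by rewrite hiE addrAC subrr add0r.
case: be => [we|wc]; first exact: mu_cell_ge.
rewrite (mu_le_cara DD n (mid R e)).
have half b A : ditv (child b e) `<=` A `|` [set x | rval x = mid R e] ->
    ((2 ^+ n * (len R e / 2))%:E <= mu A)%E.
  move=> cA; rewrite -(len_child R b); apply: le_trans (mu_cell_ge DD (wc b)) _.
  apply: le_trans (le_outer_measure _ _ _ cA) _.
  apply: le_trans (outer_measureU2 _ _ _) _.
  by rewrite (mu_lneg DD n (lneg_rval _)) adde0.
rewrite {1}(_ : len R e = len R e / 2 + len R e / 2); last by lra.
rewrite mulrDr EFinD; apply: leeD.
  apply: (half false) => x; rewrite !ditvE hiE lo_child len_child mul0r addr0 => h.
  have l := len_gt0 R e; left; split; last by rewrite /= /mid; lra.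
  by rewrite ditvE hiE; lra.
apply: (half true) => x; rewrite !ditvE hiE lo_child len_child mul1r => h.
have := len_gt0 R e; have [xm _|xm l] := eqVneq (rval x) (mid R e); first by right; rewrite /= xm.
left; split; first by rewrite ditvE hiE; lra.
move=> /= xm'; move/eqP: xm; apply; move: xm' h; rewrite /mid; lra.
Qed.

Lemma mu_fin A : mu A \is a fin_num.
Proof.
rewrite ge0_fin_numE ?outer_measure_ge0 //.
apply: le_lt_trans (@mu_itv _ _ DD n A 0 1 _ _) _ => //; last by rewrite ltry.
by move=> x _; exact: rvalP.
Qed.

(** ** Measurability for H_n *)

Local Notation T := (caratheodory_type mu).
Local Notation H := (Hn Delta n).

Lemma H_mu A : H A = mu A. Proof. by []. Qed.

Lemma measurable_rval : measurable_fun setT (@rval R : T -> measurableTypeR R).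
Proof.
apply: (measurability _ (measurable_realfun.RGenOInfty.measurableE R)) => _ [_ [a ->] <-].
rewrite setTI (_ : _ @^-1` _ = ~` [set x : T | rval x <= a]).
  by apply: measurableC; exact: mu_le_cara.
by apply/seteqP; split => x /=; rewrite in_itv /= andbT ltNge => /negP.
Qed.

Lemma measurable_preimage (B : set R) : measurable B ->
  measurable (@rval R @^-1` B : set T).
Proof. by move=> mB; rewrite -[_ @^-1` _]setTI; exact: measurable_rval. Qed.

Lemma measurable_ditv e : measurable (ditv e : set T).
Proof. by apply: measurable_preimage; exact: measurable_itv. Qed.

Lemma measurable_null A : mu A = 0%E -> measurable (A : set T).
Proof.
move=> A0; apply: le_caratheodory_measurable => X.
rewrite [X in (X + _)%E](_ : _ = 0%E) ?add0e; first exact: le_outer_measure.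
apply/eqP; rewrite eq_le outer_measure_ge0 andbT -A0.
by apply: le_outer_measure; exact: subIsetr.
Qed.

Lemma negligibleE A : H.-negligible A <-> mu A = 0%E.
Proof.
split => [[N [mN N0 AN]]|A0].
  apply/eqP; rewrite eq_le outer_measure_ge0 andbT -[leRHS]N0.
  exact: le_outer_measure.
by apply/negligibleP => //; exact: measurable_null.
Qed.

Lemma An_measurable A : An Delta n A -> measurable (A : set T).
Proof.
move: A; apply: smallest_sub; first exact: sigma_algebra_measurable.
move=> A [hA|[e /= _ <-]]; last exact: measurable_ditv.
by apply: measurable_null; exact: mu_lneg.
Qed.

Lemma An_measurable_fun (g : I -> R) :
  measurable_fun setT (g : g_sigma_algebraType (An_gen Delta n) -> R) ->
  measurable_fun setT (g : T -> R).
Proof.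
move=> mg _ B mB; rewrite setTI; apply: An_measurable.
by have := mg measurableT B mB; rewrite setTI.
Qed.

(** ** Integration over a block *)

Section BlockIntegral.
Variable e : dyadic.
Hypothesis be : block n e.
Local Notation J := (`[lo R e, hi R e]%classic : set R).

(** The inequality with Lebesgue measure holds for B and for its complement in the
    block, and the two sides have the same total mass by [mu_block]. *)
Lemma mu_block_lebesgue (B : set R) : measurable B -> B `<=` J ->
  mu (@rval R @^-1` B) = ((2 ^+ n)%:E * lebesgue_measure B)%E.
Proof.
move=> mB BJ; have p0 : (0 <= (2 ^+ n)%:E :> \bar R)%E by rewrite lee_fin exprn_ge0.
have mJB : measurable (J `\` B) by apply: measurableD => //; exact: measurable_itv.
have lJ : lebesgue_measure J = (len R e)%:E.
  by rewrite lebesgue_measure_itv /= lte_fin lo_lt_hi -EFinB hiE addrAC subrr add0r.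
have muE : (mu (@rval R @^-1` B) + mu (@rval R @^-1` (J `\` B)) =
    (2 ^+ n)%:E * (lebesgue_measure B + lebesgue_measure (J `\` B)))%E.
  have -> : (lebesgue_measure B + lebesgue_measure (J `\` B) = (len R e)%:E)%E.
    rewrite -lJ -[in RHS](setDUK BJ); apply/esym.
    by apply: (measureU (@lebesgue_measure R)) => //; rewrite setDIK.
  rewrite -EFinM -mu_block // [X in _ = mu X](_ : _ = @rval R @^-1` B `|` @rval R @^-1` (J `\` B)).
    apply/esym; apply: (measureU H); try exact: measurable_preimage.
    by rewrite -preimage_setI setDIK // preimage_set0.
  by rewrite -preimage_setU setDUK.
apply/eqP; rewrite eq_le mu_lebesgue //= leNgt; apply/negP => lt.
have lfin C : measurable C -> C `<=` J -> lebesgue_measure C \is a fin_num.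
  move=> mC CJ; rewrite ge0_fin_numE //.
  apply: (@le_lt_trans _ _ (lebesgue_measure J)); last by rewrite lJ ltry.
  by apply: (le_measure (@lebesgue_measure R)) => //; rewrite inE //; exact: measurable_itv.
move: muE; rewrite ge0_muleDr // => muE.
have : (mu (@rval R @^-1` B) + mu (@rval R @^-1` (J `\` B)) <
    (2 ^+ n)%:E * lebesgue_measure B + (2 ^+ n)%:E * lebesgue_measure (J `\` B))%E.
  by apply: lte_leD => //; [exact: mu_fin|exact: mu_lebesgue].
by rewrite muE ltxx.
Qed.

Lemma ge0_integral_block (B : set R) (f : R -> \bar R) : measurable B -> B `<=` J ->
  measurable_fun (setT : set (measurableTypeR R)) f -> (forall t, 0 <= f t)%E ->
  (\int[H]_(x in @rval R @^-1` B) f (rval x) =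
   (2 ^+ n)%:E * \int[lebesgue_measure]_(t in B) f t)%E.
Proof.
move=> mB BJ mf f0.
have p0 : 0 <= 2 ^+ n :> R by rewrite exprn_ge0.
pose m0 : {measure set (measurableTypeR R) -> \bar R} :=
  pushforward H (@rval R : T -> measurableTypeR R).
pose m1 := m0 measurable_rval.
pose m2 : {measure set (measurableTypeR R) -> \bar R} :=
  mscale (NngNum p0) (@lebesgue_measure R).
transitivity (\int[m1]_(t in B) f t)%E.
  by rewrite (ge0_integral_pushforward measurable_rval H mB (measurable_funTS mf)).
transitivity (\int[m2]_(t in B) f t)%E.
  apply: (@eq_measure_integral _ (measurableTypeR R) R B m2 m1 f) => A mA AB.
  by apply: (mu_block_lebesgue mA); exact: subset_trans BJ.
by rewrite ge0_integral_mscale //; exact: measurable_funTS.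
Qed.

Lemma Rintegral_block (B : set R) (f : R -> R) : measurable B -> B `<=` J ->
  measurable_fun setT f -> lebesgue_measure.-integrable B (EFin \o f) ->
  \int[H]_(x in @rval R @^-1` B) f (rval x) =
  2 ^+ n * \int[lebesgue_measure]_(t in B) f t.
Proof.
move=> mB BJ mf fi; rewrite /Rintegral.
rewrite [in LHS]integralE [in RHS]integralE.
have mfe : measurable_fun (setT : set (measurableTypeR R)) (EFin \o f).
  exact/measurable_EFinP.
have intE (g : R -> \bar R) : measurable_fun (setT : set (measurableTypeR R)) g ->
    (forall t, 0 <= g t)%E -> forall h : T -> \bar R, h =1 g \o @rval R ->
    (\int[H]_(x in @rval R @^-1` B) h x =
     (2 ^+ n)%:E * \int[lebesgue_measure]_(t in B) g t)%E.
  move=> mg g0 h hg; rewrite -(ge0_integral_block mB BJ mg g0).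
  by apply: eq_integral => x _; rewrite hg.
rewrite (intE _ (measurable_funepos mfe) (@funepos_ge0 _ _ _)
  ((fun x : T => (f (rval x))%:E)^\+)%E); last by move=> x; rewrite /= !funeposE.
rewrite (intE _ (measurable_funeneg mfe) (@funeneg_ge0 _ _ _)
  ((fun x : T => (f (rval x))%:E)^\-)%E); last by move=> x; rewrite /= !funenegE.
have mBL : measurable (B : set (measurableTypeR R)) by exact: mB.
have fp := integrable_fin_num mBL (integrable_funepos mBL fi).
have fn := integrable_fin_num mBL (integrable_funeneg mBL fi).
by rewrite -muleBr ?fin_num_adde_defr // fineM // fin_numB fp fn.
Qed.

End BlockIntegral.
End Blocks.

(** * Integrals of A_n-measurable functions *)

Section Integrals.
Variables (R : realType) (Delta : dyadic -> R).
Hypothesis DD : dyadic_diameter Delta.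
Local Notation I := (I01 R).
Variable n : nat.
Local Notation mu := (hausdorffn Delta n).
Local Notation T := (caratheodory_type mu).
Local Notation H := (Hn Delta n).
Implicit Types (g h : I -> R) (A B : set I) (M : R).

Lemma mu0_sub A B : A `<=` B -> mu B = 0%E -> mu A = 0%E.
Proof.
move=> AB B0; apply/eqP; rewrite eq_le outer_measure_ge0 andbT -B0.
exact: le_outer_measure.
Qed.

Lemma mu0_bigcup (F : (set I)^nat) : (forall k, mu (F k) = 0%E) ->
  mu (\bigcup_k F k) = 0%E.
Proof.
move=> h; apply/eqP; rewrite eq_le outer_measure_ge0 andbT.
apply: le_trans (outer_measure_sigma_subadditive mu F) _.
by rewrite eseries0 // => k _ _.
Qed.

Lemma mu0U A B : mu A = 0%E -> mu B = 0%E -> mu (A `|` B) = 0%E.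
Proof. by move=> A0 B0; rewrite -bigcup2E; apply: mu0_bigcup => -[|[|k]] //=; exact: outer_measure0. Qed.

Lemma aeE (P : I -> Prop) : {ae H, forall x, P x} <-> mu [set x | ~ P x] = 0%E.
Proof. exact: negligibleE. Qed.

Definition An_fun g := measurable_fun setT (g : g_sigma_algebraType (An_gen Delta n) -> R).

Lemma An_funP g : An_fun g <-> forall B : set R, measurable B -> An Delta n (g @^-1` B).
Proof.
split => [mg B mB|h _ B mB]; last by rewrite setTI; exact: h.
by have := mg measurableT B mB; rewrite setTI.
Qed.

Definition ess_bdd M g := mu [set x | ~ (`|g x| <= M)] = 0%E.

Section Bounded.
Variables (M : R) (g : I -> R).
Hypotheses (M0 : 0 <= M) (mg : An_fun g) (bg : ess_bdd M g).

Let mgT : measurable_fun setT (g : T -> R).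
Proof. exact: An_measurable_fun. Qed.

Lemma integral_abs_le D : measurable (D : set T) ->
  (\int[H]_(x in D) `|(g x)%:E| <= M%:E * mu D)%E.
Proof.
move=> mD; apply: (integral_le_bound M%:E).
- exact: mD.
- exact/measurable_EFinP/measurable_funTS.
- by rewrite lee_fin.
- apply/aeE; apply: mu0_sub bg => x /= h b; apply: h => _; exact: b.
Qed.

Lemma integrable_An D : measurable (D : set T) -> H.-integrable D (EFin \o g).
Proof.
move=> mD; apply/integrableP; split; first exact/measurable_EFinP/measurable_funTS.
apply: le_lt_trans (integral_abs_le mD) _.
by apply: lte_mul_pinfty; rewrite // -ge0_fin_numE ?outer_measure_ge0 // mu_fin.
Qed.

Lemma Rint_le D : measurable (D : set T) ->
  `|\int[H]_(x in D) g x| <= M * fine (mu D).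
Proof.
move=> mD; apply: le_trans (le_normr_Rintegral mD (integrable_An mD)) _.
rewrite /Rintegral -[M]/(fine M%:E) -fineM ?mu_fin //.
have fin : (M%:E * mu D)%E \is a fin_num by rewrite fin_numM ?mu_fin.
apply: fine_le => //; last exact: integral_abs_le.
rewrite ge0_fin_numE ?integral_ge0 //.
apply: le_lt_trans (integral_abs_le mD) _; rewrite -ge0_fin_numE //.
by rewrite mule_ge0 // outer_measure_ge0.
Qed.

Lemma Rint_null A B : measurable (A : set T) -> measurable (B : set T) ->
  mu (A `\` B) = 0%E -> mu (B `\` A) = 0%E ->
  \int[H]_(x in A) g x = \int[H]_(x in B) g x.
Proof.
move=> mA mB AB BA; rewrite /Rintegral; congr fine.
have N0 := mu0U AB BA; set N := _ `|` _ in N0.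
have mN : measurable (N : set T) by exact: measurable_null.
rewrite (negligible_integral mN mA (integrable_An mA) N0).
rewrite (negligible_integral mN mB (integrable_An mB) N0).
congr (integral _ _ _); apply/seteqP; split=> x [Ax nN]; split => //;
  by apply: contrapT => nx; apply: nN; first [by left|by right].
Qed.

Definition below (x : I) : set I := [set y | rval y <= rval x].

Lemma measurable_below x : measurable (below x : set T).
Proof. exact: mu_le_cara. Qed.

Lemma Rint_below x y : rval x <= rval y ->
  Imap_n Delta n g y - Imap_n Delta n g x =
  \int[H]_(z in @rval R @^-1` `]rval x, rval y]%classic) g z.
Proof.
move=> xy; rewrite /Imap_n.
have -> : [set z : I | rval z <= rval y] =
    below x `|` (@rval R @^-1` `]rval x, rval y]%classic).
  apply/seteqP; split=> z /=; rewrite in_itv /=.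
    by move=> zy; have [zx|xz] := leP (rval z) (rval x); [left|right].
  by move=> [/le_trans|/andP[_]]; [exact|].
rewrite Rintegral_setU.
- by rewrite addrAC subrr add0r.
- exact: measurable_below.
- by apply: measurable_preimage => //; exact: measurable_itv.
- apply: integrable_An; apply: measurableU; first exact: measurable_below.
  by apply: measurable_preimage => //; exact: measurable_itv.
- apply/disj_setPS => z /= [zx]; rewrite in_itv /= => /andP[xz _].
  by move: zx; rewrite /below /= leNgt xz.
Qed.

Lemma Imap_n_lip x y : `|Imap_n Delta n g x - Imap_n Delta n g y| <=
  M * 2 ^+ n * `|rval x - rval y|.
Proof.
wlog xy : x y / rval x <= rval y.
  move=> hw; have [|/ltW] := leP (rval x) (rval y); first exact: hw.
  by move/hw; rewrite distrC (distrC (rval y)).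
rewrite distrC (distrC (rval x)) Rint_below // (ger0_norm (_ : 0 <= rval y - rval x)) ?subr_ge0 //.
apply: le_trans (Rint_le _) _; first by apply: measurable_preimage => //; exact: measurable_itv.
rewrite -mulrA ler_wpM2l // -lee_fin fineK ?mu_fin //.
by apply: mu_itv => // z /=; rewrite in_itv /= => /andP[/ltW -> ->].
Qed.

Lemma Imap_n_0 : Imap_n Delta n g (zero01 R) = 0.
Proof.
rewrite /Imap_n (_ : [set y : I | rval y <= 0] = [set y | rval y = 0]).
  apply/eqP; rewrite -normr_le0; apply: le_trans (Rint_le _) _.
    by apply: measurable_null; apply: mu_lneg => //; exact: lneg_rval.
  by rewrite (mu_lneg DD n (lneg_rval _)) mulr0.
apply/seteqP; split=> y /=; last by move=> ->.
by move=> y0; apply: le_anti; rewrite y0; have /andP[] := rvalP y.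
Qed.

(** Every set where g < q is null or conull in the atom ([An_leaf]), so g is
    almost everywhere the supremum of the q for which the set is null. *)
Lemma An_fun_leaf l : leaf Delta n l ->
  exists c, mu (dint l `&` [set x | g x <> c]) = 0%E.
Proof.
move=> ll.
have dich q : lneg (dint l `&` [set x | g x < q]) \/ lneg (dint l `&` [set x | ~ (g x < q)]).
  have := An_leaf DD ll ((An_funP g).1 mg `]-oo, q[%classic (measurable_itv _)).
  have -> : g @^-1` `]-oo, q[%classic = [set x | g x < q].
    by apply/seteqP; split=> x /=; rewrite in_itv.
  by rewrite setDE.
pose S := [set q | lneg (dint l `&` [set x | g x < q])].
have Sdown p q : p <= q -> S q -> S p.
  by move=> pq; apply: lnegS => x [lx gx]; split => //; exact: lt_le_trans pq.
have [q0 Sq0] : exists q, S q.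
  apply: contrapT => nS; apply: (@not_lneg_dint R l).
  apply: (@lnegS _ _ (\bigcup_k (dint l `&` [set x | ~ (g x < - k%:R)]))) => [x lx|].
    exists (Num.truncn `|g x|).+1 => //; split => //=.
    have /andP[_ h] := truncn_itv (normr_ge0 (g x)).
    by apply/negP; rewrite -leNgt; move: h; rewrite ltr_norml => /andP[/ltW].
  by apply: lneg_bigcup => k; case: (dich (- k%:R)) => // h; case: nS; exists (- k%:R).
have [q1 nSq1] : exists q, ~ S q.
  apply: contrapT => aS; apply: (@not_lneg_dint R l).
  apply: (@lnegS _ _ (\bigcup_k (dint l `&` [set x | g x < k%:R]))) => [x lx|].
    exists (Num.truncn `|g x|).+1 => //; split => //=.
    have /andP[_ h] := truncn_itv (normr_ge0 (g x)).
    exact: le_lt_trans (ler_norm _) h.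
  by apply: lneg_bigcup => k; apply: contrapT => h; apply: aS; exists k%:R.
have hs : has_sup S.
  split; first by exists q0.
  exists q1 => q Sq; rewrite leNgt; apply/negP => q1q; apply: nSq1.
  exact: Sdown (ltW q1q) Sq.
exists (sup S); apply: mu_lneg => //.
apply: (@lnegS _ _ ((\bigcup_k (dint l `&` [set x | g x < sup S - k.+1%:R^-1])) `|`
    \bigcup_k (dint l `&` [set x | ~ (g x < sup S + k.+1%:R^-1)]))).
  have inv (e : R) : 0 < e -> exists k : nat, k.+1%:R^-1 <= e :> R.
    move=> e0; exists (Num.truncn e^-1).
    have ei : 0 <= e^-1 by rewrite invr_ge0 ltW.
    have /andP[_ /ltW h] := truncn_itv ei.
    by rewrite -[leRHS]invrK lef_pV2 // posrE ?invr_gt0.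
  move=> x [lx /= /eqP]; rewrite neq_lt => /orP[gs|sg]; [left|right].
    have [k hk] := inv ((sup S - g x) / 2) ltac:(lra).
    by exists k => //; split => //; rewrite /mkset; move: (_^-1) hk => w hk; lra.
  have [k hk] := inv (g x - sup S) ltac:(lra).
  by exists k => //; split => //; rewrite /mkset; apply/negP; rewrite -leNgt; move: (_^-1) hk => w hk; lra.
apply: lnegU; apply: lneg_bigcup => k.
  have k0 : 0 < k.+1%:R^-1 :> R by rewrite invr_gt0 ltr0n.
  have [q Sq hq] := sup_adherent k0 hs; apply: Sdown Sq; exact: ltW.
case: (dich (sup S + k.+1%:R^-1)) => // h; exfalso.
have := ub_le_sup hs.2 h; rewrite leNgt => /negP; apply.
by rewrite ltrDl invr_gt0 ltr0n.
Qed.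

End Bounded.
End Integrals.

(** * Kernels of the conditional expectations, and primitives *)

Section Kernel.
Variables (R : realType) (Delta : dyadic -> R).
Hypothesis DD : dyadic_diameter Delta.
Local Notation I := (I01 R).
Implicit Types (g h : I -> R) (M : R) (n m : nat).

(** The equation condexp n g = 0 up to null sets; see [condexp_zeroP]. *)
Definition mean_zero n g : Prop :=
  if n is m.+1 then
    hausdorffn Delta n (Diff Delta m `&` [set x | g x <> 0]) = 0%E /\
    forall l, leaf Delta m l -> \int[Hn Delta n]_(x in ditv l) g x = 0
  else True.

Lemma below_inE x l : ~ dint l x -> rval x <= lo R l \/ hi R l <= rval x.
Proof.
rewrite dintE => nl; have [|h1] := leP (rval x) (lo R l); first by left.
by have [|h2] := leP (hi R l) (rval x); [right|case: nl; rewrite h1].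
Qed.

Lemma measurable_dint n e : measurable (dint e : set (caratheodory_type (hausdorffn Delta n))).
Proof.
have -> : dint e = @rval R @^-1` `]lo R e, hi R e[%classic.
  by apply/seteqP; split=> x /=; rewrite dintE in_itv.
by apply: measurable_preimage => //; exact: measurable_itv.
Qed.

Lemma mu_dyadic_pt n : hausdorffn Delta n (dyadic_pt R) = 0%E.
Proof. by apply: mu_lneg => //; exact: lneg_dyadic_pt. Qed.

Lemma mu_ditv_dint n e : hausdorffn Delta n (ditv e `\` dint e) = 0%E.
Proof. by apply: mu_lneg => //; exact: ditv_diff_dint. Qed.

Section OneLevel.
Variables (M : R) (n : nat) (g : I -> R).
Hypotheses (M0 : 0 <= M) (mg : An_fun Delta n g) (bg : ess_bdd Delta n M g).
Local Notation mu := (hausdorffn Delta n).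
Local Notation T := (caratheodory_type mu).
Local Notation H := (Hn Delta n).
Local Notation J := (Imap_n Delta n g).

Let ig := integrable_An DD M0 mg bg.

(** An initial segment that ends at a point of Diff m is a disjoint union of a part
    of Diff m, where g vanishes, and of atoms of A_m, where g has mean zero. *)
Lemma Imap_n_Diff m x : n = m.+1 -> mean_zero n g -> Diff Delta m x -> J x = 0.
Proof.
move=> nm; have : mean_zero n g = (mu (Diff Delta m `&` [set x | g x <> 0]) = 0%E /\
    forall l, leaf Delta m l -> \int[H]_(x in ditv l) g x = 0) by rewrite nm.
move=> -> [g0 gl] xD.
pose F k : set I := if k is k'.+1 then
    (if pickle_inv k' is Some l then
      (if `[< leaf Delta m l /\ hi R l <= rval x >] then dint l else set0) else set0)
  else Diff Delta m `&` [set y | rval y <= rval x].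
have F_l k y : F k.+1 y -> exists l, [/\ pickle_inv k = Some l, leaf Delta m l,
    hi R l <= rval x & dint l y].
  rewrite /F; case E : (pickle_inv k) => [l|//]; case: asboolP => // -[h1 h2] ly.
  by exists l.
have UF : [set y | rval y <= rval x] = \bigcup_k F k.
  apply/seteqP; split=> [y /= yx|y [[|k] _]].
  - have [yD|/notDiffP] := pselect (Diff Delta m y); first by exists 0%N.
    move=> /(_ DD)[l ll ly]; exists (pickle l).+1 => //.
    rewrite /F pickleK_inv asboolT //; split => //.
    case: (below_inE ((DiffP DD _ _).1 xD l ll)) => // xl.
    by move: ly; rewrite dintE; lra.
  - by move=> [].
  - move=> /F_l[l [_ _ lx]]; rewrite dintE /=; lra.
have mD : measurable (Diff Delta m : set T).
  rewrite /Diff; apply: measurableC.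
  have -> : \bigcup_(e in At Delta m) @dint R e = \bigcup_(e in leaf Delta m) dint e.
    by apply: eq_bigcupl; split=> e /(At_leaf DD).
  rewrite bigcup_countType; apply: bigcup_measurable => k _.
  case: (unpickle k) => [l|]; last exact: measurable0.
  have [ll|nl] := pselect (leaf Delta m l).
    rewrite (_ : mkset _ = dint l); first exact: measurable_dint.
    by apply/seteqP; split=> [y []|y].
  by rewrite (_ : mkset _ = set0); [exact: measurable0|apply/seteqP; split=> // y []].
have mF k : measurable (F k : set T).
  case: k => [|k]; first by apply: measurableI => //; exact: measurable_below.
  rewrite /F; case: (pickle_inv k) => [l|]; last exact: measurable0.
  by case: asboolP => _; [exact: measurable_dint|exact: measurable0].
have tF : trivIset setT F.
  have D0 k y : F 0%N y -> F k.+1 y -> False.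
    by move=> [yD _] /F_l[l [_ ll _]]; exact: (DiffP DD m y).1.
  move=> [|i] [|j] _ _ [y [yi yj]] //.
  - by case: (D0 j y).
  - by case: (D0 i y).
  move: yi yj => /F_l[l [il ll _ ly]] /F_l[l' [jl ll' _ ly']].
  have ee := leaf_uniq DD ll ll' ly ly'; rewrite -ee in jl.
  by have := @pickle_invK dyadic i; have := @pickle_invK dyadic j; rewrite il jl /= => <- <-.
rewrite /Imap_n UF /Rintegral integral_bigcup //; last by apply: ig; rewrite -UF; exact: measurable_below.
rewrite eseries0 // => k _ _.
have E : forall A, measurable (A : set T) -> \int[H]_(y in A) g y = 0 ->
    (\int[H]_(y in A) (g y)%:E = 0)%E.
  by move=> A mA; rewrite /Rintegral => h; rewrite -(fineK (integrable_fin_num mA (ig mA))) /= h.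
apply: E => //; case: k => [|k] /=.
  apply/eqP; rewrite -normr_le0.
  have z : \int[H]_(y in F 0%N) g y = \int[H]_(y in F 0%N `\` (Diff Delta m `&` [set y | g y <> 0])) g y.
    rewrite /Rintegral; congr fine; apply: negligible_integral => //; last exact: ig.
    exact: measurable_null.
  rewrite z (_ : \int[H]_(y in _) g y = \int[H]_(y in F 0%N `\` (Diff Delta m `&` [set y | g y <> 0])) 0).
    by rewrite Rintegral_cst ?mul0r ?normr0 //; apply: measurableD => //; exact: measurable_null.
  apply: eq_Rintegral => y; rewrite inE => -[[yD _] ny].
  by apply: contrapT => gy; apply: ny.
case: (pickle_inv k) => [l|]; last by rewrite Rintegral_set0.
case: asboolP => [[ll _]|_]; last by rewrite Rintegral_set0.
rewrite -(gl l ll); apply: (Rint_null DD M0 mg bg) => //.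
- exact: measurable_dint.
- exact: measurable_ditv.
- by rewrite setDE (_ : _ `&` _ = set0) ?outer_measure0 //; apply/seteqP; split=> // y [/dint_ditv ? ?].
- exact: mu_ditv_dint.
Qed.

(** The primitive vanishes at the left end of the atom, and its slope is at most
    M 2^n, that is 2 M times the weight of the atom. *)
Lemma Imap_n_tail m l x : n = m.+1 -> mean_zero n g -> leaf Delta m l -> ditv l x ->
  `|J x| <= 2 * M * Delta l.
Proof.
move=> nm g0 ll lx.
have J0 : J (pt (lo R l)) = 0.
  apply: (Imap_n_Diff nm g0); apply: (Diff_lohi DD (leaf_wt ll)).
  by left; rewrite rval_lo.
have := Imap_n_lip DD M0 mg bg x (pt (lo R l)); rewrite J0 subr0 rval_lo => /le_trans; apply.
rewrite (leaf_Delta ll) (_ : 2 * M * _ = M * 2 ^+ n * len R l); last by rewrite nm exprS; ring.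
apply: ler_wpM2l; first by rewrite mulr_ge0 // exprn_ge0.
by move: lx; rewrite ditvE hiE ler_distl; lra.
Qed.

Lemma Imap_n_affine l : leaf Delta n l ->
  exists a b, forall x, ditv l x -> J x = a * rval x + b.
Proof.
move=> ll; have [c gc] := An_fun_leaf DD mg ll.
have [e be el] : exists2 e, block Delta n e & anc e l.
  case En : n => [|m]; first by exists dtop; last exact: dtop_anc.
  have [|l' [b [ll' a]]] := @leaf_ex _ _ DD m l.
    by case: ll => -> _; rewrite En pow2_lt.
  by exists l' => //; apply: anc_trans a; apply: anc_child; exact: ancxx.
exists (c * 2 ^+ n), (J (pt (lo R l)) - c * 2 ^+ n * lo R l) => x lx.
suff : J x - J (pt (lo R l)) = c * (2 ^+ n * (rval x - lo R l)) by lra.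
move: (lx); rewrite ditvE => /andP[l1 l2].
rewrite (Rint_below DD M0 mg bg) rval_lo //.
pose B := `]lo R l, rval x]%classic : set R.
have mB : measurable B by exact: measurable_itv.
have mA : measurable (@rval R @^-1` B : set T) by exact: measurable_preimage.
pose N := dint l `&` [set x | g x <> c] `|` dyadic_pt R.
have N0 : mu N = 0%E by apply: mu0U => //; exact: mu_dyadic_pt.
have mN : measurable (N : set T) by exact: measurable_null.
have muA : mu (@rval R @^-1` B) = (2 ^+ n * (rval x - lo R l))%:E.
  rewrite (mu_block_lebesgue DD be) //.
    rewrite /B lebesgue_measure_itv /= lte_fin; case: ifPn => [_|]; first by rewrite -EFinM.
    by rewrite -leNgt => xl; have -> : rval x = lo R l by [lra]; rewrite subrr mulr0 mule0.
  move=> t; rewrite /B /= !in_itv /= => /andP[t1 t2].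
  by have [] := anc_lohi R el; lra.
rewrite /Rintegral (negligible_integral mN mA (ig mA) N0).
rewrite (eq_integral (fun=> c%:E)); last first.
  move=> y; rewrite inE => -[/= + nN]; rewrite /B /= in_itv /= => /andP[y1 y2].
  congr EFin; apply: contrapT => gy; apply: (nN); left; split => //.
  apply: ditv_dint => [dy|]; first by apply: nN; right.
  by rewrite ditvE; lra.
rewrite integral_cst; last exact: measurableD.
have -> : H (@rval R @^-1` B `\` N) = mu (@rval R @^-1` B).
  apply/eqP; rewrite eq_le; apply/andP; split; first by apply: le_outer_measure; exact: subDsetl.
  apply: (@le_trans _ _ (mu ((@rval R @^-1` B `\` N) `|` N))).
    by apply: le_outer_measure => y By; have [|] := pselect (N y); [right|left].
  by apply: le_trans (outer_measureU2 _ _ _) _; rewrite N0 adde0.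
by rewrite muA -EFinM.
Qed.

(** ** Primitives determine functions *)

(** The initial segments up to null sets form a pi-system, and the sigma-algebra
    that they generate contains A_n. *)
Let null_or_below : set (set I) := [set A | lneg A] `|`
  [set A | exists x, lneg (A `\` @below R x) /\ lneg (@below R x `\` A)].

Let null_or_below_setI : setI_closed null_or_below.
Proof.
move=> A B [A0|[x [x1 x2]]]; first by left; apply: lnegS A0; exact: subIsetl.
case=> [B0|[y [y1 y2]]]; first by left; apply: lnegS B0; exact: subIsetr.
wlog xy : A B x y x1 x2 y1 y2 / rval x <= rval y.
  move=> hw; have [h|/ltW h] := leP (rval x) (rval y); first exact: (hw A B x y).
  by rewrite setIC; exact: (hw B A y x).
right; exists x; split.
  by apply: lnegS x1 => z [[Az Bz] nz].
apply: lnegS (lnegU x2 y2) => z [zx nAB].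
have [Az|nAz] := pselect (A z); last by left.
right; split; first exact: le_trans zx xy.
by move=> Bz; apply: nAB.
Qed.

Let An_null_or_below : An Delta n `<=` <<s null_or_below >>.
Proof.
apply: smallest_sub; first exact: smallest_sigma_algebra.
move=> A [A0|[e /= _ <-]]; first by apply: sub_sigma_algebra; left.
have gen x : <<s null_or_below >> (@below R x).
  by apply: sub_sigma_algebra; right; exists x; rewrite setDv; split; exact: lneg0.
pose S := g_sigma_algebraType null_or_below.
have mS x : measurable (@below R x : set S) by exact: gen.
have -> : @ditv R e = (below (pt (hi R e)) `\` below (pt (lo R e))) `|` [set x | rval x = lo R e].
  apply/seteqP; split=> [x|x].
    rewrite ditvE => /andP[h1 h2].
    have [h|h] := eqVneq (rval x) (lo R e); [by right|left; split].
      by rewrite /below /= rval_hi.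
    by rewrite /below /= rval_lo => h3; move/eqP: h; apply; apply: le_anti; rewrite h1 h3.
  rewrite ditvE => -[[]|/= ->]; last by rewrite lexx ltW // lo_lt_hi.
  by rewrite /below /= rval_lo rval_hi => -> /negP; rewrite -ltNge => /ltW ->.
suff : measurable ((below (pt (hi R e)) `\` below (pt (lo R e))) `|`
    [set x | rval x = lo R e] : set S) by [].
apply: measurableU; first by apply: measurableD; exact: mS.
by apply: sub_sigma_algebra; left; exact: lneg_rval.
Qed.

(** The integral of g vanishes over a pi-system that generates A_n, so over all
    of A_n, in particular over the sets where g is positive or negative. *)
Lemma Imap_n_inj : (forall x, J x = 0) -> mu [set x | g x <> 0] = 0%E.
Proof.
move=> J0.
pose Z := [set A : set I | measurable (A : set T) /\ \int[H]_(x in A) g x = 0].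
have dZ : <<s null_or_below >> `<=` Z.
  move=> A hA; apply: (@dynkin_induction _ (g_sigma_algebraType null_or_below) null_or_below Z) => //.
  - split => //; rewrite -[RHS](J0 (pt 1)) /Imap_n; congr (Rintegral _ _ _).
    apply/seteqP; split=> // x _ /=; rewrite rval_pt ?lexx ?ler01 //.
    by have /andP[] := rvalP x.
  - move=> B [B0|[x [x1 x2]]].
      have mB : measurable (B : set T) by apply: measurable_null; exact: mu_lneg.
      split => //; apply/eqP; rewrite -normr_le0.
      by apply: le_trans (Rint_le DD M0 mg bg mB) _; rewrite (mu_lneg DD n B0) mulr0.
    have m1 : measurable (B `\` below x : set T) by apply: measurable_null; exact: mu_lneg.
    have m2 : measurable (below x `\` B : set T) by apply: measurable_null; exact: mu_lneg.
    have mb : measurable (@below R x : set T) by exact: measurable_below.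
    have mB : measurable (B : set T).
      have -> : B = (B `\` below x) `|` (below x `\` (below x `\` B)).
        by rewrite setDD setUC -setIC setUIDK.
      by apply: measurableU => //; exact: measurableD.
    split => //; rewrite -[RHS](J0 x) /Imap_n; apply: (Rint_null DD M0 mg bg) => //;
      exact: mu_lneg.
  - move=> B _ [mB B0]; split; first exact: measurableC.
    have := @Rintegral_setU _ _ _ H B (~` B) g mB (measurableC mB).
    rewrite setUv B0 add0r => <-.
    + rewrite -[RHS](J0 (pt 1)) /Imap_n; congr (Rintegral _ _ _).
      apply/seteqP; split=> // x _ /=; rewrite rval_pt ?lexx ?ler01 //.
      by have /andP[] := rvalP x.
    + exact: ig.
    + by apply/disj_setPS; rewrite setICr.
  - move=> F mF tF ZF; have mU : measurable (\bigcup_k F k : set T).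
      by apply: bigcup_measurable => k _; case: (ZF k).
    split => //; rewrite /Rintegral integral_bigcup //.
    + rewrite eseries0 // => k _ _; have [mFk] := ZF k; rewrite /Rintegral => h.
      by rewrite -(fineK (integrable_fin_num mFk (ig mFk))) /= h.
    + by move=> k; case: (ZF k).
    + exact: ig.
have half (P : R -> bool) (s : R) : s != 0 -> measurable [set t : R | P t] ->
    (forall t, P t -> 0 < s * t) -> mu [set x | P (g x)] = 0%E.
  move=> s0 mP Ps.
  have AP : An Delta n [set x | P (g x)] by exact: (An_funP _ _ _).1 mg [set t | P t] mP.
  have [mA int0] := dZ _ (An_null_or_below AP).
  have mgA : measurable_fun [set x : T | P (g x)] (fun x => (g x)%:E).
    exact/measurable_EFinP/measurable_funTS/An_measurable_fun.
  have : (\int[H]_(x in [set x | P (g x)]) `|(g x)%:E| = 0)%E.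
    transitivity (\int[H]_(x in [set x | P (g x)]) ((Num.sg s)%:E * (g x)%:E))%E.
      apply: eq_integral => x; rewrite inE /= => /Ps; rewrite -EFinM.
      move: s0; rewrite neq_lt => /orP[s_lt0|s_gt0].
        by rewrite nmulr_rgt0 // => ?; rewrite ltr0_sg // mulN1r /= ltr0_norm.
      by rewrite pmulr_rgt0 // => ?; rewrite gtr0_sg // mul1r /= gtr0_norm.
    rewrite integralZl //; last exact: ig.
    have := fineK (integrable_fin_num mA (ig mA)).
    by move: int0; rewrite /Rintegral => -> <-; rewrite mule0.
  move=> /(ae_eq_integral_abs H mA mgA) /aeE; apply: mu0_sub => x /= Px h.
  have := h Px; case => gx; have := Ps _ Px.
  by rewrite gx mulr0 ltxx.
apply: (@mu0_sub _ _ _ _ ([set x | 0 < g x] `|` [set x | g x < 0])).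
  by move=> x /= /eqP; rewrite neq_lt => /orP[]; [right|left].
apply: mu0U.
  apply: (half (fun t => 0 < t) 1) => //; last by move=> t; rewrite mul1r.
  rewrite (_ : mkset _ = `]0, +oo[%classic); first exact: measurable_itv.
  by apply/seteqP; split=> t /=; rewrite in_itv /= andbT.
apply: (half (fun t => t < 0) (-1)) => //; last by move=> t; rewrite mulN1r oppr_gt0.
rewrite (_ : mkset _ = `]-oo, 0[%classic); first exact: measurable_itv.
by apply/seteqP; split=> t /=; rewrite in_itv.
Qed.

End OneLevel.
End Kernel.

(** * Doubling *)

Section Doubling.
Variables (R : realType) (Delta : dyadic -> R).
Hypothesis DD : dyadic_diameter Delta.
Local Notation I := (I01 R).
Local Notation d := (dmetric Delta).

Let Delta_ge0 e : 0 <= Delta e.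
Proof. exact/ltW/Delta_gt0. Qed.

Lemma Delta_clamp c (x y : I) :
  wt Delta c * `|clamp c (rval x) - clamp c (rval y)| <= d x y.
Proof.
apply: clamp_dmetric => // e e' a; split; first exact: Delta_anc.
exact: wt_anc.
Qed.

Lemma Delta_childP e :
  (forall b, Delta (child b e) = Delta e / 2) \/ (forall b, Delta (child b e) = Delta e).
Proof. by case: DD => _ _ /(_ e) [] [h0 h1] _; [left|right]; case. Qed.

Lemma Delta_dich e e' : anc e e' -> Delta e' = Delta e \/ Delta e' <= Delta e / 2.
Proof.
move: e'; apply: anc_ind => [|b e' _ IH]; first by left.
have p := Delta_gt0 DD e'.
by case: (Delta_childP e') => ->; case: IH => h; rewrite ?h; [right|right|left|right]; lra.
Qed.

(** A dyadic interval c between x and y forces the distances of any p to x and y to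
    add up to at least Delta c: clamp to c. *)
Let separated (r : R) (x y : I) : Prop := exists2 c, r <= Delta c &
  (rval x <= lo R c /\ hi R c <= rval y) \/ (rval y <= lo R c /\ hi R c <= rval x).

Let separated_far r x y p : separated r x y -> r <= d p x + d p y.
Proof.
move=> [c rc xy]; apply: le_trans rc _.
apply: le_trans (lerD (Delta_clamp c p x) (Delta_clamp c p y)).
rewrite -mulrDr Delta_wt ler_pM2l ?wt_gt0 //.
have -> : len R c = hi R c - lo R c by rewrite hiE addrAC subrr add0r.
set P := clamp c (rval p); case: xy => -[h1 h2]; rewrite (clamp_lo h1) (clamp_hi h2).
  by have := ler_norm (P - lo R c); have := ler_norm (hi R c - P);
    rewrite (distrC (hi R c)); lra.
by have := ler_norm (P - lo R c); have := ler_norm (hi R c - P);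
  rewrite (distrC (hi R c)); lra.
Qed.

(** When the diameter stays constant along k steps, the sibling left behind at each
    step has the same diameter. Of two midpoints of siblings the earlier is cut off
    from the later by a half of its sibling. *)
Let separated_points k : forall l l', anc l l' -> gen l' = (gen l + k)%N ->
  Delta l' = Delta l -> exists z : nat -> I,
  (forall i, (i < k)%N -> ditv l (z i)) /\
  forall i j, (i < j < k)%N -> separated (Delta l / 2) (z i) (z j).
Proof.
elim: k => [|k IH] l l' a gl Dl; first by exists (fun=> zero01 R); split=> // i j; rewrite ltn0 andbF.
have [ll|[b bl]] := anc_cases a.
  by move: gl; rewrite -ll -addSnnS => /eqP; rewrite -{1}(addn0 (gen l)) addSnnS eqn_add2l.
have Dc b' : Delta (child b' l) = Delta l.
  have p := Delta_gt0 DD l; have h := Delta_anc DD bl.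
  by case: (Delta_childP l) => e; rewrite e // in h *; move: h; rewrite Dl e; lra.
have [|| z [zl zs]] := IH _ _ bl; first by rewrite gl gen_child addSnnS.
  by rewrite Dl Dc.
pose s := child (~~ b) l.
exists (fun i => if i is i'.+1 then z i' else pt (mid R s)); split.
  move=> [_|i ik]; last first.
    by apply: anc_ditv (zl i ik); apply: anc_child; exact: ancxx.
  apply: (@anc_ditv R l s); first by apply: anc_child; exact: ancxx.
  by apply: dint_ditv; rewrite dintE rval_mid mid_in.
move=> [|i] [|j] //.
  rewrite !ltnS => /= jk; exists (child b s).
    rewrite -(Dc (~~ b)) -/s; have p := Delta_gt0 DD s.
    by case: (Delta_childP s) => ->; lra.
  have := zl j jk; rewrite rval_mid ditvE !hiE !lo_child !len_child /mid !lo_child !len_child.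
  by have := len_gt0 R l; case: (b); rewrite /=; [left|right]; split; lra.
rewrite !ltnS => ijk; have := zs i j ijk; by rewrite Dc.
Qed.

Variable N : nat.
Hypothesis dbl : doubling N d.

(** Let r be the diameter of l. Three applications of the doubling condition cover
    l by N^3 balls of radius r / 4, none of which contains two of the points of
    [separated_points]. *)
Lemma Delta_halves n l l' : leaf Delta n l -> leaf Delta (n + (N ^ 3).+1) l' -> anc l l' ->
  Delta l' <= Delta l / 2.
Proof.
move=> ll ll' a; case: (Delta_dich a) => // Dl; exfalso.
have gl : gen l' = (gen l + (N ^ 3).+1)%N.
  have := leaf_Delta ll; have := leaf_Delta ll'; rewrite Dl => -> /eqP.
  rewrite /len exprD eqr_div ?expf_neq0 // -mulrA (inj_eq (mulfI _)) ?expf_neq0 // -exprD.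
  by rewrite addnC => /eqP /(@ieexprIn R 2 ltac:(lra) ltac:(lra)) <-.
have [z [zl zs]] := separated_points a gl Dl.
have D0 := Delta_gt0 DD l.
pose cov x r : 'I_N -> I := if pselect (0 < r) is left h then sval (cid (dbl x h)) else fun=> x.
have covP x r y : 0 < r -> d x y < r -> exists i, d (cov x r i) y < r / 2.
  move=> r0 xy; rewrite /cov; case: pselect => // h.
  by case: cid => c /= /(_ y xy)[i _ hi]; exists i.
pose q1 := 2 * Delta l; pose q2 := q1 / 2; pose q3 := q2 / 2.
have q10 : 0 < q1 by rewrite /q1; lra.
have q20 : 0 < q2 by rewrite /q2; lra.
have q30 : 0 < q3 by rewrite /q3; lra.
pose c1 := cov (z 0%N) q1; pose c2 i := cov (c1 i) q2; pose c3 i j := cov (c2 i j) q3.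
have Z m : (m < (N ^ 3).+1)%N ->
    exists t : 'I_N * 'I_N * 'I_N, d (c3 t.1.1 t.1.2 t.2) (z m) < q3 / 2.
  move=> mk; have z0m : d (z 0%N) (z m) < q1.
    by apply: le_lt_trans (dmetric_le Delta_ge0 (zl _ (ltn0Sn _)) (zl _ mk)) _; rewrite /q1; lra.
  have [i1 h1] := covP _ _ _ q10 z0m.
  have [i2 h2] := covP _ _ _ q20 h1.
  have [i3 h3] := covP _ _ _ q30 h2.
  by exists (i1, i2, i3).
pose phi (m : 'I_(N ^ 3).+1) := sval (cid (Z m (ltn_ord m))).
have phi_inj : injective phi.
  move=> i j; wlog ij : i j / (i < j)%N => [hw h|].
    by case: (ltngtP i j) => [/hw|/hw|]; [exact|move=> /(_ (esym h))|exact: val_inj].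
  rewrite /phi; case: cid => t ti; case: cid => t' tj /= tt'; exfalso.
  rewrite -tt' in tj; have := zs i j; rewrite ij ltn_ord => /(_ isT).
  by move=> /(separated_far (c3 t.1.1 t.1.2 t.2)); move: ti tj; rewrite /q3 /q2 /q1; lra.
have := leq_card phi phi_inj; rewrite !card_prod !card_ord.
by rewrite !expnS expn0 muln1 mulnA ltnn.
Qed.

End Doubling.

(** * The sum operator *)

(** Shifting a partial sum S by K leaves at most S / 2, and the first K terms are
    at most b each; so S <= K b + S / 2. *)
Lemma sum_halving (R : realFieldType) (u : nat -> R) (K : nat) (b : R) :
  (forall i, 0 <= u i) -> (forall i, u i <= b) -> (forall i, u (K + i)%N <= u i / 2) ->
  forall j, \sum_(0 <= i < j) u i <= 2 * K%:R * b.
Proof.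
move=> u0 ub uK j; set S := \sum_(0 <= i < j) u i.
have : S <= \sum_(0 <= i < K + j) u i.
  by rewrite addnC (@big_cat_nat _ _ _ j) ?leq_addr //= lerDl sumr_ge0.
rewrite (@big_cat_nat _ _ _ K) ?leq_addr //= => h.
have h1 : \sum_(0 <= i < K) u i <= K%:R * b.
  rewrite big_mkord; apply: (@le_trans _ _ (\sum_(i < K) b)); first by apply: ler_sum.
  by rewrite sumr_const card_ord mulr_natl.
have h2 : \sum_(K <= i < K + j) u i <= S / 2.
  rewrite -{1}(add0n K) (addnC K) big_addn addnK /S mulr_suml.
  by apply: ler_sum_nat => i _; rewrite addnC.
lra.
Qed.

Section Sum.
Variables (R : realType) (Delta : dyadic -> R).
Hypothesis DD : dyadic_diameter Delta.
Variable N : nat.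
Hypothesis dbl : doubling N (dmetric Delta).
Local Notation I := (I01 R).
Local Notation d := (dmetric Delta).

Let Delta_ge0 e : 0 <= Delta e.
Proof. exact/ltW/Delta_gt0. Qed.

(** The value is 0 when no atom of A_n contains x in its interior. *)
Definition atom_diam (n : nat) (x : I) : R :=
  let l := xget dtop [set l | leaf Delta n l /\ dint l x] in
  if `[< leaf Delta n l /\ dint l x >] then Delta l else 0.

Lemma atom_diamE n l x : leaf Delta n l -> dint l x -> atom_diam n x = Delta l.
Proof.
move=> ll lx; rewrite /atom_diam; case: xgetP => [l' -> [ll' lx']|none].
  by rewrite asboolT // (leaf_uniq DD ll ll' lx lx').
by case: (none l).
Qed.

Lemma atom_diam0 n x : Diff Delta n x -> atom_diam n x = 0.
Proof.
move=> xD; rewrite /atom_diam asboolF // => -[ll lx].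
exact: (DiffP DD n x).1 xD _ ll lx.
Qed.

Lemma atom_diam_ge0 n x : 0 <= atom_diam n x.
Proof. by rewrite /atom_diam; case: asboolP. Qed.

Lemma atom_diam_le n e x : wt Delta e <= 2 ^+ n -> ditv e x -> atom_diam n x <= Delta e.
Proof.
move=> we ex; have [/atom_diam0 -> //|/(notDiffP DD)[l ll lx]] := pselect (Diff Delta n x).
rewrite (atom_diamE ll lx); apply: (Delta_anc DD); apply: (leaf_overlap DD ll we lx).
rewrite dintE; have xD := DiffP DD n x.
move: (ex); rewrite ditvE => /andP[h1 h2]; rewrite !lt_neqAle h1 h2 !andbT.
apply/andP; split; apply/eqP => h; apply: (xD.1 _ l ll lx);
  apply: (Diff_lohi DD we); [by left|by right].
Qed.

Lemma atom_diam_halves n x : atom_diam ((N ^ 3).+1 + n) x <= atom_diam n x / 2.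
Proof.
have [/atom_diam0 ->|/(notDiffP DD)[l' ll' lx']] := pselect (Diff Delta ((N ^ 3).+1 + n) x).
  by rewrite divr_ge0 ?atom_diam_ge0.
have [l ll a] := leaf_anc_leaf DD (leq_addl (N ^ 3).+1 n) ll'.
rewrite (atom_diamE ll' lx') (atom_diamE ll (anc_dint a lx')).
by apply: (Delta_halves DD dbl ll) => //; rewrite addnC.
Qed.

Lemma sum_atom_diam m e x j : wt Delta e <= 2 ^+ m -> ditv e x ->
  \sum_(0 <= i < j) atom_diam (m + i) x <= 2 * (N ^ 3).+1%:R * Delta e.
Proof.
move=> we ex; apply: sum_halving => i; first exact: atom_diam_ge0.
  by apply: atom_diam_le ex; apply: le_trans we _; rewrite pow2_le leq_addr.
by rewrite addnCA; exact: atom_diam_halves.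
Qed.

(** Representatives of the elements of norm at most M of the sum of the kernels;
    see [sum_kerP]. *)
Definition kerM (M : R) (g : nat -> I -> R) : Prop :=
  forall n, [/\ An_fun Delta n (g n), ess_bdd Delta n M (g n) & mean_zero Delta n (g n)].

Section Kernel.
Variables (M : R) (g : nat -> I -> R).
Hypotheses (M0 : 0 <= M) (gM : kerM M g).
Let u n x := Imap_n Delta n (g n) x.

Lemma Imap_term_le n x : `|u n.+1 x| <= 2 * M * atom_diam n x.
Proof.
have [m b z] := gM n.+1.
have [xD|/(notDiffP DD)[l ll lx]] := pselect (Diff Delta n x).
  by rewrite /u (Imap_n_Diff DD M0 m b erefl z xD) normr0 mulr_ge0 ?atom_diam_ge0 ?mulr_ge0.
by rewrite (atom_diamE ll lx); apply: (Imap_n_tail DD M0 m b erefl z ll); exact: dint_ditv.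
Qed.

Lemma Imap_n_Diff_sum k n x : (n < k)%N -> Diff Delta n x -> u k x = 0.
Proof.
case: k => // k; rewrite ltnS => nk /(Diff_le DD nk) xD.
by have [m b z] := gM k.+1; exact: (Imap_n_Diff DD M0 m b erefl z xD).
Qed.

Lemma Imap_abs_cvg x : cvgn (series (fun n => `|u n x|)).
Proof.
apply: nondecreasing_is_cvgn.
  by apply: nondecreasing_series => n _ _; exact: normr_ge0.
exists (`|u 0%N x| + 2 * M * (2 * (N ^ 3).+1%:R * Delta dtop)) => _ [j _ <-].
apply: (@le_trans _ _ (\sum_(0 <= i < j.+1) `|u i x|)).
  by rewrite /series /= big_nat_recr //= lerDl.
rewrite big_nat_recl //= lerD2l.
apply: (@le_trans _ _ (\sum_(0 <= i < j) 2 * M * atom_diam i x)).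
  by apply: ler_sum_nat => i _; exact: Imap_term_le.
rewrite -mulr_sumr ler_wpM2l ?mulr_ge0 //.
apply: (@sum_atom_diam 0%N); last exact: ditv_dtop.
by rewrite wt_dtop // expr0.
Qed.

Lemma Imap_cvg x : cvgn (series (fun n => u n x)).
Proof.
by have h := @normed_cvg R R^o (fun n => u n x); apply: h; exact: Imap_abs_cvg.
Qed.

Lemma Imap_Diff n x : Diff Delta n x ->
  Imap Delta g x = \sum_(0 <= k < n.+1) u k x.
Proof.
move=> xD; apply/cvg_lim => //; apply: cvg_near_cst; exists n.+1 => // j /= nj.
rewrite /series /= (@big_cat_nat _ _ _ n.+1) //= [X in _ + X]big_nat_cond.
rewrite [X in _ + X]big1 ?addr0 // => k; rewrite andbT => /andP[nk _].
exact: Imap_n_Diff_sum xD.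
Qed.

Definition lip_const : R := 2 + 8 * (N ^ 3).+1%:R.

(** On e, the terms of index n with 2^n <= wt e have slope at most M 2^n, and
    sum to a geometric series; the later ones vanish outside the atoms inside e,
    whose diameters decrease geometrically by the doubling condition. *)
Lemma Imap_osc e x y : ditv e x -> ditv e y ->
  `|Imap Delta g x - Imap Delta g y| <= lip_const * M * Delta e.
Proof.
move=> ex ey; have [m we] := wt_pow DD e.
have bound j : `|series (fun n => u n x) j - series (fun n => u n y) j| <=
    lip_const * M * Delta e.
  rewrite /series /= -sumrB.
  apply: le_trans (ler_norm_sum _ _ _) _.
  apply: (@le_trans _ _ (\sum_(0 <= i < m.+1 + j) `|u i x - u i y|)).
    by rewrite addnC [leRHS](@big_cat_nat _ _ _ j) ?leq_addr //= lerDl sumr_ge0.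
  rewrite (@big_cat_nat _ _ _ m.+1) ?leq_addr //=.
  have low : \sum_(0 <= i < m.+1) `|u i x - u i y| <= 2 * M * Delta e.
    have dxy : `|rval x - rval y| <= len R e.
      by move: ex ey; rewrite !ditvE hiE ler_distl; lra.
    apply: (@le_trans _ _ (\sum_(0 <= i < m.+1) M * 2 ^+ i * len R e)).
      apply: ler_sum_nat => i _; have [mi b z] := gM i.
      apply: le_trans (Imap_n_lip DD M0 mi b x y) _.
      by rewrite ler_wpM2l // mulr_ge0 // exprn_ge0.
    rewrite -mulr_suml -mulr_sumr (Delta_wt Delta e) we.
    rewrite (_ : 2 * M * (2 ^+ m * len R e) = M * (2 ^+ m.+1) * len R e); last by rewrite exprS; ring.
    apply: ler_wpM2r; first exact/ltW/len_gt0.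
    apply: ler_wpM2l => //.
    have := subrX1 (2 : R) m.+1; rewrite big_mkord (_ : 2 - 1 = 1 :> R) ?mul1r; last by ring.
    by move=> <-; rewrite gerBl.
  have high : \sum_(m.+1 <= i < m.+1 + j) `|u i x - u i y| <=
      8 * (N ^ 3).+1%:R * M * Delta e.
    rewrite -{1}(add0n m.+1) (addnC m.+1) big_addn addnK.
    apply: (@le_trans _ _ (\sum_(0 <= i < j)
        (2 * M * atom_diam (m + i) x + 2 * M * atom_diam (m + i) y))).
      apply: ler_sum_nat => i _; rewrite addnS addnC.
      by apply: le_trans (ler_normB _ _) _; apply: lerD; exact: Imap_term_le.
    rewrite big_split -!mulr_sumr /= -mulrDr.
    have h1 := @sum_atom_diam m e x j; have h2 := @sum_atom_diam m e y j.
    rewrite we in h1 h2; have {}h1 := h1 (lexx _) ex; have {}h2 := h2 (lexx _) ey.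
    apply: le_trans (ler_wpM2l _ (lerD h1 h2)) _; first by rewrite mulr_ge0.
    by rewrite le_eqVlt; apply/orP; left; apply/eqP; ring.
  apply: le_trans (lerD low high) _.
  by rewrite le_eqVlt; apply/orP; left; apply/eqP; rewrite /lip_const; ring.
have c : `|series (u^~ x) j - series (u^~ y) j| @[j --> \oo] -->
    `|Imap Delta g x - Imap Delta g y|.
  by apply: cvg_norm; apply: cvgB; exact: Imap_cvg.
rewrite -(cvg_lim _ c) //; apply: limr_le; first by apply/cvg_ex; eexists; exact: c.
by apply: nearW => j /=; exact: bound.
Qed.

Lemma lip_const_ge0 : 0 <= lip_const.
Proof. by rewrite addr_ge0 // mulr_ge0. Qed.

Lemma Imap_lipschitz : is_lipschitz d (Imap Delta g) (lip_const * M).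
Proof.
split=> [|x y]; first by rewrite mulr_ge0 // lip_const_ge0.
apply: osc_dmetric => //; first by rewrite mulr_ge0 // lip_const_ge0.
by move=> e {}x {}y; exact: Imap_osc.
Qed.

Lemma Imap_zero : Imap Delta g (zero01 R) = 0.
Proof.
apply/cvg_lim => //; rewrite (_ : series _ = fun=> 0); first exact: cvg_cst.
apply/funext => j; rewrite /series /= big1 // => i _.
by have [mi b z] := gM i; exact: (Imap_n_0 DD M0 mi b).
Qed.

Lemma Imap_Lip0 : Lip0 d (Imap Delta g).
Proof. by split; [exists (lip_const * M); exact: Imap_lipschitz|exact: Imap_zero]. Qed.

(** On Diff n the sum reduces to its terms of index at most n. If it vanishes and
    the earlier terms do, then so does the n-th one on Diff n, hence at both ends
    of each atom of A_n, on which it is affine. *)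
Lemma Imap_inj : (forall x, Imap Delta g x = 0) ->
  forall n, hausdorffn Delta n [set x | g n x <> 0] = 0%E.
Proof.
move=> F0 n; have [mn bn zn] := gM n; apply: (Imap_n_inj DD M0 mn bn).
elim/ltn_ind: n {mn bn zn} => n IH x; have [mn bn zn] := gM n.
have onD y : Diff Delta n y -> u n y = 0.
  move=> /Imap_Diff; rewrite F0 big_nat_recr //= big_nat_cond big1 ?add0r // => k.
  by rewrite andbT => /andP[_ kn]; exact: IH.
have [/onD //|/(notDiffP DD)[l ll lx]] := pselect (Diff Delta n x).
have [a [b ab]] := Imap_n_affine DD M0 mn bn ll.
have Dl : u n (pt (lo R l)) = 0.
  by apply: onD; apply: (Diff_lohi DD (leaf_wt ll)); left; rewrite rval_lo.
have Dh : u n (pt (hi R l)) = 0.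
  by apply: onD; apply: (Diff_lohi DD (leaf_wt ll)); right; rewrite rval_hi.
move: Dl Dh; rewrite /u (ab _ (ditv_lo R l)) (ab _ (ditv_hi R l)) (ab _ (dint_ditv lx)).
rewrite rval_lo rval_hi hiE => h1 h2.
have : a * len R l = 0 by lra.
by move/eqP; rewrite mulf_eq0 [len R l == 0]gt_eqF ?len_gt0 // orbF => /eqP a0; rewrite a0 in h1 *; lra.
Qed.

End Kernel.

Lemma kerM_lin M M' (a : R) g h : 0 <= M -> 0 <= M' -> kerM M g -> kerM M' h ->
  kerM (`|a| * M + M') (fun n x => a * g n x + h n x).
Proof.
move=> M0 M'0 gM hM n; have [mg bg zg] := gM n; have [mh bh zh] := hM n.
split.
- by apply: measurable_funD => //; apply: measurable_funM.
- apply: mu0_sub (mu0U bg bh) => x /=; apply: contra_notP => /not_orP[/contrapT h1 /contrapT h2].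
  apply: le_trans (ler_normD _ _) _; apply: lerD => //.
  by rewrite normrM ler_wpM2l.
case: n mg bg zg mh bh zh => // n mg bg [g0 gl] mh bh [h0 hl]; split.
  apply: mu0_sub (mu0U g0 h0) => x [xD /= nz].
  have [gx|gx] := pselect (g n.+1 x = 0); last by left.
  by right; split => // hx; apply: nz; rewrite gx hx mulr0 addr0.
move=> l ll; have ig := integrable_An DD M0 mg bg (measurable_ditv DD n.+1 l).
have ih := integrable_An DD M'0 mh bh (measurable_ditv DD n.+1 l).
have md := measurable_ditv DD n.+1 l.
rewrite RintegralD //; first by rewrite RintegralZl // gl // hl // mulr0 addr0.
exact: (integrableZl md a ig).
Qed.

Lemma Imap_lin M M' (a : R) g h : 0 <= M -> 0 <= M' -> kerM M g -> kerM M' h ->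
  Imap Delta (fun n x => a * g n x + h n x) =
  (fun x => a * Imap Delta g x + Imap Delta h x).
Proof.
move=> M0 M'0 gM hM; apply/funext => x.
have E : series (fun n => Imap_n Delta n (fun y => a * g n y + h n y) x) =
    (fun j => a * series (fun n => Imap_n Delta n (g n) x) j +
              series (fun n => Imap_n Delta n (h n) x) j).
  apply/funext => j; rewrite /series /= mulr_sumr -big_split /=.
  apply: eq_bigr => n _; have [mg bg zg] := gM n; have [mh bh zh] := hM n.
  have mb := measurable_below DD n x.
  have ig := integrable_An DD M0 mg bg mb; have ih := integrable_An DD M'0 mh bh mb.
  rewrite /Imap_n RintegralD //; first by rewrite RintegralZl.
  exact: (integrableZl mb a ig).
rewrite {1}/Imap E; apply/cvg_lim => //; apply: cvgD; last exact: (@Imap_cvg M' h M'0 hM x).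
by apply: cvgMr; exact: (@Imap_cvg M g M0 gM x).
Qed.

Lemma eq_ae_null n (g h : I -> R) :
  eq_ae Delta n g h <-> hausdorffn Delta n [set x | g x <> h x] = 0%E.
Proof. exact: aeE. Qed.

Lemma Imap_eq_ae M M' g h : 0 <= M -> 0 <= M' -> kerM M g -> kerM M' h ->
  (forall n, eq_ae Delta n (g n) (h n)) <-> Imap Delta g = Imap Delta h.
Proof.
move=> M0 M'0 gM hM; split => [gh|gh n].
  apply/funext => x; rewrite /Imap; congr (limn (series _)); apply/funext => n.
  have [mg bg zg] := gM n; have [mh bh zh] := hM n.
  rewrite /Imap_n /Rintegral; congr fine.
  apply: ae_eq_integral; first exact: (measurable_below DD n x).
  - exact/measurable_EFinP/measurable_funTS/An_measurable_fun.
  - exact/measurable_EFinP/measurable_funTS/An_measurable_fun.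
  apply/aeE; have := gh n; rewrite eq_ae_null; apply: mu0_sub => y /= /not_implyP[_ +] e.
  by rewrite e.
have := Imap_inj _ (kerM_lin (-1) M0 M'0 gM hM).
rewrite (Imap_lin (-1) M0 M'0 gM hM) => /(_ _ _ n) inj.
apply/eq_ae_null; apply: mu0_sub (inj _ _); first by move=> x /= gx h0; apply: gx; lra.
  by rewrite addr_ge0 // mulr_ge0.
by move=> x; rewrite gh; lra.
Qed.

End Sum.

(** * Lipschitz functions are primitives of their derivative *)

Section LipschitzDensity.
Variable R : realType.
Implicit Types (t s : R).

Definition has_deriv (phi : R -> R) (t g : R) : Prop :=
  forall eps, 0 < eps -> exists2 delta, 0 < delta &
    forall s, `|s - t| < delta -> `|phi s - phi t - g * (s - t)| <= eps * `|s - t|.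

Variables (phi : R -> R) (M : R).
Hypotheses (M0 : 0 <= M) (phiM : forall s t, `|phi s - phi t| <= M * `|s - t|).

Let c t : R := Num.max 0 (Num.min t 1).

Let c_le s t : s <= t -> 0 <= c t - c s <= t - s.
Proof.
rewrite /c => st; have [] := leP s 1; have [] := leP t 1 => t1 s1;
 have [] := leP 0 s; have [] := leP 0 t; have [] := leP (0 : R) 1 => *; lra.
Qed.

Let dH : R := phi 1 - phi 0 + (M + 1).

Let dH_ge1 : 1 <= dH.
Proof.
have := phiM 1 0; rewrite subr0 normr1 mulr1 ler_norml /dH => /andP[]; lra.
Qed.

(** Adding a linear term makes phi increasing; after normalisation it is the
    distribution function of a probability measure carried by [0,1]. *)
Definition lip_cdf t : R := (phi (c t) - phi 0 + (M + 1) * c t) / dH.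

Let dH_gt0 : 0 < dH. Proof. exact: lt_le_trans ltr01 dH_ge1. Qed.

Let lip_cdf_incr s t : s <= t -> 0 <= lip_cdf t - lip_cdf s <= (2 * M + 1) * (t - s).
Proof.
move=> st; rewrite /lip_cdf -mulrBl; have /andP[h1 h2] := c_le st.
have := phiM (c t) (c s); rewrite (ger0_norm h1) ler_norml => /andP[h3 h4].
have h5 : M * (c t - c s) <= M * (t - s) by exact: ler_wpM2l.
set X := (X in X / dH).
have X0 : 0 <= X by rewrite /X; lra.
have X1 : X <= (2 * M + 1) * (t - s) by rewrite /X; lra.
rewrite divr_ge0 ?(ltW dH_gt0) //=; apply: le_trans X1.
by rewrite ler_pdivrMr // ler_peMr.
Qed.

Let lip_cdf_nd : nondecreasing lip_cdf.
Proof. by move=> s t /lip_cdf_incr/andP[]; rewrite subr_ge0. Qed.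

Let lip_cdf_rc : right_continuous lip_cdf.
Proof.
apply: right_continuousW => t; apply/cvgrPdist_le => e e0.
have K0 : 0 < 2 * M + 1 by have := M0; lra.
have d0 : 0 < e / (2 * M + 1) by rewrite divr_gt0.
apply: filterS (nbhsx_ballx t _ d0) => s; rewrite /ball /= ltr_pdivlMr // mulrC => ts.
apply: le_trans (ltW ts); have [h|/ltW h] := leP t s.
  have /andP[h1 h2] := lip_cdf_incr h.
  by rewrite distrC (ger0_norm h1) (distrC t) ger0_norm ?subr_ge0.
by have /andP[h1 h2] := lip_cdf_incr h; rewrite !ger0_norm ?subr_ge0 //; lra.
Qed.

HB.instance Definition _ := isCumulative.Build R _ R lip_cdf lip_cdf_nd lip_cdf_rc.

Let lip_cdf_Ny : lip_cdf @ -oo --> (0 : R).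
Proof.
apply: cvg_near_cst; exists 0; split=> [|t /ltW t0]; first exact: real0.
have ct : c t = 0 by rewrite /c; apply/max_idPl; rewrite ge_min t0.
by rewrite /lip_cdf ct mulr0 subrr add0r mul0r.
Qed.

Let lip_cdf_y : lip_cdf @ +oo --> (1 : R).
Proof.
apply: cvg_near_cst; exists 1; split=> [|t /ltW t1]; first exact: real1.
have ct : c t = 1 by rewrite /c (min_idPr t1); apply/max_idPr; exact: ler01.
by rewrite /lip_cdf ct mulr1 divff // gt_eqF.
Qed.

HB.instance Definition _ := isCumulativeBounded.Build R 0 1 lip_cdf lip_cdf_Ny lip_cdf_y.

Local Notation lam := (@lebesgue_measure R).
Let nu := lebesgue_stieltjes_measure lip_cdf.

Let nu_itv a b : a <= b -> nu `]a, b]%classic = (lip_cdf b - lip_cdf a)%:E.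
Proof.
move=> ab; rewrite /nu /lebesgue_stieltjes_measure /measure_extension.
by rewrite measurable_mu_extE /=; [rewrite wlength_itv_bnd|exact: is_ocitv].
Qed.

(** The measure of an interval is at most 2 M + 1 times its length, so null sets
    are null for it as well, and the theorem of Radon and Nikodym applies. *)
Let nu_dom : nu `<< lam.
Proof.
apply/null_content_dominatesP => A mA A0.
have K0 : 0 < 2 * M + 1 by have := M0; lra.
apply/eqP; rewrite eq_le measure_ge0 andbT.
suff h a b : a < b -> ((wlength lip_cdf)^*%mu `]a, b]%classic <= ((2 * M + 1) * (b - a))%:E)%E.
  apply: le_trans (@outer_le_lebesgue R (ocitv_type R) ((wlength lip_cdf)^*)%mu id _ K0 h A) _.
  by move: A0 => /= ->; rewrite mule0.
move=> ab.
have := nu_itv (ltW ab); rewrite /nu /lebesgue_stieltjes_measure /measure_extension => ->.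
by rewrite lee_fin; have /andP[] := lip_cdf_incr (ltW ab).
Qed.

(** The density of the measure just built yields G; the derivative exists at the
    Lebesgue points of G. *)
Theorem lipschitz_density : exists G : R -> R,
  [/\ measurable_fun setT G, lam.-integrable setT (EFin \o G),
      forall a b, 0 <= a -> a <= b -> b <= 1 ->
        phi b - phi a = \int[lam]_(t in `]a, b]) G t &
      exists2 N, lam.-negligible N &
        forall t, 0 < t < 1 -> ~ N t -> has_deriv phi t (G t)].
Proof.
have [f [f0 ffin fint fnu]] := @radon_nikodym_sigma_finite _ _ R lam nu nu_dom.
pose g t := fine (f t).
have gE : EFin \o g = f by apply/funext => t; rewrite /= fineK.
have ig : lam.-integrable setT (EFin \o g) by rewrite gE.
have mg : measurable_fun setT g by apply/measurable_EFinP; case/integrableP: ig.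
pose A : set R := `[0, 1]%classic.
have mA : measurable (A : set (measurableTypeR R)) by exact: measurable_itv.
have A_fin : (lam A < +oo)%E.
  by rewrite /A lebesgue_measure_itv /= lte_fin ltr01 -EFinB ltry.
pose k t := dH * g t - (M + 1).
have ikA B : measurable (B : set (measurableTypeR R)) -> (lam B < +oo)%E ->
    lam.-integrable B (EFin \o (fun t => dH * g t)) /\
    lam.-integrable B (EFin \o (fun=> M + 1)).
  move=> mB Bfin; split; last first.
    apply/integrableP; split=> [|]; first exact: measurable_cst.
    rewrite (eq_integral (cst `|M + 1|%:E)) // integral_cst //.
    by apply: lte_mul_pinfty; rewrite ?lee_fin.
  by apply: (@integrableZl _ _ _ _ _ mB dH (EFin \o g)); apply: integrableS ig.
have ik : lam.-integrable A (EFin \o k).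
  by have [h1 h2] := ikA A mA A_fin; exact: (integrableB mA h1 h2).
have mk : measurable_fun setT k.
  by apply: measurable_funB => //; apply: measurable_funM.
pose G := k \_ A.
have mG : measurable_fun setT G by apply/(measurable_restrictT _ mA); exact: measurable_funTS.
have iG : lam.-integrable setT (EFin \o G).
  by rewrite /G -restrict_EFin; apply/(integrable_mkcond _ mA).
have GE a b : 0 <= a -> a <= b -> b <= 1 ->
    phi b - phi a = \int[lam]_(t in `]a, b]) G t.
  move=> a0 ab b1; pose B : set R := `]a, b]%classic.
  have mB : measurable (B : set (measurableTypeR R)) by exact: measurable_itv.
  have lB : lam B = (b - a)%:E.
    rewrite /B lebesgue_measure_itv /= lte_fin; move: ab; rewrite le_eqVlt.
    by move=> /orP[/eqP ->|->//]; rewrite ltxx subrr.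
  have Bfin : (lam B < +oo)%E by rewrite lB ltry.
  have [i1 i2] := ikA B mB Bfin.
  have igB : lam.-integrable B (EFin \o g) by apply: integrableS ig.
  rewrite (@eq_Rintegral _ _ _ lam B k); last first.
    move=> t; rewrite inE /B /= in_itv /= => /andP[t1 t2].
    rewrite /G patchE mem_set // /A /= in_itv /=; lra.
  have gB : \int[lam]_(t in B) g t = lip_cdf b - lip_cdf a.
    rewrite /Rintegral -[RHS]/(fine (lip_cdf b - lip_cdf a)%:E) -nu_itv //.
    congr fine; apply/esym; rewrite -/(nu B); apply: etrans (fnu B mB) _.
    by apply: eq_integral => t _; rewrite /g fineK.
  have -> : \int[lam]_(t in B) k t = dH * (lip_cdf b - lip_cdf a) - (M + 1) * (b - a).
    rewrite /k RintegralB // RintegralZl // gB Rintegral_cst //.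
    by congr (_ - _ * _); rewrite [X in fine X](_ : _ = (b - a)%:E).
  have cE s : 0 <= s <= 1 -> c s = s.
    by move=> /andP[s0 s1]; rewrite /c (min_idPl s1) (max_idPr s0).
  rewrite /lip_cdf !cE; [|lra|lra].
  by rewrite -mulrBl mulrCA divff ?mulr1; [ring|rewrite gt_eqF].
exists G; split => //.
have locG : locally_integrable [set: R] G.
  by apply: open_integrable_locally => //; exact: openT.
have intG y : lam.-integrable [set` Interval (BLeft 0) (BRight y)] (EFin \o G).
  have mi : measurable ([set` Interval (BLeft 0) (BRight y)] : set (measurableTypeR R)).
    exact: measurable_itv.
  exact: (integrableS measurableT mi (@subsetT _ _) iG).
pose F x := \int[lam]_(t in `[0, x]) G t.
have [N [mN N0 FN]] := FTC1 intG locG; exists N; first by exists N; split => // x.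
move=> t t01 nN.
have [der FG] : derivable F t 1 /\ derive1 F t = G t.
  apply: contrapT => h; apply: nN; apply: FN => /= h'; apply: h; apply: h'.
  by rewrite lte_fin; case/andP: t01.
have FE s : 0 <= s <= 1 -> F s = phi s - phi 0.
  move=> /andP[s0 s1]; rewrite GE // /F -[LHS]Rintegral_itv_obnd_cbnd //.
  have mi : measurable (`]0, s]%classic : set (measurableTypeR R)) by exact: measurable_itv.
  exact: (integrableS measurableT mi (@subsetT _ _) iG).
move=> eps eps0.
have : (fun h => h^-1 *: ((F \o shift t) (h *: 1) - F t)) @ 0^' --> 'D_1 F t by exact: der.
rewrite -derive1E FG => /cvgrPdist_le /(_ _ eps0).
move=> /nbhs_ballP[e /= e0 he].
exists (Num.min e (Num.min t (1 - t))).
  by rewrite !lt_min e0 /=; lra.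
move=> s; rewrite !lt_min => /andP[se /andP[st s1t]].
have [->|sNt] := eqVneq s t; first by rewrite !subrr mulr0 subr0 normr0 mulr0.
have ht : s - t != 0 by rewrite subr_eq0.
have := he (s - t); rewrite /ball /= sub0r normrN => /(_ se ht).
have s01 : 0 <= s <= 1.
  by move: st s1t; rewrite !ltr_distl; lra.
have t01' : 0 <= t <= 1 by lra.
rewrite /shift /= [(s - t) *: 1]mulr1 subrK !FE // => h.
have -> : phi s - phi t - G t * (s - t) =
    - (s - t) * (G t - (s - t)^-1 *: (phi s - phi 0 - (phi t - phi 0))).
  rewrite /GRing.scale /=; field; by rewrite ht.
by rewrite normrM normrN mulrC ler_wpM2r.
Qed.

End LipschitzDensity.

(** * Topology of the unit interval *)

Section Topology.
Variable R : realType.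
Local Notation I := (I01 R).

Lemma near_rval (x : I) (delta : R) : 0 < delta ->
  \forall y \near x, `|rval y - rval x| < delta.
Proof.
move=> d0; have : {for x, continuous (@rval R)} by exact: initial_continuous.
move=> /cvgrPdist_lt /(_ _ d0); apply: filterS => y.
by rewrite distrC.
Qed.

Lemma lipschitz_continuous (h : I -> R) (K : R) : 0 <= K ->
  (forall x y, `|h x - h y| <= K * `|rval x - rval y|) -> continuous h.
Proof.
move=> K0 hK x; have FF : Filter (nbhs x) by exact: nbhs_filter.
apply/cvgrPdist_le => e e0.
have d0 : 0 < e / (K + 1) by rewrite divr_gt0 //; lra.
apply: filterS (near_rval x d0) => y.
rewrite ltr_pdivlMr; last by lra.
move=> h1; apply: le_trans (hK x y) _.
by apply: le_trans (ltW h1); rewrite distrC mulrC; apply: ler_wpM2l => //; lra.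
Qed.

Lemma pt_continuous : continuous (@pt R).
Proof.
apply: continuous_comp_initial => t; apply/cvgrPdist_lt => e e0.
apply: filterS (nbhsx_ballx t _ e0) => s; rewrite /ball /=.
apply: le_lt_trans; rewrite -!/(rval _) !rval_ptE.
have [] := leP t 1; have [] := leP s 1; have [] := leP 0 t; have [] := leP 0 s;
  have [] := leP (0 : R) 1 => *; rewrite ?subrr ?normr0 ?normr_ge0 //;
  by rewrite ler_norml; apply/andP; split; have := ler_norm (t - s);
  have := ler_norm (s - t); rewrite distrC; lra.
Qed.

Lemma within_left_proper (x : I) : 0 < rval x ->
  ProperFilter (within [set y : I | rval y < rval x] (nbhs x)).
Proof.
move=> x0; apply: Build_ProperFilter_ex => A.
rewrite /within /= => nA.
have : nbhs (rval x) (@pt R @^-1` [set y : I | rval y < rval x -> A y]).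
  by apply: pt_continuous; rewrite ptK.
move=> /nbhs_ballP[e /= e0 he].
pose t := Num.max (rval x / 2) (rval x - e / 2).
have tx : t < rval x by rewrite /t gt_max; apply/andP; split; lra.
have t0 : 0 < t by rewrite /t lt_max; apply/orP; left; lra.
have rt : rval (pt t) = t by rewrite rval_pt //; have := rvalP x; lra.
exists (pt t); apply: he; last by rewrite rt.
rewrite /ball /= ger0_norm; last by lra.
have : rval x - e / 2 <= t by rewrite /t le_max lexx orbT.
lra.
Qed.

End Topology.

(** * Affinization *)

Section Affinization.
Variables (R : realType) (Delta : dyadic -> R).
Hypothesis DD : dyadic_diameter Delta.
Local Notation I := (I01 R).
Local Notation d := (dmetric Delta).

Let Delta_ge0 e : 0 <= Delta e.
Proof. exact/ltW/Delta_gt0. Qed.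

(** A bound on the oscillation on dyadic intervals is a Lipschitz bound: the
    chain metric of the Euclidean length is dominated by the Euclidean metric. *)
Lemma osc_euclid (h : I -> R) (K : R) : 0 <= K ->
  (forall e x y, ditv e x -> ditv e y -> `|h x - h y| <= K * len R e) ->
  forall x y, `|h x - h y| <= K * `|rval x - rval y|.
Proof.
move=> K0 osc x y; have l0 e : 0 <= len R e by exact/ltW/len_gt0.
apply: le_trans (osc_dmetric l0 K0 osc x y) _; apply: ler_wpM2l => //.
rewrite -[leRHS]mul1r; apply: dmetric_upper => // e.
by rewrite mul1r.
Qed.

Section OneFunction.
Variables (f : I -> R) (L : R).
Hypothesis fL : is_lipschitz d f L.
Variable n : nat.

Let L0 : 0 <= L. Proof. by case: fL. Qed.

Lemma lipschitz_ditv e x y : ditv e x -> ditv e y -> `|f x - f y| <= L * Delta e.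
Proof.
move=> ex ey; case: fL => _ /(_ x y) /le_trans; apply.
by apply: ler_wpM2l => //; exact: dmetric_le.
Qed.

Definition slope (h : I -> R) (e : dyadic) : R := (h (pt (hi R e)) - h (pt (lo R e))) / len R e.

Section Interpolant.
Variable h : I -> R.
Hypotheses (hD : forall x, Diff Delta n x -> h x = f x)
  (haff : forall l, leaf Delta n l ->
    exists a b : R, forall x, ditv l x -> h x = a * rval x + b).

Let h_lo e : wt Delta e <= 2 ^+ n -> h (pt (lo R e)) = f (pt (lo R e)).
Proof. by move=> we; apply/hD/(Diff_lohi DD we); left; rewrite rval_lo. Qed.

Let h_hi e : wt Delta e <= 2 ^+ n -> h (pt (hi R e)) = f (pt (hi R e)).
Proof. by move=> we; apply/hD/(Diff_lohi DD we); right; rewrite rval_hi. Qed.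

Lemma slopeE e : wt Delta e <= 2 ^+ n -> slope h e = slope f e.
Proof. by move=> we; rewrite /slope h_lo // h_hi. Qed.

Lemma affine_slope l x y : leaf Delta n l -> ditv l x -> ditv l y ->
  h x - h y = slope f l * (rval x - rval y).
Proof.
move=> ll lx ly; have [a [b ab]] := haff ll.
rewrite -slopeE ?(leaf_wt ll) // /slope (ab _ (ditv_hi R l)) (ab _ (ditv_lo R l)).
rewrite (ab _ lx) (ab _ ly) rval_lo rval_hi hiE.
have -> : a * (lo R l + len R l) + b - (a * lo R l + b) = a * len R l by ring.
by rewrite mulfK ?gt_eqF ?len_gt0 //; ring.
Qed.

Lemma slope_le e : wt Delta e <= 2 ^+ n -> `|slope f e| <= L * wt Delta e.
Proof.
move=> we; rewrite /slope normrM [`|_^-1|]gtr0_norm ?invr_gt0 ?len_gt0 //.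
rewrite ler_pdivrMr ?len_gt0 // -mulrA -Delta_wt.
exact: lipschitz_ditv (ditv_hi R e) (ditv_lo R e).
Qed.

Let slope_leaf_le l : leaf Delta n l -> `|slope f l| <= L * 2 ^+ n.
Proof. by move=> ll; apply: le_trans (slope_le (leaf_wt ll)) _; case: ll => ->. Qed.

Lemma interpolant_near e x : wt Delta e <= 2 ^+ n -> ditv e x ->
  `|h x - f (pt (lo R e))| <= L * Delta e.
Proof.
move=> we ex; have [xD|/(notDiffP DD)[l ll lx]] := pselect (Diff Delta n x).
  by rewrite hD //; apply: lipschitz_ditv => //; exact: ditv_lo.
have [dex|ndex] := pselect (dint e x); last first.
  have xD : Diff Delta n x.
    apply: (Diff_lohi DD we); case: (below_inE ndex); move: ex; rewrite ditvE => /andP[h1 h2] h3.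
      by left; apply: le_anti; rewrite h3 h1.
    by right; apply: le_anti; rewrite h3 h2.
  by rewrite hD //; apply: lipschitz_ditv => //; exact: ditv_lo.
have el := leaf_overlap DD ll we lx dex.
(* On an atom inside e the function is a convex combination of two values of f on e. *)
have lx' := dint_ditv lx.
have hx := affine_slope ll lx' (ditv_lo R l); rewrite rval_lo in hx.
set w := (rval x - lo R l) / len R l.
have w01 : 0 <= w <= 1.
  move: lx'; rewrite ditvE hiE => /andP[h1 h2].
  by rewrite /w divr_ge0 ?subr_ge0 ?(ltW (len_gt0 _ _)) // ler_pdivrMr ?len_gt0 //; lra.
set p := f (pt (lo R e)).
have flo := lipschitz_ditv (anc_ditv el (ditv_lo R l)) (ditv_lo R e).
have fhi := lipschitz_ditv (anc_ditv el (ditv_hi R l)) (ditv_lo R e).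
rewrite -/p in flo fhi.
have -> : h x - p = (1 - w) * (f (pt (lo R l)) - p) + w * (f (pt (hi R l)) - p).
  have -> : h x = f (pt (lo R l)) + slope f l * (rval x - lo R l).
    by rewrite -(h_lo (leaf_wt ll)) -hx; ring.
  have -> : slope f l * (rval x - lo R l) = (f (pt (hi R l)) - f (pt (lo R l))) * w.
    by rewrite /slope /w mulrAC -mulrA.
  ring.
clearbody w; apply: le_trans (ler_normD _ _) _; rewrite !normrM.
move: w01 => /andP[w0 w1].
rewrite (ger0_norm w0) (ger0_norm (_ : 0 <= 1 - w)) ?subr_ge0 //.
rewrite (_ : L * Delta e = (1 - w) * (L * Delta e) + w * (L * Delta e)); last by ring.
by apply: lerD; apply: ler_wpM2l => //; rewrite subr_ge0.
Qed.

Lemma interpolant_lipschitz x y : `|h x - h y| <= 2 * L * 2 ^+ n * `|rval x - rval y|.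
Proof.
apply: osc_euclid => [|e {}x {}y ex ey]; first by rewrite !mulr_ge0 // exprn_ge0.
have [we|we] := leP (wt Delta e) (2 ^+ n).
  rewrite (_ : h x - h y = (h x - f (pt (lo R e))) - (h y - f (pt (lo R e)))); last by ring.
  apply: le_trans (ler_normB _ _) _.
  apply: le_trans (lerD (interpolant_near we ex) (interpolant_near we ey)) _.
  rewrite (_ : _ + _ = 2 * L * Delta e); last by ring.
  rewrite -!mulrA ler_wpM2l // ler_wpM2l // (Delta_wt Delta e).
  by rewrite ler_wpM2r // ltW // len_gt0.
have [l [b [ll a]]] := leaf_ex DD we.
have al : anc l e by apply: anc_trans a; apply: anc_child; exact: ancxx.
rewrite (affine_slope ll (anc_ditv al ex) (anc_ditv al ey)) normrM.
apply: ler_pM => //; last by move: ex ey; rewrite !ditvE hiE ler_distl; lra.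
apply: le_trans (slope_leaf_le ll) _; rewrite -mulrA ler_peMl ?ler1n //.
by rewrite mulr_ge0 // exprn_ge0.
Qed.

(** The slopes over dyadic intervals are those of f over intervals of weight at
    most 2^n, where f grows by at most L times the diameter. *)
Lemma slope_bound e : `|slope h e| <= L * 2 ^+ n.
Proof.
have [we|we] := leP (wt Delta e) (2 ^+ n).
  by rewrite slopeE //; apply: le_trans (slope_le we) _; exact: ler_wpM2l.
have [l [b [ll a]]] := leaf_ex DD we.
have al : anc l e by apply: anc_trans a; apply: anc_child; exact: ancxx.
rewrite /slope (affine_slope ll (anc_ditv al (ditv_hi R e)) (anc_ditv al (ditv_lo R e))).
rewrite rval_lo rval_hi {1}hiE [lo R e + _]addrC addrK mulfK ?gt_eqF ?len_gt0 //.
exact: slope_leaf_le.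
Qed.

Lemma slope_in_leaf l e : leaf Delta n l -> anc l e -> slope h e = slope f l.
Proof.
move=> ll al.
rewrite /slope (affine_slope ll (anc_ditv al (ditv_hi R e)) (anc_ditv al (ditv_lo R e))).
by rewrite rval_lo rval_hi {1}hiE [lo R e + _]addrC addrK mulfK ?gt_eqF ?len_gt0.
Qed.

End Interpolant.

(** Linear interpolation of f in the atoms, and f itself on Diff n. *)
Let interp (x : I) : R :=
  let l := xget dtop [set l | leaf Delta n l /\ dint l x] in
  if `[< leaf Delta n l /\ dint l x >]
  then f (pt (lo R l)) + slope f l * (rval x - lo R l) else f x.

Let interpD x : Diff Delta n x -> interp x = f x.
Proof.
move=> xD; rewrite /interp asboolF // => -[ll lx].
exact: (DiffP DD n x).1 xD _ ll lx.
Qed.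

Let interp_leaf l : leaf Delta n l ->
  exists a b : R, forall x, ditv l x -> interp x = a * rval x + b.
Proof.
move=> ll; exists (slope f l), (f (pt (lo R l)) - slope f l * lo R l) => x lx.
suff -> : interp x = f (pt (lo R l)) + slope f l * (rval x - lo R l) by ring.
have [dx|ndx] := pselect (dint l x).
  rewrite /interp; case: xgetP => [l' -> [ll' lx']|/(_ l) []//].
  by rewrite asboolT // (leaf_uniq DD ll ll' dx lx').
have xlh : rval x = lo R l \/ rval x = hi R l.
  move: lx; rewrite ditvE => /andP[h1 h2]; case: (below_inE ndx) => h3; [left|right];
  by apply: le_anti; rewrite h3 ?h1 ?h2.
rewrite interpD; last by apply: (Diff_lohi DD (leaf_wt ll)); exact: xlh.
rewrite -[in LHS](ptK x); case: xlh => ->; first by rewrite subrr mulr0 addr0.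
rewrite /slope hiE [lo R l + _]addrC addrK mulfVK ?gt_eqF ?len_gt0 //.
by rewrite addrCA subrr addr0.
Qed.

(** The defining properties are met by the linear interpolation, whose continuity
    follows from its Euclidean Lipschitz bound. *)
Lemma affinizationP : is_affinization Delta n f (affinization Delta n f).
Proof.
rewrite /affinization; apply: (@xgetPex _ f [set h | is_affinization Delta n f h]).
exists interp; split; last by move=> e /(At_leaf DD); exact: interp_leaf.
  apply: (@lipschitz_continuous _ _ (2 * L * 2 ^+ n)).
    by rewrite !mulr_ge0 // exprn_ge0.
  exact: interpolant_lipschitz interpD interp_leaf.
exact: interpD.
Qed.

End OneFunction.
End Affinization.

(** * Conditional expectations and derivatives *)

Section Derivation.
Variables (R : realType) (Delta : dyadic -> R).
Hypothesis DD : dyadic_diameter Delta.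
Local Notation I := (I01 R).
Local Notation d := (dmetric Delta).

(** ** Gluing and evaluation of conditional expectations *)

(** The family P is countable and N is a null set, so preimages are assembled from
    pieces by countable unions. *)
Lemma An_piecewise n (P : set dyadic) (N : set I) (V : I -> R) : lneg N ->
  (forall e, P e -> wt Delta e <= 2 ^+ n) ->
  (forall e, P e -> exists2 W, An_fun Delta n W &
     forall x, dint e x -> ~ N x -> V x = W x) ->
  (forall x, ~ N x -> (forall e, P e -> ~ dint e x) -> V x = 0) ->
  An_fun Delta n V.
Proof.
move=> N0 Pw PW P0; apply/An_funP => B mB.
pose U := \bigcup_(e in P) (dint e `&` (V @^-1` B `|` N)).
have AU : An Delta n U.
  apply: An_countable => e Pe; have [W mW VW] := PW e Pe.
  have -> : dint e `&` (V @^-1` B `|` N) = dint e `&` (W @^-1` B `|` N).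
    apply/seteqP; split=> x [ex [Bx|Nx]]; split => //; try by right.
      by have [Nx|nN] := pselect (N x); [right|left; rewrite /= -VW].
    by have [Nx|nN] := pselect (N x); [right|left; rewrite /= VW].
  apply: AnI; first exact: An_dint (Pw e Pe).
  by apply: AnU; [exact: (An_funP _ _ _).1 mW B mB|exact: An_lneg].
have AP : An Delta n (\bigcup_(e in P) dint e).
  by apply: An_countable => e /Pw; exact: An_dint.
pose Z : set I := if `[< B 0 >] then ~` \bigcup_(e in P) dint e else set0.
have AZ : An Delta n Z.
  by rewrite /Z; case: asboolP => _; [exact: AnC|exact: An_lneg (@lneg0 _)].
have -> : V @^-1` B = ((U `|` Z) `\` N) `|` (V @^-1` B `&` N).
  apply/seteqP; split=> [x Bx|x [[UZ nN]|[]//]].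
    have [Nx|nN] := pselect (N x); first by right.
    left; split => //; have [[e Pe ex]|nP] := pselect (exists2 e, P e & dint e x).
      by left; exists e => //; split => //; left.
    right; have V0 : V x = 0 by apply: P0 => // e Pe ex; apply: nP; exists e.
    rewrite /Z asboolT; last by rewrite -V0.
    by move=> [e Pe ex]; apply: nP; exists e.
  case: UZ => [[e Pe [_ []]]//|].
  rewrite /Z; case: asboolP => // B0 nP; rewrite /= P0 //.
  by move=> e Pe ex; apply: nP; exists e.
apply: AnU; first by apply: AnD; [exact: AnU|exact: An_lneg].
by apply: An_lneg; apply: lnegS N0; exact: subIsetr.
Qed.

Local Notation T n := (caratheodory_type (hausdorffn Delta n)).

Lemma Rint_ae n (D N : set I) (F W : I -> R) :
  measurable (D : set (T n)) ->
  An_fun Delta n W -> hausdorffn Delta n N = 0%E ->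
  (forall x, D x -> ~ N x -> F x = W x) ->
  \int[Hn Delta n]_(x in D) F x = \int[Hn Delta n]_(x in D) W x.
Proof.
move=> mD mW N0 FW; rewrite /Rintegral; congr fine.
have mN A : A `<=` N -> measurable (A : set (T n)).
  by move=> AN; apply: measurable_null; exact: mu0_sub AN N0.
have mWT : measurable_fun setT (W : T n -> R) by exact: An_measurable_fun.
have mF : measurable_fun (D : set (T n)) (F : T n -> R).
  move=> _ B mB.
  have -> : D `&` F @^-1` B = ((D `&` W @^-1` B) `\` N) `|` (D `&` F @^-1` B `&` N).
    apply/seteqP; split=> [x [Dx Bx]|x [[[Dx Bx] nN]|[]//]].
      by have [Nx|nN] := pselect (N x); [right|left; split => //; split => //; rewrite /= -FW].
    by split => //; rewrite /= FW.
  apply: measurableU; last by apply: mN; exact: subIsetr.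
  by apply: measurableD; [exact: (measurable_funTS mWT)|exact: mN].
apply: ae_eq_integral.
- exact: mD.
- by apply/measurable_EFinP.
- exact/measurable_EFinP/measurable_funTS.
by apply/aeE; apply: mu0_sub N0 => x /= /not_implyP[Dx FWx]; apply: contrapT => nN; apply: FWx; rewrite FW.
Qed.

Lemma condexp_Diff m g x : Diff Delta m x -> ~ dyadic_pt R x ->
  condexp Delta m.+1 g x = g x.
Proof.
move=> xD nx; rewrite /condexp indicE mem_set // mulr1 fsbig1 ?addr0 //.
move=> e /(At_leaf DD) ll; rewrite indicE memNset ?mulr0 // => ex.
by apply: (DiffP DD m x).1 xD _ ll _; exact: ditv_dint.
Qed.

Lemma condexp_leaf m g l x : leaf Delta m l -> dint l x -> ~ dyadic_pt R x ->
  condexp Delta m.+1 g x = (fine (Hn Delta m.+1 (ditv l)))^-1 *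
    \int[Hn Delta m.+1]_(y in ditv l) g y.
Proof.
move=> ll lx nx; rewrite /condexp indicE memNset ?mulr0 ?add0r; last first.
  by move=> xD; exact: (DiffP DD m x).1 xD _ ll lx.
rewrite -(fsbig_widen [set l]) ?fsbig_set1 /=.
- by rewrite indicE mem_set ?mulr1 //; exact: dint_ditv.
- by move=> _ ->; exact/(At_leaf DD).
- move=> e [/(At_leaf DD) le /= el]; rewrite indicE memNset ?mulr0 // => ex.
  by apply: el; apply: (leaf_uniq DD le ll (ditv_dint nx ex) lx).
Qed.

Lemma condexp_zeroP M n g : 0 <= M -> An_fun Delta n g -> ess_bdd Delta n M g ->
  eq_ae Delta n (condexp Delta n g) (fun=> 0) <-> mean_zero Delta n g.
Proof.
move=> M0 mg bg; case: n mg bg => [|m] mg bg.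
  by split => // _; apply/eq_ae_null; rewrite -(@outer_measure0 _ _ (hausdorffn Delta 0)); congr (hausdorffn _ _ _); apply/seteqP; split.
have lpos l : leaf Delta m l -> fine (Hn Delta m.+1 (ditv l)) != 0.
  move=> ll; have := @mu_block _ _ DD m.+1 l ll.
  by rewrite -H_mu => -> /=; rewrite gt_eqF // mulr_gt0 ?exprn_gt0 ?len_gt0.
rewrite eq_ae_null; split=> [c0|[g0 gl]].
  split.
    apply: mu0_sub (mu0U c0 (mu_dyadic_pt DD m.+1)) => x [xD gx].
    have [dx|nx] := pselect (dyadic_pt R x); [by right|left].
    by rewrite /mkset condexp_Diff.
  move=> l ll; apply: contrapT => int0.
  have : hausdorffn Delta m.+1 (ditv l) = 0%E.
    apply: mu0_sub (mu0U c0 (mu_dyadic_pt DD m.+1)) => x lx.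
    have [dx|nx] := pselect (dyadic_pt R x); [by right|left].
    rewrite /mkset (condexp_leaf g ll (ditv_dint nx lx) nx) => /eqP.
    by rewrite mulf_eq0 invr_eq0 (negbTE (lpos l ll)) => /eqP.
  by have := lpos l ll; rewrite H_mu => /eqP h e; apply: h; rewrite e.
apply: mu0_sub (mu0U g0 (mu_dyadic_pt DD m.+1)) => x; rewrite /mkset => cx.
have [dx|nx] := pselect (dyadic_pt R x); [by right|left].
have [xD|/(notDiffP DD)[l ll lx]] := pselect (Diff Delta m x).
  by split => //; move: cx; rewrite condexp_Diff.
by case: cx; rewrite (condexp_leaf g ll lx nx) gl // mulr0.
Qed.

(** ** Derivatives of affinizations *)

Section OneFunction.
Variables (f : I -> R) (L : R).
Hypothesis fL : is_lipschitz d f L.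

Let L0 : 0 <= L. Proof. by case: fL. Qed.

Local Notation aff n := (affinization Delta n f).

Lemma aff_Diff n x : Diff Delta n x -> aff n x = f x.
Proof. by case: (affinizationP DD fL n) => _ h _; exact: h. Qed.

Lemma aff_leaf n l : leaf Delta n l ->
  exists a b : R, forall x, ditv l x -> aff n x = a * rval x + b.
Proof. by case: (affinizationP DD fL n) => _ _ h /(At_leaf DD); exact: h. Qed.

(** On an interval of weight 2^n the metric d_n is 2^n times the Euclidean one
    ([dn_cell]), and only points near x matter for the limit. *)
Lemma left_derivative_cell n (h : I -> R) c x g : wt Delta c = 2 ^+ n -> dint c x ->
  has_deriv (h \o @pt R) (rval x) g -> left_derivative (dn Delta n) h x = g / 2 ^+ n.
Proof.
move=> wc cx hg; have p0 : 0 < 2 ^+ n :> R by rewrite exprn_gt0.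
have p1 : 1 <= 2 ^+ n :> R by rewrite exprn_ege1 // ler1n.
have [cl ch] : lo R c < rval x /\ rval x < hi R c by move: cx; rewrite dintE => /andP.
have x0 : 0 < rval x by apply: le_lt_trans (lo_ge0 R c) cl.
have PF := within_left_proper x0.
have lim_F : (fun y => (h x - h y) / dn Delta n y x) @
    within [set y : I | rval y < rval x] (nbhs x) --> g / 2 ^+ n.
  have FF : Filter (nbhs x) by exact: nbhs_filter.
  apply/cvgrPdist_le => eps eps0; have [de de0 hde] := hg _ eps0.
  have d0 : 0 < Num.min de (rval x - lo R c) by rewrite lt_min de0 subr_gt0.
  apply: (filterS _ (near_rval x d0)) => y; rewrite lt_min => /andP[h1 h2] yx.
  have yx' : rval y < rval x by exact: yx.
  have cy : ditv c y by rewrite ditvE; move: h2; rewrite ltr_distl; lra.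
  rewrite (dn_cell DD wc cy (dint_ditv cx)) (distrC (rval y)) (gtr0_norm (_ : 0 < rval x - rval y)) ?subr_gt0 //.
  have r0 : rval x - rval y != 0 by rewrite subr_eq0 gt_eqF.
  have := hde (rval y) h1; rewrite /= !ptK => h3.
  have -> : g / 2 ^+ n - (h x - h y) / (2 ^+ n * (rval x - rval y)) =
      (h y - h x - g * (rval y - rval x)) / (2 ^+ n * (rval x - rval y)).
    have gen (P X Y G Z : R) : P != 0 -> Z != 0 ->
        G / P - (X - Y) / (P * Z) = (Y - X - G * - Z) / (P * Z).
      by move=> P0 Z0; field; rewrite P0 Z0.
    by rewrite (gen _ _ _ _ _ (lt0r_neq0 p0) r0) opprB.
  rewrite normrM [`|_^-1|]gtr0_norm ?invr_gt0 ?mulr_gt0 ?subr_gt0 //.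
  rewrite ler_pdivrMr ?mulr_gt0 ?subr_gt0 //; apply: le_trans h3 _.
  rewrite (distrC (rval y)) (gtr0_norm (_ : 0 < rval x - rval y)) ?subr_gt0 //.
  apply: ler_wpM2l; first exact: ltW.
  by rewrite ler_peMl // subr_ge0 ltW.
rewrite /left_derivative asboolT; last by split => //; apply/cvg_ex; exists (g / 2 ^+ n).
exact: cvg_lim.
Qed.

End OneFunction.
End Derivation.

(** * The functions D_n f *)

Section Inverse.
Variables (R : realType) (Delta : dyadic -> R).
Hypothesis DD : dyadic_diameter Delta.
Local Notation I := (I01 R).
Local Notation d := (dmetric Delta).

Lemma bounded_ess_bdd n M (g : I -> R) : (forall x, `|g x| <= M) -> ess_bdd Delta n M g.
Proof.
move=> gM; rewrite /ess_bdd; set A := mkset _.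
suff -> : A = set0 by exact: outer_measure0.
by apply/seteqP; split => // x; apply; exact: gM.
Qed.

Lemma pt_contract (s t : R) : `|rval (pt s) - rval (pt t)| <= `|s - t|.
Proof.
have E r : rval (pt r) = clamp dtop r by rewrite rval_ptE /clamp lo_dtop hi_dtop.
by rewrite !E clamp_contract.
Qed.

(** The secant slope over the dyadic interval of generation k around x: these
    slopes are A_n-measurable and exhibit the derivative as their limit. *)
Definition dyadic_slope (h : I -> R) (k : nat) (x : I) : R := slope h (dy k (pos k x)).

Lemma dyadic_slope_cvg (h : I -> R) x g : has_deriv (h \o @pt R) (rval x) g ->
  dyadic_slope h k x @[k --> \oo] --> g.
Proof.
move=> hg; apply/cvgrPdist_le => eps eps0; have [de de0 hde] := hg _ eps0.
have [k0 hk0] : exists k0 : nat, forall k, (k0 <= k)%N -> (2 ^+ k)^-1 < de :> R.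
  exists (Num.truncn de^-1) => k kk; rewrite invf_plt ?posrE ?exprn_gt0 //.
  have di : 0 <= de^-1 by rewrite invr_ge0 ltW.
  have /andP[_ h1] := truncn_itv di; apply: lt_le_trans h1 _.
  by rewrite -natrX ler_nat; apply: leq_ltn_trans kk _; exact: ltn_expl.
exists k0 => // k /= /hk0 lk; rewrite distrC /dyadic_slope /slope.
set e := dy k (pos k x); have := ditv_pos k x; rewrite -/e ditvE => /andP[x1 x2].
have le : len R e < de by rewrite /len gen_dy.
have l0 := len_gt0 R e; rewrite hiE in x2.
have a1 : `|hi R e - rval x| < de by rewrite hiE ger0_norm; lra.
have a2 : `|lo R e - rval x| < de by rewrite ler0_norm; lra.
have := hde _ a1; have := hde _ a2; rewrite /= ptK.
rewrite (ger0_norm (_ : 0 <= hi R e - rval x)); last by rewrite hiE; lra.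
rewrite (ler0_norm (_ : lo R e - rval x <= 0)); last by lra.
set A := h (pt (hi R e)); set B := h (pt (lo R e)) => h1 h2.
have -> : (A - B) / len R e - g = (A - B - g * len R e) / len R e.
  by rewrite [RHS]mulrBl mulfK // gt_eqF.
rewrite normrM [`|_^-1|]gtr0_norm ?invr_gt0 // ler_pdivrMr //.
have -> : A - B - g * len R e =
    (A - h x - g * (hi R e - rval x)) - (B - h x - g * (lo R e - rval x)).
  by rewrite hiE; ring.
apply: le_trans (ler_normB _ _) _; apply: le_trans (lerD h2 h1) _.
by rewrite -mulrDr hiE le_eqVlt; apply/orP; left; apply/eqP; ring.
Qed.

Section OneFunction.
Variables (f : I -> R) (L : R).
Hypothesis fL : is_lipschitz d f L.

Let L0 : 0 <= L. Proof. by case: fL. Qed.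

Local Notation aff n := (affinization Delta n f).
Local Notation lam := (@lebesgue_measure R).

(** The conditional expectation of the derivative on a block e: for n > 0 it is the
    slope of f over e, measured with d_n, and at level 0 nothing is subtracted. *)
Definition drift n e : R := if n is _.+1 then slope f e / 2 ^+ n else 0.

Lemma drift_le n e : block Delta n e -> `|drift n e| <= L.
Proof.
case: n => [_|n be]; first by rewrite normr0.
rewrite /drift normrM [`|_^-1|]gtr0_norm ?invr_gt0 ?exprn_gt0 // ler_pdivrMr ?exprn_gt0 //.
have we := leaf_wt be; apply: le_trans (slope_le DD fL we) _; apply: ler_wpM2l => //.
by case: be => -> _; rewrite pow2_le.
Qed.

Section OneLevel.
Variable n : nat.
Local Notation H := (Hn Delta n).
Local Notation F := (left_derivative (dn Delta n) (aff n)).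

(** A version U of the Euclidean derivative of the affinization. It is taken as the
    limit of the secant slopes, which makes it A_n-measurable and bounded by the
    bound L 2^n of the slopes. *)
Lemma aff_density : exists (U : I -> R) (N : set I), [/\ lneg N /\ dyadic_pt R `<=` N, An_fun Delta n U,
  ess_bdd Delta n (L * 2 ^+ n) U,
  (forall e (s t : R), block Delta n e -> lo R e <= s -> s <= t -> t <= hi R e ->
    \int[H]_(x in @rval R @^-1` `]s, t]%classic) U x =
    2 ^+ n * (aff n (pt t) - aff n (pt s))) &
  forall x, ~ N x -> has_deriv (aff n \o @pt R) (rval x) (U x) /\ `|U x| <= L * 2 ^+ n].
Proof.
pose h := aff n; pose phi := h \o @pt R.
have K0 : 0 <= 2 * L * 2 ^+ n by rewrite !mulr_ge0 // exprn_ge0.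
have hD := aff_Diff DD fL (n := n); have hl := aff_leaf DD fL (n := n).
have phiK s t : `|phi s - phi t| <= 2 * L * 2 ^+ n * `|s - t|.
  apply: le_trans (interpolant_lipschitz DD fL hD hl _ _) _.
  by apply: ler_wpM2l => //; exact: pt_contract.
have [G [mG iG GE [N1 N10 GN]]] := lipschitz_density K0 phiK.
pose N := dyadic_pt R `|` (@rval R @^-1` N1).
have N0 : lneg N.
  apply: lnegU; first exact: lneg_dyadic_pt.
  by apply: negligibleS N10 => _ [x hx <-].
have in01 x : ~ dyadic_pt R x -> 0 < rval x < 1.
  move=> nx; have /andP[x0 x1] := rvalP x; rewrite !lt_neqAle x0 x1 !andbT.
  apply/andP; split; apply/eqP => e; apply: nx; exists dtop.
    by left; rewrite lo_dtop.
  by right; rewrite hi_dtop.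
have der x : ~ N x -> has_deriv phi (rval x) (G (rval x)).
  move=> nN; apply: GN; first by apply: in01 => dx; apply: nN; left.
  by move=> N1x; apply: nN; right.
pose U x := if `[< N x >] then 0 else G (rval x).
have UE x : ~ N x -> U x = G (rval x) by move=> nN; rewrite /U asboolF.
pose v k x := if `[< N x >] then 0 else dyadic_slope h k x.
have vU x : v k x @[k --> \oo] --> U x.
  rewrite /v /U; case: asboolP => nN; first exact: cvg_cst.
  exact: dyadic_slope_cvg (der x nN).
have v_bound k x : `|v k x| <= L * 2 ^+ n.
  rewrite /v; case: asboolP => _; first by rewrite normr0 mulr_ge0 // exprn_ge0.
  exact: (slope_bound DD fL hD hl).
have U_bound x : `|U x| <= L * 2 ^+ n.
  have c : `|v k x| @[k --> \oo] --> `|U x| by exact: cvg_norm (vU x).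
  rewrite -(cvg_lim _ c) //.
  apply: limr_le; first by apply/cvg_ex; eexists; exact: c.
  by apply: nearW => k; exact: v_bound.
(* The secant slopes are constant on the intervals of generation k and weight at
   most 2^n, and on the atoms of smaller generation. *)
have mv k : An_fun Delta n (v k).
  pose P := [set e | (wt Delta e <= 2 ^+ n /\ gen e = k) \/ (leaf Delta n e /\ (gen e <= k)%N)].
  have anc_pos e x : (gen e <= k)%N -> dint e x -> ~ dyadic_pt R x ->
      anc e (dy k (pos k x)).
    move=> ek ex nx; have := ditv_dint nx (ditv_pos k x); move: ex; rewrite !dintE => ex px.
    exact: overlap_anc ex px _.
  have wP e : P e -> wt Delta e <= 2 ^+ n by case=> [[]//|[/leaf_wt]].
  apply: (@An_piecewise R Delta n P N (v k) N0 wP) => [e Pe|x nN out].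
    exists (fun=> slope h (if `[< leaf Delta n e >] then e else dy k (idx e))).
      exact: measurable_cst.
    move=> x ex nN; rewrite /v asboolF // /dyadic_slope.
    have nx : ~ dyadic_pt R x by move=> dx; apply: nN; left.
    have ek : (gen e <= k)%N by case: Pe => -[_ //] ->.
    have ap := anc_pos e x ek ex nx.
    case: asboolP => [le|nle].
      by rewrite (slope_in_leaf DD hD hl le ap) (slope_in_leaf DD hD hl le (ancxx e)).
    congr slope; case: Pe => [[_ gk]|[//]].
    have [<-|[b /anc_gen]] := anc_cases ap; last by rewrite gen_child gen_dy gk ltnn.
    by apply: dyadic_eq; rewrite ?gen_dy // idx_dy // -gk idx_lt.
  have nx : ~ dyadic_pt R x by move=> dx; apply: nN; left.
  have px := ditv_dint nx (ditv_pos k x); exfalso.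
  have [we|we] := leP (wt Delta (dy k (pos k x))) (2 ^+ n).
    by apply: (out (dy k (pos k x))) => //; left; rewrite gen_dy.
  have [l [b [ll a]]] := leaf_ex DD we.
  have al : anc l (dy k (pos k x)) by apply: anc_trans a; apply: anc_child; exact: ancxx.
  by apply: (out l); [right; split => //; exact: anc_gen al|exact: anc_dint al _ px].
have mU : An_fun Delta n U.
  by refine (@measurable_fun_cvg _ (g_sigma_algebraType (An_gen Delta n)) R setT v U mv _) => x _; exact: vU.
have bU : ess_bdd Delta n (L * 2 ^+ n) U.
  exact: bounded_ess_bdd U_bound.
exists U, N; split => //; first by split => // x; left.
  move=> e s t be es st te.
  have s0 := le_trans (lo_ge0 R e) es; have t1 := le_trans te (hi_le1 R e).
  pose B : set R := `]s, t]%classic.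
  have mB : measurable B by exact: measurable_itv.
  have BJ : B `<=` `[lo R e, hi R e]%classic.
    by move=> r; rewrite /B /= !in_itv /= => /andP[r1 r2]; lra.
  have mBL : measurable (B : set (measurableTypeR R)) by exact: mB.
  have iB : lam.-integrable B (EFin \o G) := integrableS measurableT mBL (@subsetT _ _) iG.
  have <- : \int[H]_(x in @rval R @^-1` B) G (rval x) = \int[H]_(x in @rval R @^-1` B) U x.
    apply: (@Rint_ae _ _ DD n _ N) => //; last by move=> x _ nN; rewrite UE.
      by apply: measurable_preimage.
    exact: mu_lneg.
  by rewrite (Rintegral_block DD be mB BJ mG iB) -(GE s t s0 st t1).
by move=> x nN; split; [rewrite UE //; exact: der|exact: U_bound].
Qed.

(** On a block the mean of the derivative is an increment of the affinization, which
    agrees with f at the ends of the block; outside the blocks the conditional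
    expectation is the derivative itself. *)
Lemma Dmap_n_structure : exists (U : I -> R) (N : set I), [/\ lneg N /\ dyadic_pt R `<=` N, An_fun Delta n U,
  ess_bdd Delta n (L * 2 ^+ n) U,
  (forall e (s t : R), block Delta n e -> lo R e <= s -> s <= t -> t <= hi R e ->
    \int[H]_(x in @rval R @^-1` `]s, t]%classic) U x =
    2 ^+ n * (aff n (pt t) - aff n (pt s))) &
  forall x, ~ N x -> [/\ `|U x| <= L * 2 ^+ n,
    forall e, block Delta n e -> dint e x -> Dmap_n Delta n f x = U x / 2 ^+ n - drift n e &
    forall m, n = m.+1 -> Diff Delta m x -> Dmap_n Delta n f x = 0]].
Proof.
have [U [N [[N0 dN] mU bU intU UN]]] := aff_density.
exists U, N; split => // x nN.
have nx : ~ dyadic_pt R x by move=> /dN.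
have FE y e : ~ N y -> block Delta n e -> dint e y -> F y = U y / 2 ^+ n.
  move=> nNy be ey; have [dy _] := UN y nNy.
  have [c wc cy] : exists2 c, wt Delta c = 2 ^+ n & dint c y.
    have [we|wc] := block_child DD be; first by exists e.
    have ym : rval y <> mid R e.
      move=> ym; apply: nNy; apply: dN; exists (child true e); left.
      by rewrite ym lo_child /mid mul1r.
    move: ey; rewrite dintE hiE => /andP[y1 y2].
    have l0 := len_gt0 R e.
    have [h|h] := ltP (rval y) (mid R e); [exists (child false e)|exists (child true e)] => //;
      rewrite dintE hiE lo_child len_child; move: h; rewrite /mid => h; first by rewrite mul0r; lra.
    by rewrite mul1r; move: ym; rewrite /mid; lra.
  exact: (left_derivative_cell DD (x := y) wc cy dy).
split; first by case: (UN x nN).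
- move=> e be ex; rewrite /Dmap_n (FE x e nN be ex); congr (_ - _).
  case: n be FE intU mU bU => [//|m] be FE intU mU bU.
  rewrite (condexp_leaf DD _ be ex nx) H_mu (mu_block DD (n := m.+1) be) /=.
  have p0 : 0 < 2 ^+ m.+1 :> R by rewrite exprn_gt0.
  have W0 : An_fun Delta m.+1 (fun y => U y * (2 ^+ m.+1)^-1).
    by apply: measurable_funM => //; exact: measurable_cst.
  have K0 : 0 <= L * 2 ^+ m.+1 by rewrite mulr_ge0 // ltW.
  have md := measurable_ditv DD m.+1 e.
  rewrite (@Rint_ae _ _ DD m.+1 (ditv e) N _ (fun y => U y * (2 ^+ m.+1)^-1)) //.
  + rewrite RintegralZr //; last exact: (integrable_An DD K0 mU bU md).
    have -> : \int[Hn Delta m.+1]_(y in ditv e) U y = 2 ^+ m.+1 * (aff m.+1 (pt (hi R e)) - aff m.+1 (pt (lo R e))).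
      rewrite -(intU e) ?lexx ?(ltW (lo_lt_hi R e)) //.
      apply: (Rint_null DD K0 mU bU) => //.
      * by apply: measurable_preimage => //; exact: measurable_itv.
      * apply: mu_lneg => //; apply: lnegS (lneg_rval (lo R e)) => y [].
        rewrite ditvE /= in_itv /= => /andP[h1 h2] h3.
        by apply: le_anti; rewrite h1 andbT leNgt; apply/negP => h4; apply: h3; rewrite h4 h2.
      * rewrite setDE (_ : _ `&` _ = set0) ?outer_measure0 //; apply/seteqP; split=> // y [].
        by rewrite /= in_itv /= => /andP[/ltW h1 h2]; apply; rewrite ditvE h1 h2.
    have we : wt Delta e <= 2 ^+ m.+1 by exact: (block_wt DD (n := m.+1) be).
    have := slopeE DD (aff_Diff DD fL (n := m.+1)) we; rewrite /drift {1}/slope => <-.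
    have := len_gt0 R e; move: (len R e) (2 ^+ m.+1 : R) p0 => w p p0 w0.
    by field; rewrite !gt_eqF.
  + exact: mu_lneg.
  + by move=> y ey nNy; apply: (FE _ _ nNy be); apply: ditv_dint ey => yd; exact: (nNy (dN _ yd)).
- move=> m nm xD; move: xD; rewrite /Dmap_n nm => xD.
  by rewrite condexp_Diff // subrr.
Qed.

Lemma Rint_Dmap e (s t : R) : block Delta n e -> lo R e <= s -> s <= t -> t <= hi R e ->
  \int[H]_(x in @rval R @^-1` `]s, t]%classic) Dmap_n Delta n f x =
  aff n (pt t) - aff n (pt s) - drift n e * (2 ^+ n * (t - s)).
Proof.
move=> be es st te; have [U [N [[N0 dN] mU bU intU DU]]] := Dmap_n_structure.
have p0 : 0 < 2 ^+ n :> R by rewrite exprn_gt0.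
have K0 : 0 <= L * 2 ^+ n by rewrite mulr_ge0 // ltW.
have mI : measurable (`]s, t]%classic : set R) by exact: measurable_itv.
have mD := measurable_preimage DD n mI.
have mW : An_fun Delta n (fun x => U x * (2 ^+ n)^-1).
  by apply: measurable_funM => //; exact: measurable_cst.
have bW : ess_bdd Delta n L (fun x => U x * (2 ^+ n)^-1).
  apply: mu0_sub bU => x /= h1 h2; apply: h1.
  by rewrite normrM [`|_^-1|]gtr0_norm ?invr_gt0 // ler_pdivrMr.
have mc : An_fun Delta n (fun=> drift n e) by exact: measurable_cst.
have bc : ess_bdd Delta n `|drift n e| (fun=> drift n e).
  by apply: bounded_ess_bdd => x; exact: lexx.
rewrite (@Rint_ae _ _ DD n _ N _ (fun x => U x * (2 ^+ n)^-1 - drift n e)) //; first last.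
- move=> x /= xst nN; have [_ h _] := DU x nN; apply: h => //.
  apply: ditv_dint => [/dN//|]; rewrite ditvE; move: xst; rewrite in_itv /= => /andP[x1 x2].
  by rewrite (le_trans es (ltW x1)) (le_trans x2 te).
- exact: mu_lneg.
- by apply: measurable_funB.
rewrite RintegralB //; first last.
- exact: (integrable_An DD (normr_ge0 (drift n e)) mc bc mD).
- exact: (integrable_An DD L0 mW bW mD).
rewrite RintegralZr //; last exact: (integrable_An DD K0 mU bU mD).
rewrite (intU e) // Rintegral_cst // H_mu.
rewrite (mu_block_lebesgue DD be mI); last first.
  by move=> r; rewrite /= !in_itv /= => /andP[r1 r2]; rewrite (le_trans es (ltW r1)) (le_trans r2 te).
have -> : lebesgue_measure (`]s, t]%classic : set R) = (t - s)%:E.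
  rewrite lebesgue_measure_itv /= lte_fin; case: ltP => [_|ts]; first by rewrite EFinD.
  by rewrite (_ : t = s) ?subrr //; apply: le_anti; rewrite st ts.
by rewrite -EFinM /= [2 ^+ n * (aff _ _ - _)]mulrC mulfK ?gt_eqF.
Qed.

End OneLevel.

Lemma drift_block m l : drift m.+1 l * (2 ^+ m.+1 * len R l) = f (pt (hi R l)) - f (pt (lo R l)).
Proof.
have p0 : 2 ^+ m.+1 != 0 :> R by rewrite expf_neq0.
rewrite /drift mulrA mulfVK // /slope mulfVK // gt_eqF // len_gt0 //.
Qed.

(** Both the derivative and the drift are bounded by L; the drift is chosen so that
    the integral over a block vanishes. *)
Lemma Dmap_ker : kerM Delta (2 * L) (Dmap Delta f).
Proof.
move=> n; have [U [N [[N0 dN] mU bU intU DU]]] := Dmap_n_structure n.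
have p0 : 0 < 2 ^+ n :> R by rewrite exprn_gt0.
have mW e : An_fun Delta n (fun x => U x / 2 ^+ n - drift n e).
  apply: measurable_funB; last exact: measurable_cst.
  by apply: measurable_funM => //; exact: measurable_cst.
have K0 : 0 <= L * 2 ^+ n by rewrite mulr_ge0 // ltW.
have out x : ~ N x -> (forall e, block Delta n e -> ~ dint e x) ->
    Dmap Delta f n x = 0.
  move=> nN nb; have [_ _ h] := DU x nN.
  have [n0|[m nm]] : n = 0 \/ exists m, n = m.+1 by case: (n) => [|m]; [left|right; exists m].
    exfalso; apply: (nb dtop); first by rewrite n0.
    by apply: ditv_dint (ditv_dtop x) => /dN.
  by apply: (h m nm); apply/(DiffP DD m x) => l ll; apply: nb; rewrite nm.
have mD : An_fun Delta n (Dmap Delta f n).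
  apply: (@An_piecewise R Delta n (block Delta n) N _ N0) => // [e be|e be].
    exact: block_wt be.
  by exists (fun x => U x / 2 ^+ n - drift n e) => // x ex nN; have [_ h _] := DU x nN; exact: h.
have bD x : ~ N x -> `|Dmap Delta f n x| <= 2 * L.
  move=> nN; have [U_le DE _] := DU x nN.
  have [[e be ex]|nb] := pselect (exists2 e, block Delta n e & dint e x); last first.
    by rewrite out ?normr0 ?mulr_ge0 // => e be ex; apply: nb; exists e.
  rewrite /Dmap (DE e be ex); apply: le_trans (ler_normB _ _) _.
  rewrite (_ : 2 * L = L + L); last by ring.
  apply: lerD; last exact: drift_le.
  by rewrite normrM [`|_^-1|]gtr0_norm ?invr_gt0 // ler_pdivrMr.
have bDn : ess_bdd Delta n (2 * L) (Dmap Delta f n).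
  by apply: mu0_sub (mu_lneg DD n N0) => x /= h; apply: contrapT => nN; apply: h; exact: bD.
split => //; case: n mU bU intU DU p0 mW K0 out mD bDn bD => // m mU bU intU DU p0 mW K0 out mD bDn bD.
split.
  apply: mu0_sub (mu_lneg DD m.+1 N0) => x [xD /= h]; apply: contrapT => nN; apply: h.
  by have [_ _ DE] := DU x nN; exact: DE erefl xD.
move=> l ll; have L20 : 0 <= 2 * L by rewrite mulr_ge0.
have h := Rint_Dmap (n := m.+1) ll (lexx _) (ltW (lo_lt_hi R l)) (lexx _).
have wl : wt Delta l <= 2 ^+ m.+1 by exact: (block_wt DD (n := m.+1) ll).
have l0 := gt_eqF (len_gt0 R l).
transitivity (\int[Hn Delta m.+1]_(x in @rval R @^-1` `]lo R l, hi R l]%classic) Dmap Delta f m.+1 x).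
  apply: (Rint_null DD L20 mD bDn).
  - exact: measurable_ditv.
  - by apply: measurable_preimage => //; exact: measurable_itv.
  - apply: mu_lneg => //; apply: lnegS (lneg_rval (lo R l)) => y [].
    rewrite ditvE /= in_itv /= => /andP[h1 h2] h3.
    by apply: le_anti; rewrite h1 andbT leNgt; apply/negP => h4; apply: h3; rewrite h4 h2.
  - rewrite setDE (_ : _ `&` _ = set0) ?outer_measure0 //; apply/seteqP; split=> // y [].
    by rewrite /= in_itv /= => /andP[/ltW h1 h2]; apply; rewrite ditvE h1 h2.
have hl : hi R l - lo R l = len R l by rewrite hiE addrC addKr.
rewrite h hl drift_block; have := slopeE DD (aff_Diff DD fL (n := m.+1)) wl.
by rewrite /slope => /(congr1 ( *%R^~ (len R l))); rewrite !mulfVK ?l0 // => ->; rewrite subrr.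
Qed.

End OneFunction.
End Inverse.

(** * D followed by I *)

Section LeftInverse.
Variables (R : realType) (Delta : dyadic -> R).
Hypothesis DD : dyadic_diameter Delta.
Local Notation I := (I01 R).
Local Notation d := (dmetric Delta).

Variables (N : nat) (f : I -> R) (L : R).
Hypothesis dbl : doubling N d.
Hypothesis fL : is_lipschitz d f L.
Hypothesis f0 : f (zero01 R) = 0.

Let L0 : 0 <= L. Proof. by case: fL. Qed.

Local Notation aff n := (affinization Delta n f).

Lemma pt_lo_dtop : pt (lo R dtop) = zero01 R.
Proof. by rewrite -(ptK (zero01 R)) lo_dtop. Qed.

Lemma Imap_n_Dmap_block n e x : block Delta n e -> ditv e x ->
  Imap_n Delta n (Dmap Delta f n) x - Imap_n Delta n (Dmap Delta f n) (pt (lo R e)) =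
  aff n x - aff n (pt (lo R e)) - drift f n e * (2 ^+ n * (rval x - lo R e)).
Proof.
move=> be ex; have [mg bg _] := Dmap_ker DD fL n.
have M0 : 0 <= 2 * L by rewrite mulr_ge0.
move: ex; rewrite ditvE => /andP[ex xe].
rewrite (Rint_below DD M0 mg bg); last by rewrite rval_lo.
by rewrite rval_lo (Rint_Dmap DD fL be) // ptK.
Qed.

(** The level-n integral is the increment of the affinizations: the drift of D_n
    on an atom of the previous level is the slope of the previous affinization. *)
Lemma Imap_n_Dmap n x : Imap_n Delta n (Dmap Delta f n) x =
  aff n x - (if n is m.+1 then aff m x else 0).
Proof.
have [mg bg gz] := Dmap_ker DD fL n.
have M0 : 0 <= 2 * L by rewrite mulr_ge0.
have hD k := aff_Diff DD fL (n := k); have hl k := aff_leaf DD fL (n := k).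
case: n mg bg gz => [|m] mg bg gz.
  have := @Imap_n_Dmap_block 0 dtop x erefl (ditv_dtop x).
  rewrite pt_lo_dtop (Imap_n_0 DD M0 mg bg) subr0 /drift mul0r !subr0 => ->.
  rewrite (hD 0 (zero01 R)) ?f0 ?subr0 //; apply: (Diff_lohi DD (e := dtop)).
    by rewrite wt_dtop.
  by left; rewrite lo_dtop.
have [xD|/(notDiffP DD)[l ll lx]] := pselect (Diff Delta m x).
  rewrite (Imap_n_Diff DD M0 mg bg erefl gz xD).
  by rewrite !hD ?subrr //; apply: (Diff_le DD (leqnSn m)).
have xl := dint_ditv lx; have wl := leaf_wt ll.
have loD : Diff Delta m (pt (lo R l)).
  by apply: (Diff_lohi DD wl); left; rewrite rval_lo.
have := @Imap_n_Dmap_block m.+1 l x ll xl.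
rewrite (Imap_n_Diff DD M0 mg bg erefl gz loD) subr0 => ->.
rewrite (hD m.+1 (pt (lo R l))); last exact: (Diff_le DD (leqnSn m)).
have := affine_slope DD (hD m) (hl m) ll xl (ditv_lo R l); rewrite (hD m (pt (lo R l))) // rval_lo.
rewrite /drift; have : 2 ^+ m.+1 != 0 :> R by rewrite expf_neq0.
move: (2 ^+ m.+1) (slope _ _) => p s p0 E.
by rewrite mulrA mulfVK // -E; ring.
Qed.

Lemma series_Imap_Dmap n x :
  series (fun k => Imap_n Delta k (Dmap Delta f k) x) n.+1 = aff n x.
Proof.
rewrite /series /= big_mkord; elim: n => [|n IH].
  by rewrite big_ord_recr big_ord0 /= Imap_n_Dmap subr0 add0r.
by rewrite big_ord_recr /= IH Imap_n_Dmap addrC subrK.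
Qed.

(** The diameters are summable by doubling. *)
Lemma atom_diam_cvg x : atom_diam Delta n x @[n --> \oo] --> 0.
Proof.
apply: cvg_series_cvg_0; apply: nondecreasing_is_cvgn.
  by apply: nondecreasing_series => n _ _; exact: atom_diam_ge0.
exists (2 * (N ^ 3).+1%:R * Delta dtop) => _ [n _ <-].
apply: (sum_atom_diam DD dbl (m := 0) n _ (ditv_dtop x)).
by rewrite wt_dtop.
Qed.

(** On an atom both f and its affinization stay within L times the diameter of the
    value of f at the left end. *)
Lemma aff_near n x : `|aff n x - f x| <= 2 * L * atom_diam Delta n x.
Proof.
have hD := aff_Diff DD fL (n := n); have hl := aff_leaf DD fL (n := n).
have [xD|/(notDiffP DD)[l ll lx]] := pselect (Diff Delta n x).
  by rewrite hD // subrr normr0 !mulr_ge0 // atom_diam_ge0.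
have xl := dint_ditv lx; rewrite (atom_diamE DD ll lx).
rewrite (_ : aff n x - f x = (aff n x - f (pt (lo R l))) - (f x - f (pt (lo R l)))); last by ring.
apply: le_trans (ler_normB _ _) _.
rewrite (_ : 2 * L * Delta l = L * Delta l + L * Delta l); last by ring.
apply: lerD; first exact: (interpolant_near DD fL hD hl (leaf_wt ll)).
exact: (lipschitz_ditv DD fL xl (ditv_lo R l)).
Qed.

Lemma Imap_Dmap : Imap Delta (Dmap Delta f) = f.
Proof.
apply/funext => x; apply: cvg_lim => //; rewrite -cvg_shiftS.
rewrite (_ : [sequence _]_n = (fun n => aff n x)); last first.
  by apply/funext => n; rewrite /= series_Imap_Dmap.
have b0 : 2 * L * atom_diam Delta n x @[n --> \oo] --> 0.
  by rewrite -(mulr0 (2 * L)); apply: cvgMr; exact: atom_diam_cvg.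
have e0 : aff n x - f x @[n --> \oo] --> 0.
  apply/norm_cvg0P; apply: (squeeze_cvgr _ (cvg_cst 0) b0).
  by apply: nearW => n /=; rewrite normr_ge0 aff_near.
rewrite -[f x]add0r; rewrite (_ : (fun n => aff n x) = (fun n => (aff n x - f x) + f x)).
  by apply: cvgD => //; exact: cvg_cst.
by apply/funext => n; rewrite subrK.
Qed.

End LeftInverse.

(** * Norms and kernels of classes of functions *)

Section Norms.
Variables (R : realType) (Delta : dyadic -> R).
Hypothesis DD : dyadic_diameter Delta.
Local Notation I := (I01 R).
Local Notation d := (dmetric Delta).

Lemma Linf_normP n (g : I -> R) (M : R) : (Linf_norm Delta n g <= M%:E)%E <-> ess_bdd Delta n M g.
Proof.
split=> [/ess_supP /aeE|h].
  by apply: mu0_sub => x /= h1 h2; apply: h1; rewrite -lee_fin.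
by apply/ess_supP/aeE; apply: mu0_sub h => x /= h1 h2; apply: h1; rewrite lee_fin.
Qed.

(** Nonnegative because [0,1] has positive measure; the essential supremum over a
    null space would be -oo. *)
Lemma Linf_norm0_ge0 (g : I -> R) : (0 <= Linf_norm Delta 0 g)%E.
Proof.
apply: ess_sup_gee; last first.
  apply/aeE; set A := mkset _; suff -> : A = set0 by exact: outer_measure0.
  by apply/seteqP; split => // x; apply; rewrite lee_fin.
have -> : Hn Delta 0 setT = hausdorffn Delta 0 (ditv dtop).
  by rewrite H_mu; congr (hausdorffn _ _ _); apply/seteqP; split => // x _; exact: ditv_dtop.
by rewrite (@mu_block _ _ DD 0 dtop erefl) lte_fin mulr_gt0 // len_gt0.
Qed.

Lemma sum_normP (g : nat -> I -> R) (M : R) :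
  (sum_norm Delta g <= M%:E)%E <-> forall n, ess_bdd Delta n M (g n).
Proof.
split=> [h n|h].
  by apply/Linf_normP; apply: le_trans h; apply: ereal_sup_ubound; exists n.
by apply: ge_ereal_sup => _ [n _ <-]; apply/Linf_normP.
Qed.

Lemma sum_norm_ge0 (g : nat -> I -> R) : (0 <= sum_norm Delta g)%E.
Proof. by apply: le_trans (Linf_norm0_ge0 (g 0)) _; apply: ereal_sup_ubound; exists 0. Qed.

Lemma sum_kerP (g : nat -> I -> R) :
  sum_ker Delta g <-> exists2 M : R, 0 <= M & kerM Delta M g.
Proof.
split=> [[gk gb]|[M M0 gM]].
  have g0 := sum_norm_ge0 g; have fg : sum_norm Delta g \is a fin_num.
    by rewrite ge0_fin_numE.
  have M0 : 0 <= fine (sum_norm Delta g) by exact: fine_ge0.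
  exists (fine (sum_norm Delta g)) => // n.
  have bn : ess_bdd Delta n (fine (sum_norm Delta g)) (g n).
    by apply: (sum_normP g _).1; rewrite fineK.
  have [[mg _] h] := gk n; split => //.
  by apply/(condexp_zeroP DD M0 mg bn).
split=> [n|].
  have [mg bg gz] := gM n; split; last by apply/(condexp_zeroP DD M0 mg bg).
  by split => //; apply: le_lt_trans (ltry M); apply/Linf_normP.
by apply: le_lt_trans (ltry M); apply/sum_normP => n; have [] := gM n.
Qed.

Lemma lip_norm_ge0 (f : I -> R) : 0 <= lip_norm d f.
Proof.
have [ex|nex] := pselect (exists L, is_lipschitz d f L).
  by apply: lb_le_inf => // L [].
by rewrite /lip_norm (_ : mkset _ = set0) ?inf0 //; apply/seteqP; split => // L hL; apply: nex; exists L.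
Qed.

Lemma lip_norm_le (f : I -> R) L : is_lipschitz d f L -> lip_norm d f <= L.
Proof. by move=> fL; apply: ge_inf => //; exists 0 => M []. Qed.

(** The infimum defining the optimal Lipschitz constant is attained. *)
Lemma lip_norm_lipschitz (f : I -> R) M : (exists L, is_lipschitz d f L) ->
  lip_norm d f <= M -> is_lipschitz d f M.
Proof.
move=> ex fM; have M0 := le_trans (lip_norm_ge0 f) fM; split => // x y.
have d0 : 0 <= d x y by apply: dmetric_ge0 => e; exact/ltW/Delta_gt0.
apply/ler_addgt0Pr => eps eps0.
have e0 : 0 < eps / (d x y + 1) by rewrite divr_gt0 // ltr_wpDl.
have [|L hL Lm] := @inf_adherent _ [set L | is_lipschitz d f L] _ e0.
  by split => //; exists 0 => K [].
case: hL => L0 /(_ x y) /le_trans; apply.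
have h : L <= M + eps / (d x y + 1).
  by apply/ltW/(lt_le_trans Lm); rewrite lerD2r.
apply: le_trans (ler_wpM2r d0 h) _; rewrite mulrDl lerD2l.
move: (d x y) d0 => r r0; have r1 : 0 < r + 1 by rewrite ltr_wpDl.
rewrite mulrAC ler_pdivrMr //; apply: ler_wpM2l; first exact: ltW.
by rewrite lerDl.
Qed.

Variable N : nat.
Hypothesis dbl : doubling N d.

(** I maps both sides to a f + h, and is injective. *)
Lemma Dmap_linear (a : R) f h : Lip0 d f -> Lip0 d h ->
  forall n, eq_ae Delta n (Dmap Delta (fun x => a * f x + h x) n)
                   (fun x => a * Dmap Delta f n x + Dmap Delta h n x).
Proof.
move=> [[L fL] f0] [[L' hL'] h0].
have L0 : 0 <= L by case: fL. have L'0 : 0 <= L' by case: hL'.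
have kL : is_lipschitz d (fun x => a * f x + h x) (`|a| * L + L').
  split=> [|x y]; first by rewrite addr_ge0 // mulr_ge0.
  have -> : a * f x + h x - (a * f y + h y) = a * (f x - f y) + (h x - h y) by ring.
  apply: le_trans (ler_normD _ _) _; rewrite normrM mulrDl -mulrA.
  by apply: lerD; [apply: ler_wpM2l => //; apply: fL.2|apply: hL'.2].
have k0 : a * f (zero01 R) + h (zero01 R) = 0 by rewrite f0 h0 mulr0 addr0.
have M0 : 0 <= 2 * L by rewrite mulr_ge0. have M'0 : 0 <= 2 * L' by rewrite mulr_ge0.
have kf := Dmap_ker DD fL; have kh := Dmap_ker DD hL'.
have K0 : 0 <= 2 * (`|a| * L + L') by rewrite mulr_ge0 //; case: kL.
have K'0 : 0 <= `|a| * (2 * L) + 2 * L' by rewrite addr_ge0 // mulr_ge0.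
apply: (Imap_eq_ae DD dbl K0 K'0 (Dmap_ker DD kL) (kerM_lin DD a M0 M'0 kf kh)).2.
apply: (etrans (Imap_Dmap DD dbl kL k0)); apply/esym.
apply: (etrans (Imap_lin DD dbl a M0 M'0 kf kh)).
have Ef := Imap_Dmap DD dbl fL f0; have Eh := Imap_Dmap DD dbl hL' h0.
exact: (f_equal2 (fun (u v : I -> R) x => a * u x + v x) Ef Eh).
Qed.

End Norms.

(** * The isomorphism *)

Section OperatorNorms.
Variables (R : realType) (Delta : dyadic -> R).
Hypothesis DD : dyadic_diameter Delta.
Local Notation I := (I01 R).
Local Notation d := (dmetric Delta).

Lemma zero_lipschitz : is_lipschitz d (fun=> 0) 0.
Proof. by split => // x y; rewrite subrr normr0 mul0r. Qed.

Lemma zero_Lip0 : Lip0 d (fun=> 0).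
Proof. by split => //; exists 0; exact: zero_lipschitz. Qed.

Lemma Dmap_norm_bounds : (0 <= Dmap_norm Delta <= 2%:E)%E.
Proof.
apply/andP; split.
  apply: le_trans (sum_norm_ge0 DD (Dmap Delta (fun=> 0))) _.
  apply: ereal_sup_ubound; exists (fun=> 0) => //; split; first exact: zero_Lip0.
  by apply: le_trans (lip_norm_le zero_lipschitz) _; exact: ler01.
apply: ge_ereal_sup => _ [f [[fL _] f1] <-].
have f1L := lip_norm_lipschitz DD fL f1.
apply/sum_normP => n; have [_ b _] := Dmap_ker DD f1L n.
by move: b; rewrite mulr1.
Qed.

Lemma Imap_norm_bounds N : doubling N d ->
  (0 <= Imap_norm Delta <= (lip_const R N)%:E)%E.
Proof.
move=> dbl; have k0 := Dmap_ker DD zero_lipschitz.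
apply/andP; split.
  apply: (@le_trans _ _ (lip_norm d (Imap Delta (Dmap Delta (fun=> 0))))%:E).
    by rewrite lee_fin; exact: lip_norm_ge0.
  apply: ereal_sup_ubound; exists (Dmap Delta (fun=> 0)) => //; split.
    by apply/(sum_kerP DD); exists (2 * 0) => //; rewrite mulr0.
  apply: (@le_trans _ _ (2 * 0)%:E); last by rewrite lee_fin mulr0 ler01.
  by apply/sum_normP => n; have [] := k0 n.
apply: ge_ereal_sup => _ [g [gk g1] <-].
have [M M0 gM] := (sum_kerP DD g).1 gk.
have g1M : kerM Delta 1 g.
  by move=> n; have [mg _ gz] := gM n; split => //; exact: (sum_normP Delta g 1).1 g1 n.
rewrite lee_fin -[leRHS]mulr1; apply: lip_norm_le.
exact: (Imap_lipschitz DD dbl ler01 g1M).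
Qed.

End OperatorNorms.

Theorem theorem3p35 (R : realType) :
  exists C : nat -> R,
  forall (Delta : dyadic -> R) (N : nat),
    dyadic_diameter Delta ->
    doubling N (dmetric Delta) ->
    Delta (child false dtop) = 1 ->
    Delta (child true dtop) = 1 ->
    (forall f, Lip0 (dmetric Delta) f -> sum_ker Delta (Dmap Delta f)) /\
    (forall (a : R) f h, Lip0 (dmetric Delta) f -> Lip0 (dmetric Delta) h ->
       forall n, eq_ae Delta n (Dmap Delta (fun x => a * f x + h x) n)
                   (fun x => a * Dmap Delta f n x + Dmap Delta h n x)) /\
    (forall g, sum_ker Delta g ->
       (forall x, cvgn (series (fun n => `|Imap_n Delta n (g n) x|))) /\
       Lip0 (dmetric Delta) (Imap Delta g)) /\
    (forall g h, sum_ker Delta g -> sum_ker Delta h ->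
       (forall n, eq_ae Delta n (g n) (h n)) -> Imap Delta g = Imap Delta h) /\
    (forall (a : R) g h, sum_ker Delta g -> sum_ker Delta h ->
       Imap Delta (fun n x => a * g n x + h n x)
       = (fun x => a * Imap Delta g x + Imap Delta h x)) /\
    (forall f, Lip0 (dmetric Delta) f -> Imap Delta (Dmap Delta f) = f) /\
    (forall g, sum_ker Delta g ->
       forall n, eq_ae Delta n (Dmap Delta (Imap Delta g) n) (g n)) /\
    Dmap_norm Delta \is a fin_num /\
    Imap_norm Delta \is a fin_num /\
    (Dmap_norm Delta * Imap_norm Delta <= (C N)%:E)%E.
Proof.
exists (fun N => 2 * lip_const R N) => Delta N DD dbl _ _.
have /andP[D0 D2] := Dmap_norm_bounds DD; have /andP[I0 IL] := Imap_norm_bounds DD dbl.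
have kD f L : is_lipschitz (dmetric Delta) f L -> 0 <= 2 * L /\ kerM Delta (2 * L) (Dmap Delta f).
  by move=> fL; split; [case: fL => L0 _; rewrite mulr_ge0|exact: (Dmap_ker DD fL)].
split; first by move=> f [[L /kD[L0 k]] _]; apply/(sum_kerP DD); exists (2 * L).
split; first by move=> a f h; exact: (Dmap_linear DD dbl).
split.
  move=> g /(sum_kerP DD)[M M0 gM]; split; last exact: (Imap_Lip0 DD dbl M0 gM).
  by move=> x; exact: (Imap_abs_cvg DD dbl M0 gM).
split.
  move=> g h /(sum_kerP DD)[M M0 gM] /(sum_kerP DD)[M' M'0 hM].
  exact: (Imap_eq_ae DD dbl M0 M'0 gM hM).1.
split.
  move=> a g h /(sum_kerP DD)[M M0 gM] /(sum_kerP DD)[M' M'0 hM].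
  exact: (Imap_lin DD dbl a M0 M'0 gM hM).
split; first by move=> f [[L fL] f0]; exact: (Imap_Dmap DD dbl fL f0).
split.
  move=> g /(sum_kerP DD)[M M0 gM].
  have [[L fL] f0] := Imap_Lip0 DD dbl M0 gM; have [L0 k] := kD _ _ fL.
  apply: (Imap_eq_ae DD dbl L0 M0 k gM).2.
  exact: (Imap_Dmap DD dbl fL f0).
have fD : Dmap_norm Delta \is a fin_num by rewrite ge0_fin_numE //; exact: le_lt_trans D2 (ltry _).
have fI : Imap_norm Delta \is a fin_num by rewrite ge0_fin_numE //; exact: le_lt_trans IL (ltry _).
split => //; split => //.
by rewrite EFinM; exact: lee_pmul.
Qed.
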